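(* Let $f:\mathbb{R}^d\to\mathbb{R}$ be convex, twice differentiable with $L$-Lipschitz continuous Hessian ($L>0$), and with at least one minimizer $x^*\in\arg\min_{x\in\mathbb{R}^d}f(x)$. Let $x_0\in\mathbb{R}^d$, $R_0=\|x_0-x^*\|$, $\epsilon>0$, and let $m\ge2$ be an integer. Set $$\gamma=\Theta(L/m^{4/3}),\qquad \sigma\in(0,0.99]\ \text{(a fixed constant)},$$ $$S=\Theta\Big(\ln\Big(\tfrac1\sigma\big(\tfrac{L+2\gamma}{\gamma}\big)^{2/3}\Big)\Big),\qquad N=\Theta\Big(m^{1/3}\sqrt{\tfrac{L+2\gamma}{\gamma}}\Big).$$ Then, for a suitable number $T$ of outer iterations, the algorithm CALEN$(f,x_0,T)$ (described in the context, with Hessian-update period $m$) finds an $\epsilon$-global solution, i.e. returns $x_T$ with $f(x_T)-f(x^* )\le\epsilon$, in total $$TSN=\mathcal{O}\Big(\big(m+m^{13/21}(LR_0^3/\epsilon)^{2/7}\big)\ln m\Big)$$ iterations. In particular, choosing $m=\Theta(\bar d)$, where $\bar d$ is the effective dimension, the equivalent gradient complexity of CALEN for finding an $\epsilon$-global solution is $\mathcal{O}\big((\bar d+\bar d^{13/21}(LR_0^3/\epsilon)^{2/7})\ln\bar d\big)$.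
   Context: Norms are Euclidean (vectors) and spectral (matrices). $\mathbb{B}_D^d(0)=\{x\in\mathbb{R}^d:\|x\|\le D\}$. For an integer $m\ge1$, $\pi(n)=n-(n\bmod m)$. $L$-Lipschitz Hessian: $\|\nabla^2 f(x)-\nabla^2 f(x')\|\le L\|x-x'\|$ for all $x,x'$. Asymptotic notation: $\mathcal{O}$ and $\Theta$ hide only universal numerical constants (and the fixed constant $\sigma$). ''Setting a parameter $=\Theta(E)$'' means it is set to a suitably chosen universal constant times $E$ (rounded to a positive integer for integer parameters); the claim is that such universal constants exist. (1) Algorithm NALEN$(h,x_0,N)$ for a function $h$ with $M$-Lipschitz Hessian and $H_0:=h(x_0)-\inf h$, period $m$, with parameters $T'=\Theta(m^{1/3})$, $D=\Theta((H_0/(NMm^{2/3}))^{1/3})$, $\eta=\Theta(1/(mMD))$: if $H_0=0$ return $x_0$. Otherwise set $v_0=\Delta_0=-D\nabla h(x_0)/\|\nabla h(x_0)\|$ ($0/0:=0$), $K=\lfloor N/T'\rfloor$, and for $n=0,\dots,N-1$: $z_n=x_n+\frac12\Delta_n$; $\Delta_{n+1}\in\arg\min_{\Delta\in\mathbb{B}_D^d(0)}\langle\nabla h(z_n),\Delta\rangle+\frac14\langle\nabla^2h(z_{\pi(n)})(\Delta-\Delta_n),\Delta-\Delta_n\rangle+\frac1{2\eta}\|\Delta-v_n\|^2$; $x_{n+1}=x_n+\Delta_{n+1}$, $y_{n+1}=x_n+\frac12\Delta_{n+1}$; $v_{n+1}=\arg\min_{v\in\mathbb{B}_D^d(0)}\langle\nabla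 h(y_{n+1}),v\rangle+\frac1{2\eta}\|v-v_n\|^2$. Return the point with smallest $\|\nabla h\|$ among $\bar y^{(k)}=\frac1{T'}\sum_{t=1}^{T'}y_{(k-1)T'+t}$, $k=1,\dots,K$. (2) Sub-solver. For $x\in\mathbb{R}^d$ let $f_{x,\gamma}(y)=f(y)+\frac\gamma3\|y-x\|^3$, whose Hessian is $(L+2\gamma)$-Lipschitz. The sub-solver at $x$ computes $y_0=\arg\min_y\langle\nabla f(x),y\rangle+\frac12\langle\nabla^2f(x)(y-x),y-x\rangle+\frac{L+2\gamma}{3}\|y-x\|^3$, then $y_{s+1}=$ NALEN$(f_{x,\gamma},y_s,N)$ for $s=0,1,\dots,S$ (with $M=L+2\gamma$), and returns $\mathrm{Sub}(x):=y_{S+1}$. (3) Algorithm CALEN$(f,x_0,T)$: set $v_0=\bar x_0=x_0$, $A_0=0$, $y_0=\mathrm{Sub}(x_0)$, $\lambda_0'=\lambda_0=1/(\gamma\|y_0-x_0\|)$. For $t=0,\dots,T-1$: - $a_{t+1}'=\frac12\big(\lambda_t'+\sqrt{(\lambda_t')^2+4\lambda_t'A_t}\big)$, $A_{t+1}'=A_t+a_{t+1}'$, $\bar x_t=(A_tx_t+a_{t+1}'v_t)/A_{t+1}'$; - if $t>0$: $y_t=\mathrm{Sub}(\bar x_t)$, $\lambda_t=1/(\gamma\|y_t-\bar x_t\|)$; - if $\lambda_t\ge\lambda_t'$: $a_{t+1}=a_{t+1}'$, $A_{t+1}=A_{t+1}'$, $x_{t+1}=y_t$, $\lambda_{t+1}'=2\lambda_t'$;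 else: $\beta_t=\lambda_t/\lambda_t'$, $a_{t+1}=\beta_ta_{t+1}'$, $A_{t+1}=A_t+a_{t+1}$, $x_{t+1}=((1-\beta_t)A_tx_t+\beta_tA_{t+1}'y_t)/A_{t+1}$, $\lambda_{t+1}'=\lambda_t'/2$; - $v_{t+1}=v_t-a_{t+1}\nabla f(y_t)$. Return $x_T$. If at some step $y_t=\bar x_t$ (so that $\lambda_t$ would be infinite), stop and return $y_t$. Complexity model: let $c_H,c_g$ be the costs of one Hessian and one gradient evaluation; the effective dimension is $\bar d:=c_H/c_g$, with $2\le\bar d\le d$. An algorithm making $n_H$ Hessian and $n_g$ gradient evaluations has equivalent gradient complexity $\bar d\,n_H+n_g$. ''Total iterations'' counts NALEN iterations over all sub-solver calls, up to a universal constant. *)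

(* Defs.v *)
From HB Require Import structures.
From mathcomp Require Import all_boot all_order all_algebra.
From mathcomp Require Import all_classical all_reals all_analysis.

Set Implicit Arguments.
Unset Strict Implicit.
Unset Printing Implicit Defensive.

Import Order.TTheory GRing.Theory Num.Theory.
Import numFieldNormedType.Exports.

Local Open Scope classical_set_scope.
Local Open Scope ring_scope.

(* The library norm on 'rV[R]_d is the sup norm; it induces the same topology,
   hence the same differentials, but lengths below are measured by l2norm. *)
Definition dot (R : realType) (d : nat) (u v : 'rV[R]_d) : R :=
  \sum_(i < d) u ord0 i * v ord0 i.

Definition l2norm (R : realType) (d : nat) (u : 'rV[R]_d) : R :=
  Num.sqrt (dot u u).

Definition l2ball (R : realType) (d : nat) (r : R) : set 'rV[R]_d :=
  [set u | l2norm u <= r].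

Definition spectral_norm (R : realType) (d : nat) (A : 'M[R]_d) : R :=
  sup [set l2norm (u *m A) | u in @l2ball R d 1].

Definition grad (R : realType) (d : nat) (f : 'rV[R]_d -> R) (x : 'rV[R]_d) :
  'rV[R]_d := \row_i 'D_(delta_mx ord0 i) f x.

(* Row-vector convention: the differential of grad f at x is u |-> u *m hess f x. *)
Definition hess (R : realType) (d : nat) (f : 'rV[R]_d -> R) (x : 'rV[R]_d) :
  'M[R]_d := jacobian (grad f) x.

Definition twice_differentiable (R : realType) (d : nat) (f : 'rV[R]_d -> R) :
  Prop :=
  (forall x, differentiable f x) /\ (forall x, differentiable (grad f) x).

Definition lipschitz_hessian (R : realType) (d : nat) (L : R)
    (f : 'rV[R]_d -> R) : Prop :=
  forall x x', spectral_norm (hess f x - hess f x') <= L * l2norm (x - x').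

Definition argmin_on (R : realType) (T : Type) (A : set T) (phi : T -> R) :
  set T := [set x | A x /\ forall y, A y -> phi x <= phi y].

(* Rounding up: a positive integer whenever x is positive. *)
Definition nat_ceil (R : realType) (x : R) : nat := absz (Num.ceil x).

(* Oracle usage: NALEN iterations, Hessian and gradient evaluations. *)
Record cost := Cost { n_iter : nat; n_hess : nat; n_grad : nat }.

Definition add_cost (c c' : cost) : cost :=
  Cost (n_iter c + n_iter c') (n_hess c + n_hess c') (n_grad c + n_grad c').

Definition no_cost : cost := Cost 0 0 0.

Definition equivalent_gradients (R : realType) (dbar : R) (c : cost) : R :=
  dbar * (n_hess c)%:R + (n_grad c)%:R.

(* The universal factors hidden in the Theta's of the parameter choices. *)
Record constants (R : realType) := Constants {
  c_gamma : R; c_S : R; c_N : R; c_T' : R; c_D : R; c_eta : R }.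

Definition positive_constants (R : realType) (k : constants R) : Prop :=
  [/\ 0 < c_gamma k, 0 < c_S k & 0 < c_N k] /\
  [/\ 0 < c_T' k, 0 < c_D k & 0 < c_eta k].

Definition period_start (m n : nat) : nat := (n - n %% m)%N.

Section nalen.
Variables (R : realType) (d : nat) (k : constants R).
(* M is the Lipschitz constant of the Hessian of h, m the Hessian period. *)
Variables (m : nat) (M : R) (h : 'rV[R]_d -> R) (x0 : 'rV[R]_d) (N : nat).

Definition nalen_H0 : R := h x0 - inf (range h).

Definition nalen_T' : nat := nat_ceil (c_T' k * m%:R `^ (1 / 3)).

Definition nalen_D : R :=
  c_D k * (nalen_H0 / (N%:R * M * m%:R `^ (2 / 3))) `^ (1 / 3).

Definition nalen_eta : R := c_eta k / (m%:R * M * nalen_D).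

Definition nalen_K : nat := (N %/ nalen_T')%N.

Definition nalen_trace (x z y Delta v : nat -> 'rV[R]_d) : Prop :=
  [/\ x 0%N = x0,
      v 0%N = - (nalen_D / l2norm (grad h x0)) *: grad h x0,
      Delta 0%N = v 0%N &
      forall n, (n < N)%N ->
        [/\ z n = x n + 2^-1 *: Delta n,
            argmin_on (l2ball nalen_D) (fun D =>
                dot (grad h (z n)) D
                + 4^-1 * dot ((D - Delta n) *m hess h (z (period_start m n)))
                             (D - Delta n)
                + (2 * nalen_eta)^-1 * l2norm (D - v n) ^+ 2)
              (Delta n.+1),
            x n.+1 = x n + Delta n.+1,
            y n.+1 = x n + 2^-1 *: Delta n.+1 &
            argmin_on (l2ball nalen_D) (fun w =>
                dot (grad h (y n.+1)) w
                + (2 * nalen_eta)^-1 * l2norm (w - v n) ^+ 2)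
              (v n.+1)]].

(* block_average y j is the average over the (j+1)-st block of T' iterates. *)
Definition block_average (y : nat -> 'rV[R]_d) (j : nat) : 'rV[R]_d :=
  (nalen_T'%:R)^-1 *: \sum_(1 <= t < nalen_T'.+1) y (j * nalen_T' + t)%N.

(* A Hessian is evaluated only when period_start m n = n; gradients are
   evaluated at x0, at all z n and y n.+1, and at the K block averages. *)
Definition nalen_cost : cost :=
  Cost N (count (fun n => period_start m n == n) (iota 0 N))
    (1 + 2 * N + nalen_K).

Inductive nalen : 'rV[R]_d -> cost -> Prop :=
| nalen_minimizer : nalen_H0 = 0 -> nalen x0 no_cost
| nalen_return x z y Delta v j :
    nalen_H0 <> 0 -> nalen_trace x z y Delta v -> (j < nalen_K)%N ->
    (forall i, (i < nalen_K)%N ->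
       l2norm (grad h (block_average y j))
         <= l2norm (grad h (block_average y i))) ->
    nalen (block_average y j) nalen_cost.

End nalen.

Section subsolver.
Variables (R : realType) (d : nat) (k : constants R).
Variables (m : nat) (L gamma : R) (S N : nat) (f : 'rV[R]_d -> R).

Definition cubic_regularized (x y : 'rV[R]_d) : R :=
  f y + gamma / 3 * l2norm (y - x) ^+ 3.

Definition cubic_model (x y : 'rV[R]_d) : R :=
  dot (grad f x) y + 2^-1 * dot ((y - x) *m hess f x) (y - x)
  + (L + 2 * gamma) / 3 * l2norm (y - x) ^+ 3.

Definition subsolver (x out : 'rV[R]_d) (c : cost) : Prop :=
  exists (y : nat -> 'rV[R]_d) (cs : nat -> cost),
    [/\ argmin_on setT (cubic_model x) (y 0%N),
        forall s, (s <= S)%N ->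
          nalen k m (L + 2 * gamma) (cubic_regularized x) (y s) N
            (y s.+1) (cs s),
        out = y S.+1 &
        c = add_cost (Cost 0 1 1) (\big[add_cost/no_cost]_(s < S.+1) cs s)].

End subsolver.

Record calen_state (R : realType) (d : nat) := CalenState {
  st_x : 'rV[R]_d; st_v : 'rV[R]_d; st_A : R; st_lambda' : R }.

Section calen.
Variables (R : realType) (d : nat) (gamma : R) (f : 'rV[R]_d -> R).
Variable sub : 'rV[R]_d -> 'rV[R]_d -> cost -> Prop.
Variable x0 : 'rV[R]_d.

Definition step_a' (s : calen_state R d) : R :=
  2^-1 * (st_lambda' s
          + Num.sqrt (st_lambda' s ^+ 2 + 4 * st_lambda' s * st_A s)).

Definition step_A' (s : calen_state R d) : R := st_A s + step_a' s.

Definition step_xbar (s : calen_state R d) : 'rV[R]_d :=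
  (step_A' s)^-1 *: (st_A s *: st_x s + step_a' s *: st_v s).

Definition step_lambda (xbar y : 'rV[R]_d) : R := 1 / (gamma * l2norm (y - xbar)).

Definition calen_step (s : calen_state R d) (y : 'rV[R]_d) (lambda : R) :
    calen_state R d :=
  if st_lambda' s <= lambda then
    CalenState y (st_v s - step_a' s *: grad f y) (step_A' s)
      (2 * st_lambda' s)
  else
    let beta := lambda / st_lambda' s in
    let a := beta * step_a' s in
    let A := st_A s + a in
    CalenState
      (A^-1 *: (((1 - beta) * st_A s) *: st_x s + (beta * step_A' s) *: y))
      (st_v s - a *: grad f y) A (st_lambda' s / 2).

(* calen_reaches t s c: t outer iterations are completed without stopping,
   s is the resulting state and c the total cost so far. *)
Inductive calen_reaches : nat -> calen_state R d -> cost -> Prop :=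
| calen_first y c :
    sub x0 y c -> y <> x0 ->
    calen_reaches 1
      (calen_step (CalenState x0 x0 0 (step_lambda x0 y)) y (step_lambda x0 y))
      (add_cost c (Cost 0 0 1))
| calen_next t s c y c' :
    calen_reaches t s c ->
    sub (step_xbar s) y c' -> y <> step_xbar s ->
    calen_reaches t.+1 (calen_step s y (step_lambda (step_xbar s) y))
      (add_cost (add_cost c c') (Cost 0 0 1)).

(* The initial call to the sub-solver is made, and charged, even if T = 0. *)
Inductive calen_returns (T : nat) : 'rV[R]_d -> cost -> Prop :=
| calen_no_iteration y c : T = 0%N -> sub x0 y c -> calen_returns T x0 c
| calen_finish s c : calen_reaches T s c -> calen_returns T (st_x s) c
| calen_stop_first y c :
    (0 < T)%N -> sub x0 y c -> y = x0 -> calen_returns T y c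
| calen_stop t s c y c' :
    (t < T)%N -> calen_reaches t s c ->
    sub (step_xbar s) y c' -> y = step_xbar s ->
    calen_returns T y (add_cost c c').

End calen.

Definition calen_gamma (R : realType) (k : constants R) (L : R) (m : nat) : R :=
  c_gamma k * (L / m%:R `^ (4 / 3)).

Definition calen_S (R : realType) (k : constants R) (sigma L : R) (m : nat) :
    nat :=
  let gamma := calen_gamma k L m in
  nat_ceil (c_S k * ln (1 / sigma * ((L + 2 * gamma) / gamma) `^ (2 / 3))).

Definition calen_N (R : realType) (k : constants R) (L : R) (m : nat) : nat :=
  let gamma := calen_gamma k L m in
  nat_ceil (c_N k * (m%:R `^ (1 / 3) * Num.sqrt ((L + 2 * gamma) / gamma))).

Definition calen (R : realType) (d : nat) (k : constants R) (sigma L : R)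
    (m : nat) (f : 'rV[R]_d -> R) (x0 : 'rV[R]_d) (T : nat)
    (out : 'rV[R]_d) (c : cost) : Prop :=
  let gamma := calen_gamma k L m in
  calen_returns gamma f
    (subsolver k m L gamma (calen_S k sigma L m) (calen_N k L m) f)
    x0 T out c.

(* The rate for a period (or effective dimension) q. *)
Definition calen_rate (R : realType) (L R0 eps q : R) : R :=
  (q + q `^ (13 / 21) * (L * R0 ^+ 3 / eps) `^ (2 / 7)) * ln q.

(* Main.v *)
(* The outer loop is an accelerated proximal method with an adaptive step size. With
   E = A (f(x) - f(xstar)) + |v - xstar|^2 / 2, every sub-solver output y at xbar satisfying
   |grad f(y) + gamma |y - xbar| (y - xbar)| <= sigma gamma |y - xbar|^2 makes E decrease,
   and a step halving lambda' makes it decrease by a multiple of A' / (gamma^2 lambda'^3).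
   At such a step s + s^-6 >= 1 for s = w lambda'^(1/2) A'^(-1/6) and any w > 0. The sum
   of the terms s^-6 is bounded by the decrease of E, that of the terms s by the potential
   5 A^(1/3) - lambda'^(1/2) A^(-1/6), which never decreases because a step doubling
   lambda' raises A^(1/2) by at least lambda'^(1/2) / 2. Optimizing w gives
   T^7 <= K (gamma R0 A)^2, that is f(x_T) - f(xstar) = O(gamma R0^3 / T^(7/2)).

   One NALEN run is online-to-nonconvex conversion: x_{n+1} - x_n is played by an
   optimistic mirror descent whose hint uses the lazy Hessian, the regret over a block of
   T' steps against - D G / |G|, with G the sum of the gradients of the block, bounds |G|,
   and averaging over the block costs only a second-order term. The output gradient
   satisfies |grad h|^3 N^2 <= 35^3 M m^(2/3) H0^2. Since |.|^3 is uniformly convex,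
   gamma H^2 <= 8 |grad h|^3, so the gap contracts by a constant at each of the S + 1
   runs, and comparing the minimizer of the cubic model with the proximal point bounds
   the initial gap by a power of (L + 2 gamma) / gamma. *)
Require Import Defs.
From HB Require Import structures.
From mathcomp Require Import all_boot all_order all_algebra.
From mathcomp Require Import all_classical all_reals all_analysis.
From mathcomp Require Import ring lra.

Set Implicit Arguments.
Unset Strict Implicit.
Unset Printing Implicit Defensive.

Import Order.TTheory GRing.Theory Num.Theory.
Import numFieldNormedType.Exports.

Local Open Scope classical_set_scope.
Local Open Scope ring_scope.

(** * Euclidean geometry and calculus of row vectors *)

(** The potential argument counts only the steps that halve lambda'. The doublings are controlled
    separately: if they exceed the halvings by j, then lambda' = lambda_0 2^j, which never exceeds 2
    A, while the first step gives 1 - sigma^2 <= (gamma R0 lambda_0)^2; so j is at most logarithmic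
    in gamma R0 A. The obstacle in the sub-solver is that its target accuracy is relative to the
    distance |y - x| of its own output. It is aimed instead at the distance rho from x to the exact
    proximal point: the minimizer of the cubic model already has gradient O(M rho^2) with M = L + 2
    gamma, and a gradient of size sigma gamma rho^2 / 192 meets the target. The number of runs thus
    depends only on sigma and on M / gamma = m^(4/3) + 2, which is the origin of the factor ln m.
    Smoothness constants are not sharp: the regularized function is analysed with 2 M in place of M,
    and the factor is absorbed by eta = 1 / (8 m M D). *)

Section dot_product.
Variables (R : realType) (d : nat).
Implicit Types (u v w : 'rV[R]_d) (a : R).

Lemma dotC u v : dot u v = dot v u.
Proof. by apply: eq_bigr => i _; rewrite mulrC. Qed.

Lemma dotDl u v w : dot (u + v) w = dot u w + dot v w.
Proof. by rewrite /dot -big_split; apply: eq_bigr => i _; rewrite mxE mulrDl. Qed.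

Lemma dotZl a u v : dot (a *: u) v = a * dot u v.
Proof. by rewrite /dot mulr_sumr; apply: eq_bigr => i _; rewrite mxE mulrA. Qed.

Lemma dotNl u v : dot (- u) v = - dot u v.
Proof. by rewrite -scaleN1r dotZl mulN1r. Qed.

Lemma dotBl u v w : dot (u - v) w = dot u w - dot v w.
Proof. by rewrite dotDl dotNl. Qed.

Lemma dotDr u v w : dot u (v + w) = dot u v + dot u w.
Proof. by rewrite dotC dotDl !(dotC _ u). Qed.

Lemma dotZr a u v : dot u (a *: v) = a * dot u v.
Proof. by rewrite dotC dotZl dotC. Qed.

Lemma dotNr u v : dot u (- v) = - dot u v.
Proof. by rewrite dotC dotNl dotC. Qed.

Lemma dotBr u v w : dot u (v - w) = dot u v - dot u w.
Proof. by rewrite dotDr dotNr. Qed.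

Lemma dot0l u : dot 0 u = 0.
Proof. by rewrite -(scale0r u) dotZl mul0r. Qed.

Lemma dot0r u : dot u 0 = 0.
Proof. by rewrite dotC dot0l. Qed.

Definition dotE := (dotDl, dotDr, dotNl, dotNr, dotZl, dotZr, dot0l, dot0r).

Lemma dot_ge0 u : 0 <= dot u u.
Proof. by apply: sumr_ge0 => i _; rewrite -expr2 sqr_ge0. Qed.

Lemma dot_eq0 u : dot u u = 0 -> u = 0.
Proof.
move=> /eqP; rewrite psumr_eq0; last by move=> i _; rewrite -expr2 sqr_ge0.
move=> /allP u0; apply/rowP => i; rewrite mxE; apply/eqP.
by have := u0 i (mem_index_enum _); rewrite /= mulf_eq0 orbb.
Qed.

Lemma l2norm_ge0 u : 0 <= l2norm u.
Proof. exact: sqrtr_ge0. Qed.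

Lemma l2norm_sqr u : l2norm u ^+ 2 = dot u u.
Proof. by rewrite sqr_sqrtr// dot_ge0. Qed.

Lemma l2norm0 : l2norm (0 : 'rV[R]_d) = 0.
Proof. by rewrite /l2norm dot0l sqrtr0. Qed.

Lemma l2norm_eq0 u : l2norm u = 0 -> u = 0.
Proof. by move=> u0; apply: dot_eq0; rewrite -l2norm_sqr u0 expr0n. Qed.

Lemma l2normZ a u : l2norm (a *: u) = `|a| * l2norm u.
Proof.
by rewrite /l2norm !dotE mulrA -expr2 sqrtrM ?sqr_ge0// sqrtr_sqr.
Qed.

Lemma l2normN u : l2norm (- u) = l2norm u.
Proof. by rewrite -scaleN1r l2normZ normrN1 mul1r. Qed.

Lemma l2distC u v : l2norm (u - v) = l2norm (v - u).
Proof. by rewrite -l2normN opprB. Qed.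

Lemma Cauchy_Schwarz u v : dot u v <= l2norm u * l2norm v.
Proof.
have [/eqP v0|v0] := boolP (l2norm v == 0).
  by rewrite (l2norm_eq0 v0) dot0r l2norm0 mulr0.
have [/eqP u0|u0] := boolP (l2norm u == 0).
  by rewrite (l2norm_eq0 u0) dot0l l2norm0 mul0r.
have := dot_ge0 (l2norm v *: u - l2norm u *: v).
rewrite !dotE -!l2norm_sqr (dotC v u).
have up : 0 < l2norm u by rewrite lt_def u0 l2norm_ge0.
have vp : 0 < l2norm v by rewrite lt_def v0 l2norm_ge0.
have uvp := mulr_gt0 up vp.
move=> h; have {h} : 0 <= 2 * (l2norm u * l2norm v) * (l2norm u * l2norm v - dot u v).
  by lra.
by rewrite pmulr_rge0 ?subr_ge0// mulr_gt0.
Qed.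

Lemma Cauchy_Schwarz_abs u v : `|dot u v| <= l2norm u * l2norm v.
Proof.
rewrite ler_norml Cauchy_Schwarz andbT lerNl -dotNl.
by rewrite (le_trans (Cauchy_Schwarz _ _))// l2normN.
Qed.

Lemma l2normD u v : l2norm (u + v) <= l2norm u + l2norm v.
Proof.
rewrite -(@ler_pXn2r _ 2)// ?nnegrE ?addr_ge0 ?l2norm_ge0// l2norm_sqr !dotE.
rewrite -!l2norm_sqr (dotC v u).
by have := Cauchy_Schwarz u v; lra.
Qed.

Lemma l2normB u v : l2norm (u - v) <= l2norm u + l2norm v.
Proof. by rewrite -(l2normN v) l2normD. Qed.

Lemma l2norm_sub_le u v : `|l2norm u - l2norm v| <= l2norm (u - v).
Proof.
rewrite ler_norml; apply/andP; split.
  by have := l2normB u (u - v); rewrite opprB addrC subrK; lra.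
by have := l2normD (u - v) v; rewrite subrK; lra.
Qed.

Lemma l2norm_sum (I : Type) (r : seq I) (P : pred I) (F : I -> 'rV[R]_d) :
  l2norm (\sum_(i <- r | P i) F i) <= \sum_(i <- r | P i) l2norm (F i).
Proof.
elim/big_rec2: _ => [|i a s _ ih]; first by rewrite l2norm0.
by rewrite (le_trans (l2normD _ _))// lerD2l.
Qed.

Lemma norm_coord_le_l2norm u i : `|u ord0 i| <= l2norm u.
Proof.
rewrite -(@ler_pXn2r _ 2)// ?nnegrE ?l2norm_ge0// l2norm_sqr real_normK ?num_real//.
by rewrite /dot (bigD1 i)//= expr2 lerDl sumr_ge0// => j _; rewrite -expr2 sqr_ge0.
Qed.

Lemma coord_le_norm u i : `|u ord0 i| <= `|u|.
Proof.
by rewrite [leRHS]/Num.norm /= mx_normrE; exact: (le_bigmax _ _ (ord0, i)).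
Qed.

Lemma norm_le_l2norm u : `|u| <= l2norm u.
Proof.
rewrite [leLHS]/Num.norm /= mx_normrE; apply/bigmax_leP; split.
  exact: l2norm_ge0.
by move=> [i j] _; rewrite [i]ord1; exact: norm_coord_le_l2norm.
Qed.

Lemma l2norm_le_norm u : l2norm u <= d%:R * `|u|.
Proof.
rewrite -(@ler_pXn2r _ 2)// ?nnegrE ?l2norm_ge0 ?mulr_ge0// l2norm_sqr.
have [d0|d0] := posnP d.
  by rewrite /dot big1 ?sqr_ge0// => -[i id]; exfalso; move: id; rewrite d0.
have le_norm i : u ord0 i * u ord0 i <= `|u| ^+ 2.
  by rewrite -expr2 -real_normK ?num_real// lerXn2r ?nnegrE// coord_le_norm.
apply: (@le_trans _ _ (\sum_(i < d) `|u| ^+ 2)); first exact: ler_sum.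
rewrite sumr_const card_ord -[leLHS]mulr_natl exprMn ler_wpM2r ?sqr_ge0//.
by rewrite -natrX ler_nat leq_pmulr.
Qed.

End dot_product.

Section calculus.
Variables (R : realType) (d : nat).
Implicit Types (W : normedModType R) (u v x y : 'rV[R]_d).

Lemma mulmx_l2norm_bounded n (A : 'M[R]_(d, n)) :
  exists2 K, 0 <= K & forall u, l2norm (u *m A) <= K * l2norm u.
Proof.
exists (\sum_(i < d) l2norm (row i A)).
  by apply: sumr_ge0 => i _; exact: l2norm_ge0.
move=> u; rewrite mulmx_sum_row (le_trans (l2norm_sum _ _ _))// mulr_suml.
apply: ler_sum => i _; rewrite l2normZ mulrC ler_wpM2l ?l2norm_ge0//.
exact: norm_coord_le_l2norm.
Qed.

Lemma near_l2norm_lt (e : R) : 0 < e -> \forall u \near (0 : 'rV[R]_d), l2norm u < e.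
Proof.
move=> e0; have D0 : 0 < d.+1%:R :> R by [].
have e'0 : 0 < e / d.+1%:R by rewrite divr_gt0.
near=> u; apply: (le_lt_trans (l2norm_le_norm u)).
rewrite (@le_lt_trans _ _ (d.+1%:R * `|u|))// ?ler_wpM2r ?ler_nat//.
rewrite mulrC -ltr_pdivlMr//; near: u.
Unshelve. all: by end_near. Qed.

(** Passes from an estimate in [l2norm] to the topology of ['rV], which is that of the sup norm. *)
Lemma l2_lipschitz_continuous W (F : 'rV[R]_d -> W) :
  (forall x, exists K, forall u, l2norm u <= 1 -> `|F (x + u) - F x| <= K * l2norm u) ->
  continuous F.
Proof.
move=> FK x; suff : {for 0, continuous (F \o shift x)} by rewrite -continuous_shift.
have [K HK] := FK x.
apply/(@cvgrPdist_lt _ _ _ (nbhs (0 : 'rV[R]_d))) => e e0; rewrite /= add0r.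
have K0 : 0 < `|K| + 1 by rewrite ltr_wpDl.
near=> u; rewrite distrC [u + x]addrC.
have u1 : l2norm u < 1 by near: u; exact: near_l2norm_lt.
have ue : l2norm u < e / (`|K| + 1).
  by near: u; apply: near_l2norm_lt; rewrite divr_gt0.
rewrite (le_lt_trans (HK u (ltW u1)))//.
rewrite (@le_lt_trans _ _ ((`|K| + 1) * l2norm u))//; last by rewrite mulrC -ltr_pdivlMr.
by rewrite ler_wpM2r ?l2norm_ge0// (le_trans (ler_norm _))// lerDl.
Unshelve. all: by end_near. Qed.

Lemma l2_bounded_linear_continuous W (F : {linear 'rV[R]_d -> W}) K :
  (forall u, `|F u| <= K * l2norm u) -> continuous F.
Proof.
by move=> FK; apply: l2_lipschitz_continuous => x; exists K => u _; rewrite linearD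
    addrC addKr.
Qed.

Lemma continuous_mulmxr n (A : 'M[R]_(d, n)) : continuous (fun u : 'rV[R]_d => u *m A).
Proof.
have [K _ HK] := mulmx_l2norm_bounded A.
by apply: (@l2_bounded_linear_continuous _ (mulmxr A) K) => u; rewrite
    (le_trans (norm_le_l2norm _))//=.
Qed.

Lemma continuous_dot (T : topologicalType) (F G : T -> 'rV[R]_d) :
  continuous F -> continuous G -> continuous (fun t => dot (F t) (G t)).
Proof.
move=> cF cG; apply: (@continuous_big _ _ +%R); first exact: add_continuous.
move=> i _ t; apply: cvgM.
- exact: (@cvg_comp _ _ _ _ _ _ _ _ (cF t) (@coord_continuous R 1 d ord0 i _)).
- exact: (@cvg_comp _ _ _ _ _ _ _ _ (cG t) (@coord_continuous R 1 d ord0 i _)).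
Qed.

Lemma continuous_l2norm (T : topologicalType) (F : T -> 'rV[R]_d) :
  continuous F -> continuous (fun t => l2norm (F t)).
Proof.
move=> cF t; apply: (@continuous_comp _ _ _ (fun s => dot (F s) (F s)) (@Num.sqrt R)).
  exact: continuous_dot.
exact: sqrt_continuous.
Qed.

(** The norms are equivalent, so a remainder quadratic in [l2norm] is little-o for the sup norm.
    This differentiates the cube of the norm at every point, its centre included. *)
Lemma quadratic_remainder_diff W (F : 'rV[R]_d -> W) (dF : {linear 'rV[R]_d -> W}) x K C :
  (forall u, `|dF u| <= K * l2norm u) ->
  (forall u, l2norm u <= 1 -> `|F (x + u) - F x - dF u| <= C * l2norm u ^+ 2) ->
  differentiable F x /\ 'd F x = dF :> ('rV[R]_d -> W).
Proof.
move=> /l2_bounded_linear_continuous cdF FC.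
have dFx : F \o shift x = cst (F x) + dF +o_ (nbhs (0 : 'rV[R]_d)) id.
  apply/eqaddoP => _/posnumP[e].
  (* [d.+1] in place of [d] keeps the factor positive in dimension 0. *)
  have D0 : 0 < (`|C| + 1) * d.+1%:R by rewrite mulr_gt0// ltr_wpDl.
  near=> u; rewrite /= !fctE/= opprD addrA [u + x]addrC.
  have u1 : l2norm u < 1 by near: u; exact: near_l2norm_lt.
  rewrite (le_trans (FC u (ltW u1)))//.
  have ue : l2norm u < e%:num / ((`|C| + 1) * d.+1%:R).
    by near: u; apply: near_l2norm_lt; rewrite divr_gt0.
  have ud : l2norm u <= d.+1%:R * `|u|.
    by rewrite (le_trans (l2norm_le_norm u))// ler_wpM2r ?ler_nat.
  apply: (@le_trans _ _ ((`|C| + 1) * l2norm u ^+ 2)).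
    by rewrite ler_wpM2r ?sqr_ge0// (le_trans (ler_norm _))// lerDl.
  apply: (@le_trans _ _ (l2norm u * ((`|C| + 1) * d.+1%:R) * `|u|)).
    have -> : forall a b c e : R, a * (b * c) * e = b * (a * (c * e)) by move=> *; ring.
    by rewrite expr2 !ler_wpM2l ?l2norm_ge0 ?addr_ge0.
  by rewrite ler_wpM2r// ltW// -ltr_pdivlMr.
split; last exact: diff_unique.
apply/diff_locallyP; rewrite (diff_unique cdF dFx)//.
Unshelve. all: by end_near. Qed.

Lemma diff_add_scale W (F G : 'rV[R]_d -> W) (a : R) x :
  differentiable F x -> differentiable G x ->
  differentiable (fun y => F y + a *: G y) x /\
  forall v, 'd (fun y => F y + a *: G y) x v = 'd F x v + a *: 'd G x v.
Proof.
move=> dF dG; have daG := differentiableZ a dG.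
rewrite (_ : (fun y => _) = F + a *: G); last by [].
split=> [|v]; first exact: differentiableD.
have E1 := congr1 (fun df : 'rV[R]_d -> W => df v) (diffD dF daG).
have E2 := congr1 (fun df : 'rV[R]_d -> W => df v) (diffZ a dG).
exact: (etrans E1 (congr1 (+%R ('d F x v)) E2)).
Qed.

(** The difference quotient of s |-> F (x + s v) at t is that of F at x + t v in direction v. *)
Lemma is_derive_line W (F : 'rV[R]_d -> W) x v (t : R) :
  differentiable F (x + t *: v) ->
  is_derive t 1 (fun s : R => F (x + s *: v)) ('d F (x + t *: v) v).
Proof.
move=> dF; have dv := @diff_derivable _ _ _ _ _ v dF.
have E : (fun h : R => h^-1 *: (((fun s : R => F (x + s *: v)) \o shift t) (h *: 1) - F
    (x + t *: v)))
  = (fun h : R => h^-1 *: ((F \o shift (x + t *: v)) (h *: v) - F (x + t *: v))).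
  by apply/funext => h /=; rewrite scalerDl addrCA [h *: 1]mulr1.
apply: DeriveDef; first by rewrite /derivable E.
by rewrite -deriveE// /derive E.
Qed.
End calculus.

(** Replaces limits in first-order arguments: an inequality along a step of length s is divided by
    s, and the remainder is O(s). *)
Lemma le0_of_le_small (R : realType) (a C : R) :
  (forall s, 0 < s -> s <= 1 -> a <= C * s) -> a <= 0.
Proof.
move=> aC; apply/ler_addgt0Pl => e e0; rewrite addr0.
have C0 : 0 < `|C| + 1 by rewrite ltr_wpDl.
have s0 : 0 < Num.min 1 (e / (`|C| + 1)) by rewrite lt_min ltr01 divr_gt0.
apply: (le_trans (aC _ s0 _)); first by rewrite ge_min lexx.
rewrite (@le_trans _ _ ((`|C| + 1) * Num.min 1 (e / (`|C| + 1))))//.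
  by rewrite ler_wpM2r ?(ltW s0)// (le_trans (ler_norm _))// lerDl.
rewrite mulrC -ler_pdivlMr// ge_min; apply/orP; right.
by rewrite lexx.
Qed.

Section dot_linear.
Variables (R : realType) (d : nat) (w : 'rV[R]_d).

Definition dotr (u : 'rV[R]_d) : R := dot u w.

Fact dotr_is_linear : linear dotr.
Proof. by move=> a u v; rewrite /dotr dotDl dotZl. Qed.

HB.instance Definition _ := GRing.isLinear.Build R 'rV[R]_d R _ dotr dotr_is_linear.

Lemma dotr_bounded u : `|dotr u| <= l2norm w * l2norm u.
Proof. by rewrite mulrC; exact: Cauchy_Schwarz_abs. Qed.

Lemma continuous_dotr : continuous dotr.
Proof. exact: (l2_bounded_linear_continuous dotr_bounded). Qed.

End dot_linear.

(** * Gradients and Hessians *)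

Section gradient.
Variables (R : realType) (d : nat).
Implicit Types (u v w x y : 'rV[R]_d) (f : 'rV[R]_d -> R).

Lemma diff_grad f x v : differentiable f x -> 'd f x v = dot (grad f x) v.
Proof.
move=> df; rewrite {1}(row_sum_delta v) linear_sum /=.
by apply: eq_bigr => i _; rewrite linearZ /= !mxE deriveE// mulrC.
Qed.

Lemma grad_unique f x w : differentiable f x ->
  (forall v, 'd f x v = dot w v) -> grad f x = w.
Proof.
move=> df dfw; apply/rowP => i; rewrite mxE deriveE// dfw /dot (bigD1 i)//=.
rewrite mxE !eqxx mulr1 big1 ?addr0// => j ji.
by rewrite mxE eqxx (negPf ji) mulr0.
Qed.

(** The mean value theorem for the difference of the two restrictions yields one t for both lines;
    two separate uses would give two values, and the cancellations below would fail. *)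
Lemma line_MVT2 f a b u v : (forall x, differentiable f x) ->
  exists t, [/\ 0 < t, t < 1 &
    (f (a + u) - f (b + v)) - (f a - f b) =
    dot (grad f (a + t *: u)) u - dot (grad f (b + t *: v)) v].
Proof.
move=> df.
have dF (t : R) : is_derive t 1
    ((fun s : R => f (a + s *: u)) - (fun s : R => f (b + s *: v)))
    (dot (grad f (a + t *: u)) u - dot (grad f (b + t *: v)) v).
  by rewrite -!diff_grad//; apply: is_deriveB; exact: is_derive_line.
have := @MVT R _ _ 0 1 ltr01 (fun t _ => dF t).
case=> [|t]; last first.
  rewrite in_itv/= => /andP[t0 t1]; rewrite !fctE !scale1r !scale0r !addr0 subr0 mulr1 => E.
  by exists t.
apply: continuous_subspaceT => t; apply: differentiable_continuous.
by apply/derivable1_diffP; have [] := dF t.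
Qed.

Lemma line_MVT f x v : (forall x, differentiable f x) ->
  exists t, [/\ 0 < t, t < 1 & f (x + v) - f x = dot (grad f (x + t *: v)) v].
Proof.
move=> df; have [t [t0 t1 E]] := line_MVT2 x x v 0 df; exists t; split => //.
by move: E; rewrite addr0 dot0r subrr !subr0.
Qed.

End gradient.

Section second_order.
Variables (R : realType) (d : nat).
Implicit Types (u v w x y : 'rV[R]_d) (f : 'rV[R]_d -> R).

(** [sup] is an upper bound only of a bounded set; [mulmx_l2norm_bounded] supplies the bound. *)
Lemma spectral_norm_bound (A : 'M[R]_d) u : l2norm (u *m A) <= spectral_norm A * l2norm u.
Proof.
have [K K0 HK] := mulmx_l2norm_bounded A.
have [/eqP u0|u0] := boolP (l2norm u == 0).
  by rewrite (l2norm_eq0 u0) mul0mx l2norm0 mulr0.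
have up : 0 < l2norm u by rewrite lt_def u0 l2norm_ge0.
rewrite -ler_pdivrMr//.
have -> : l2norm (u *m A) / l2norm u = l2norm ((l2norm u)^-1 *: u *m A).
  by rewrite -scalemxAl l2normZ gtr0_norm ?invr_gt0// mulrC.
apply: ub_le_sup.
  exists K => _ [v /= v1 <-]; rewrite (le_trans (HK v))//.
  by rewrite ler_piMr.
exists ((l2norm u)^-1 *: u) => //=.
by rewrite /l2ball/= l2normZ gtr0_norm ?invr_gt0// mulVf.
Qed.

(* The first clause follows from the second by the mean value theorem, which gives
   the constant M instead of the sharp M / 2; the cube of the norm is checked directly. *)
Definition second_order_lip (M : R) (g : 'rV[R]_d -> 'rV[R]_d) (H : 'rV[R]_d -> 'M[R]_d) :=
  (forall x y, l2norm (g y - g x - (y - x) *m H x) <= M * l2norm (y - x) ^+ 2) /\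
  (forall x y u, l2norm (u *m (H x - H y)) <= M * l2norm (x - y) * l2norm u).

(** The mean value theorem is for scalar functions, so it is applied to the product of [grad f] with
    the remainder w itself; this gives |w|^2 <= L |v|^2 |w|, and |w| is cancelled. *)
Lemma lipschitz_hessian_second_order f L :
  twice_differentiable f -> lipschitz_hessian L f -> 0 <= L ->
  second_order_lip L (grad f) (hess f).
Proof.
move=> [_ d2f] Lf L0.
have lipH x y u : l2norm (u *m (hess f x - hess f y)) <= L * l2norm (x - y) * l2norm u.
  by rewrite (le_trans (spectral_norm_bound _ _))// ler_wpM2r ?l2norm_ge0.
split => // x y; set w := (X in l2norm X); set v := y - x.
have dF z : differentiable (dotr w \o grad f) z.
  by apply: differentiable_comp => //; apply: linear_differentiable; exact: continuous_dotr.
have dFE z u : 'd (dotr w \o grad f) z u = dot (u *m hess f z) w.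
  rewrite diff_comp//=; last by apply: linear_differentiable; exact: continuous_dotr.
  rewrite diff_lin; last exact: continuous_dotr.
  by rewrite -deriveE// deriveEjacobian.
have [t [t0 t1]] := line_MVT x v dF.
rewrite -diff_grad// dFE (_ : x + v = y); last by rewrite addrC subrK.
rewrite /= /dotr => E.
have : l2norm w ^+ 2 <= L * l2norm v ^+ 2 * l2norm w.
  rewrite l2norm_sqr {1}/w !dotBl E -dotBl -mulmxBr.
  rewrite (le_trans (Cauchy_Schwarz _ _))// ler_wpM2r ?l2norm_ge0//.
  rewrite (le_trans (lipH _ _ _))// addrAC subrr add0r l2normZ gtr0_norm//.
  rewrite expr2 !mulrA ler_wpM2r ?l2norm_ge0// -!mulrA ler_wpM2l//.
  by rewrite ler_piMl ?l2norm_ge0// ltW.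
have [/eqP -> _|w0] := boolP (l2norm w == 0).
  by rewrite mulr_ge0// sqr_ge0.
by rewrite expr2 ler_pM2r// lt_def w0 l2norm_ge0.
Qed.

Section consequences.
Variables (f : 'rV[R]_d -> R) (H : 'rV[R]_d -> 'M[R]_d) (M : R).
Hypothesis df : forall x, differentiable f x.
Hypothesis M0 : 0 <= M.
Hypothesis fM : second_order_lip M (grad f) H.

(** The points c + t u and c - t u share the same t, so the Hessian terms cancel and only a cubic
    error is left. *)
Lemma second_order_midpoint c u :
  f (c + u) - f (c - u) <= 2 * dot (grad f c) u + 2 * M * l2norm u ^+ 3.
Proof.
have [t [t0 t1]] := line_MVT2 c c u (- u) df.
rewrite subrr subr0 => ->; rewrite dotNr opprK scalerN.
have [Q1 _] := fM.
have tu : l2norm (t *: u) <= l2norm u.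
  by rewrite l2normZ gtr0_norm// ler_piMl ?l2norm_ge0// ltW.
have tu2 : l2norm (t *: u) ^+ 2 <= l2norm u ^+ 2.
  by rewrite ler_pXn2r// ?nnegrE ?l2norm_ge0.
have := Q1 c (c + t *: u); have := Q1 c (c - t *: u).
rewrite ![c + _]addrC !addrK l2normN mulNmx opprK.
set e1 := (X in l2norm X); set e2 := (X in l2norm X <= _ -> _ -> _) => He1.
set e3 := (X in l2norm X) => He3.
have -> : dot (grad f (t *: u + c)) u + dot (grad f (- (t *: u) + c)) u
   = 2 * dot (grad f c) u + dot (e1 + e3) u.
  by rewrite /e1 /e3 !dotE; ring.
rewrite lerD2l (le_trans (Cauchy_Schwarz _ _))// exprSr mulrA ler_wpM2r ?l2norm_ge0//.
rewrite (le_trans (l2normD _ _))//.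
by have := ler_wpM2l M0 tu2; lra.
Qed.

(* The left-hand second difference is symmetric in u and v, hence so is the Hessian. *)
Lemma second_difference x u v :
  `|(f (x + u + v) - f (x + u)) - (f (x + v) - f x) - dot (v *m H x) u|
  <= 2 * M * (l2norm u + l2norm v) ^+ 3.
Proof.
have [t [t0 t1]] := line_MVT2 (x + v) x u u df.
rewrite (addrAC x v u) => ->; have [Q1 _] := fM.
have tu : l2norm (t *: u) <= l2norm u.
  by rewrite l2normZ gtr0_norm// ler_piMl ?l2norm_ge0// ltW.
have := Q1 x (x + v + t *: u); have := Q1 x (x + t *: u).
rewrite (_ : x + v + t *: u = v + t *: u + x); last by rewrite -addrA addrC.
rewrite (addrC x (t *: u)) !addrK.
set e1 := (X in l2norm X) => He1.
set e2 := (X in l2norm X) => He2.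
have -> : dot (grad f (v + t *: u + x)) u - dot (grad f (t *: u + x)) u - dot (v *m H x) u
   = dot (e2 - e1) u.
  by rewrite /e1 /e2 mulmxDl !dotE; ring.
rewrite (le_trans (Cauchy_Schwarz_abs _ _))//.
have u0 := l2norm_ge0 u; have v0 := l2norm_ge0 v; have tu0 := l2norm_ge0 (t *: u).
have vtu : l2norm (v + t *: u) <= l2norm u + l2norm v.
  by rewrite (le_trans (l2normD _ _))// addrC lerD2r.
have vtu0 := l2norm_ge0 (v + t *: u).
rewrite exprSr mulrA ler_pM ?l2norm_ge0// ?lerDl//.
rewrite (le_trans (l2normB _ _))//.
have h1 : l2norm (t *: u) ^+ 2 <= (l2norm u + l2norm v) ^+ 2.
  by rewrite ler_pXn2r// ?nnegrE ?addr_ge0//; lra.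
have h2 : l2norm (v + t *: u) ^+ 2 <= (l2norm u + l2norm v) ^+ 2.
  by rewrite ler_pXn2r// ?nnegrE ?addr_ge0//; lra.
by have := ler_wpM2l M0 h1; have := ler_wpM2l M0 h2; lra.
Qed.

(** Schwarz's theorem: the second differences along s a and s b in both orders agree, so the two
    values differ by O(s^3) / s^2. *)
Lemma second_order_sym x u v : dot (u *m H x) v = dot (v *m H x) u.
Proof.
suff le a b : dot (a *m H x) b <= dot (b *m H x) a by apply/eqP; rewrite eq_le !le.
rewrite -subr_le0; apply: (@le0_of_le_small _ _ (4 * M * (l2norm a + l2norm b) ^+ 3)).
move=> s s0 _.
have := second_difference x (s *: a) (s *: b); have := second_difference x (s *: b)
    (s *: a).
rewrite !l2normZ (gtr0_norm s0) -!mulrDr !ler_norml -!scalemxAl !dotE (addrAC x (s *: b)).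
move=> /andP[h1 _] /andP[_ h2].
have h : s ^+ 2 * (dot (a *m H x) b - dot (b *m H x) a) <=
   s ^+ 2 * (4 * M * (l2norm a + l2norm b) ^+ 3 * s).
  rewrite (addrC (l2norm b)) in h1.
  by lra.
by rewrite -(ler_pM2l (exprn_gt0 2 s0)).
Qed.

End consequences.
End second_order.

(** * The cubic regularization *)

Section cube.
Variables (R : realType) (d : nat).
Implicit Types (u v w x y z : 'rV[R]_d).

Definition cube_grad z := l2norm z *: z.

(** Hessian of |z|^3 / 3. As the inverse of 0 is 0, its value at z = 0 is the zero matrix, which is
    the correct one. *)
Definition cube_hess z : 'M[R]_d := (l2norm z)%:M + (l2norm z)^-1 *: (z^T *m z).

(* With a = |z|, b = |y|, r = |y - z|, the Bregman divergence of |.|^3 / 3 is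
   (b - a)^2 (2 b + a) / 6 + a r^2 / 2. *)
Lemma cube_bregman y z :
  l2norm y ^+ 3 / 3 - l2norm z ^+ 3 / 3 - dot (cube_grad z) (y - z) =
  (l2norm y - l2norm z) ^+ 2 * (2 * l2norm y + l2norm z) / 6
  + l2norm z * l2norm (y - z) ^+ 2 / 2.
Proof.
rewrite l2norm_sqr !dotE -!l2norm_sqr (dotC y z).
by lra.
Qed.

(** If |z| >= r / 24 the second term of [cube_bregman] suffices; otherwise |y| carries nearly all of
    r and the first term does. *)
Lemma cube_bregman_ge y z :
  l2norm (y - z) ^+ 3 / 48 <=
  l2norm y ^+ 3 / 3 - l2norm z ^+ 3 / 3 - dot (cube_grad z) (y - z).
Proof.
rewrite cube_bregman; have := l2normB y z.
have := l2norm_ge0 y; have := l2norm_ge0 z; have := l2norm_ge0 (y - z).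
set a := l2norm z; set b := l2norm y; set r := l2norm _ => r0 a0 b0 rab.
have r20 : 0 <= r ^+ 2 by rewrite sqr_ge0.
have rest0 : 0 <= (b - a) ^+ 2 * (2 * b + a) by rewrite mulr_ge0 ?sqr_ge0//; lra.
have [ar|ar] := leP (r / 24) a.
  have := ler_wpM2r r20 ar; lra.
have h1 : r / 2 <= b - a by lra.
have h2 : r <= 2 * b + a by lra.
have h3 : (r / 2) ^+ 2 <= (b - a) ^+ 2 by rewrite ler_pXn2r// ?nnegrE; lra.
have h4 : (r / 2) ^+ 2 * r <= (b - a) ^+ 2 * (2 * b + a).
  by rewrite ler_pM// sqr_ge0.
have := mulr_ge0 a0 r20; have := exprn_ge0 3 r0; lra.
Qed.

Lemma cube_bregman_le y z :
  l2norm y ^+ 3 / 3 - l2norm z ^+ 3 / 3 - dot (cube_grad z) (y - z) <=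
  l2norm z * l2norm (y - z) ^+ 2 + l2norm (y - z) ^+ 3 / 3.
Proof.
rewrite cube_bregman; have := l2norm_sub_le y z; rewrite ler_norml => /andP[].
have := l2norm_ge0 y; have := l2norm_ge0 z; have := l2norm_ge0 (y - z).
set a := l2norm z; set b := l2norm y; set r := l2norm _ => r0 a0 b0 h1 h2.
have h3 : (b - a) ^+ 2 <= r ^+ 2.
  by rewrite -real_normK ?num_real// ler_pXn2r ?nnegrE// ler_norml h1 h2.
have h4 : (b - a) ^+ 2 * (2 * b + a) <= r ^+ 2 * (3 * a + 2 * r).
  by rewrite ler_pM ?sqr_ge0//; lra.
lra.
Qed.

(** Sum of the Bregman bound and of the one with y and z exchanged. *)
Lemma cube_grad_monotone y z :
  l2norm (y - z) ^+ 3 / 24 <= dot (cube_grad y - cube_grad z) (y - z).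
Proof.
have := cube_bregman_ge y z; have := cube_bregman_ge z y.
by rewrite (l2distC z y) -(opprB y z) dotNr dotBl; lra.
Qed.

Lemma mul_cube_hess u z :
  u *m cube_hess z = l2norm z *: u + (dot u z / l2norm z) *: z.
Proof.
rewrite mulmxDr mul_mx_scalar -scalemxAr mulmxA; congr (_ + _).
rewrite [u *m z^T]mx11_scalar mul_scalar_mx scalerA mulrC; congr (_ / _ *: _).
by rewrite !mxE; apply: eq_bigr => i _; rewrite mxE.
Qed.

Lemma l2norm_normalize z : l2norm ((l2norm z)^-1 *: z) <= 1.
Proof.
rewrite l2normZ ger0_norm ?invr_ge0 ?l2norm_ge0//.
by have [->|z0] := eqVneq (l2norm z) 0; rewrite ?mulr0// mulVf.
Qed.

Lemma normalizeK z : l2norm z *: ((l2norm z)^-1 *: z) = z.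
Proof.
have [z0|z0] := eqVneq (l2norm z) 0; last by rewrite scalerA divff// scale1r.
by rewrite (l2norm_eq0 z0) !scaler0.
Qed.

(** The remainder is a combination of u and z. The coefficient of z, times |z|, equals (|u|^2 - (|z
    + u| - |z|)^2) / 2, which lies between 0 and |u|^2 / 2. *)
Lemma cube_grad_remainder z u :
  l2norm (cube_grad (z + u) - cube_grad z - u *m cube_hess z) <= 3 / 2 * l2norm u ^+ 2.
Proof.
have uE : z + u - z = u by rewrite addrC addKr.
have := l2norm_sub_le (z + u) z; rewrite uE => hu.
rewrite mul_cube_hess.
have -> : cube_grad (z + u) - cube_grad z - (l2norm z *: u + dot u z / l2norm z *: z) =
    (l2norm (z + u) - l2norm z) *: u +
    (l2norm (z + u) - l2norm z - dot u z / l2norm z) *: z.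
  rewrite /cube_grad; apply/rowP => i; rewrite !mxE; ring.
have h1 : l2norm ((l2norm (z + u) - l2norm z) *: u) <= l2norm u ^+ 2.
  by rewrite l2normZ expr2 ler_wpM2r ?l2norm_ge0.
have h2 : l2norm ((l2norm (z + u) - l2norm z - dot u z / l2norm z) *: z) <= l2norm u ^+
    2 / 2.
  have [z0|z0] := eqVneq (l2norm z) 0.
    by rewrite (l2norm_eq0 z0) scaler0 l2norm0 divr_ge0// sqr_ge0.
  have zp : 0 < l2norm z by rewrite lt_def z0 l2norm_ge0.
  have e1 : 2 * dot u z = l2norm (z + u) ^+ 2 - l2norm z ^+ 2 - l2norm u ^+ 2.
    by rewrite !l2norm_sqr !dotE (dotC z u); ring.
  rewrite l2normZ; have -> (a : R) : `|a| * l2norm z = `|a * l2norm z|.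
    by rewrite normrM (gtr0_norm zp).
  rewrite mulrBl divfK//.
  have -> : (l2norm (z + u) - l2norm z) * l2norm z - dot u z
    = (l2norm u ^+ 2 - (l2norm (z + u) - l2norm z) ^+ 2) / 2 by lra.
  have h3 : (l2norm (z + u) - l2norm z) ^+ 2 <= l2norm u ^+ 2.
    by rewrite -real_normK ?num_real// ler_pXn2r ?nnegrE// l2norm_ge0.
  have h4 := sqr_ge0 (l2norm (z + u) - l2norm z).
  by rewrite ger0_norm; lra.
by rewrite (le_trans (l2normD _ _))//; lra.
Qed.

(** Unit vectors vary like 1 / |y|, but the one that changes carries the weight |y|: the three terms
    of [E] contribute 1, 1 and 2. *)
Lemma cube_hess_lip x y u :
  l2norm (u *m (cube_hess x - cube_hess y)) <= 4 * l2norm (x - y) * l2norm u.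
Proof.
rewrite mulmxBr !mul_cube_hess -![_ / _ *: _]scalerA.
set xh := _^-1 *: x; set yh := _^-1 *: y.
have E : l2norm x *: u + dot u x *: xh - (l2norm y *: u + dot u y *: yh) =
  (l2norm x - l2norm y) *: u + dot u (x - y) *: xh + dot u yh *: (l2norm y *: (xh - yh)).
  rewrite dotBr.
  have -> : dot u y = dot u yh * l2norm y by rewrite -{1}(normalizeK y) dotZr mulrC.
  by move: (dot u yh) (dot u x) => p q; apply/rowP => i; rewrite !mxE; ring.
have xy := l2norm_ge0 (x - y); have u0 := l2norm_ge0 u.
rewrite E (le_trans (l2normD _ _))//.
have h1 : l2norm ((l2norm x - l2norm y) *: u) <= l2norm (x - y) * l2norm u.
  by rewrite l2normZ ler_wpM2r// l2norm_sub_le.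
have h2 : l2norm (dot u (x - y) *: xh) <= l2norm (x - y) * l2norm u.
  rewrite l2normZ (@le_trans _ _ (`|dot u (x - y)|))//.
    by rewrite ler_piMr// l2norm_normalize.
  by rewrite mulrC Cauchy_Schwarz_abs.
have h3 : l2norm (l2norm y *: (xh - yh)) <= 2 * l2norm (x - y).
  have -> : l2norm y *: (xh - yh) = (l2norm y - l2norm x) *: xh + (x - y).
    by rewrite scalerBr scalerBl !normalizeK addrA subrK.
  rewrite (le_trans (l2normD _ _))// l2normZ distrC.
  have := l2norm_sub_le x y; have := l2norm_normalize x.
  rewrite -/xh => h4 h5; have := ler_pM (normr_ge0 _) (l2norm_ge0 _) h5 h4; lra.
have h4 : l2norm (dot u yh *: (l2norm y *: (xh - yh))) <= l2norm u * (2 * l2norm (x - y)).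
  rewrite l2normZ ler_pM ?normr_ge0 ?l2norm_ge0//.
  by rewrite (le_trans (Cauchy_Schwarz_abs _ _))// ler_piMr// l2norm_normalize.
have := l2normD ((l2norm x - l2norm y) *: u) (dot u (x - y) *: xh); lra.
Qed.

Lemma cube_second_order : second_order_lip 4 cube_grad cube_hess.
Proof.
split; last exact: cube_hess_lip.
move=> x y; have := cube_grad_remainder x (y - x); rewrite [x + _]addrC subrK.
by have := sqr_ge0 (l2norm (y - x)); lra.
Qed.

Lemma diff_cube c z :
  differentiable (fun y => l2norm (y - c) ^+ 3 / 3) z /\
  forall v, 'd (fun y => l2norm (y - c) ^+ 3 / 3) z v = dot (cube_grad (z - c)) v.
Proof.
have e (u : 'rV[R]_d) : z + u - c = z - c + u by rewrite addrAC.
have h1 u : l2norm u <= 1 -> `|l2norm (z + u - c) ^+ 3 / 3 - l2norm (z - c) ^+ 3 / 3 -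
    dotr (cube_grad (z - c)) u|
   <= (l2norm (z - c) + 1) * l2norm u ^+ 2.
  move=> u1.
  have := cube_bregman_le (z - c + u) (z - c); have := cube_bregman_ge (z - c + u) (z - c).
  rewrite e /dotr (dotC u) (_ : z - c + u - (z - c) = u); last by rewrite addrC addKr.
  have u0 := l2norm_ge0 u; have u3 := exprn_ge0 3 u0.
  have u32 : l2norm u ^+ 3 <= l2norm u ^+ 2 by rewrite exprSr ler_piMr// sqr_ge0.
  by move=> ge le; rewrite ger0_norm; lra.
have [dF dFE] := @quadratic_remainder_diff R d R (fun y => l2norm (y - c) ^+ 3 / 3)
  (dotr (cube_grad (z - c))) z _ _ (dotr_bounded _) h1.
by split => // v; rewrite dFE /= /dotr dotC.
Qed.

Lemma diff_cube_grad c z :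
  differentiable (fun y => cube_grad (y - c)) z /\
  forall v, 'd (fun y => cube_grad (y - c)) z v = v *m cube_hess (z - c).
Proof.
have [K K0 HK] := mulmx_l2norm_bounded (cube_hess (z - c)).
pose dG : {linear 'rV[R]_d -> 'rV[R]_d} := mulmxr (cube_hess (z - c)).
have [] := @quadratic_remainder_diff R d _ (fun y => cube_grad (y - c)) dG z K (3 / 2).
- by move=> u; rewrite (le_trans (norm_le_l2norm _))//; exact: HK.
- move=> u _; apply: (le_trans (norm_le_l2norm _)); rewrite (addrAC z u) /dG /=.
  exact: cube_grad_remainder.
- by move=> dF dFE; split => // v; rewrite dFE.
Qed.

End cube.

Section cubic_regularized.
Variables (R : realType) (d : nat) (f : 'rV[R]_d -> R) (gamma : R) (c : 'rV[R]_d).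
Hypothesis d2f : twice_differentiable f.

Local Notation h := (cubic_regularized gamma f c).

Let hE : h = fun y => f y + gamma *: (l2norm (y - c) ^+ 3 / 3 : R).
Proof.
apply/funext => y; rewrite /cubic_regularized -[_ *: _]/(_ * _); ring.
Qed.

Lemma cubic_regularized_differentiable y : differentiable h y.
Proof.
have [d1f _] := d2f; have [dc _] := diff_cube c y; rewrite hE.
by have [] := diff_add_scale gamma (d1f y) dc.
Qed.

Lemma grad_cubic_regularized y :
  grad h y = grad f y + gamma *: cube_grad (y - c).
Proof.
have [d1f _] := d2f; have [dc dcE] := diff_cube c y.
apply: grad_unique; first exact: cubic_regularized_differentiable.
move=> v; rewrite hE; have [_ E] := diff_add_scale gamma (d1f y) dc.
rewrite dotDl dotZl.
exact: (etrans (E v) (f_equal2 (fun a b => a + gamma *: b) (diff_grad v (d1f y)) (dcE v))).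
Qed.

Let gradhE : grad h = fun y => grad f y + gamma *: cube_grad (y - c).
Proof. by apply/funext => y; rewrite grad_cubic_regularized. Qed.

Lemma cubic_regularized_twice_differentiable : twice_differentiable h.
Proof.
split=> y; first exact: cubic_regularized_differentiable.
have [_ d2] := d2f; have [dc _] := diff_cube_grad c y; rewrite gradhE.
by have [] := diff_add_scale gamma (d2 y) dc.
Qed.

Lemma hess_cubic_regularized y :
  hess h y = hess f y + gamma *: cube_hess (y - c).
Proof.
have [_ d2] := d2f; have [dc dcE] := diff_cube_grad c y.
apply/row_matrixP => i; rewrite !rowE /hess /jacobian.
have [_ E] := diff_add_scale gamma (d2 y) dc.
have J : 'd (grad f) y (delta_mx 0 i) = delta_mx 0 i *m jacobian (grad f) y.
  by rewrite -deriveE// deriveEjacobian.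
rewrite mul_rV_lin1 gradhE mulmxDr -scalemxAr.
exact: (etrans (E _) (f_equal2 (fun a b => a + gamma *: b) J (dcE _))).
Qed.

(** [4 * gamma] instead of the sharp [2 * gamma] comes from the constant 4 in [cube_second_order];
    the sum stays below 2 (L + 2 gamma). *)
Lemma cubic_regularized_second_order L :
  0 <= gamma -> second_order_lip L (grad f) (hess f) ->
  second_order_lip (L + 4 * gamma) (grad h) (hess h).
Proof.
move=> g0 [Q1 Q2]; have [C1 C2] := @cube_second_order R d; split.
  move=> x y; rewrite !grad_cubic_regularized hess_cubic_regularized.
  rewrite mulmxDr -scalemxAr.
  have -> : forall a b a' b' e e' : 'rV[R]_d, a + gamma *: b - (a' + gamma *: b') -
      (e + gamma *: e')
    = (a - a' - e) + gamma *: (b - b' - e').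
    by move=> *; apply/rowP => i; rewrite !mxE; ring.
  rewrite (le_trans (l2normD _ _))// l2normZ ger0_norm//.
  have := C1 (x - c) (y - c); rewrite opprB addrA subrK => C1xy.
  by have := Q1 x y; have := ler_wpM2l g0 C1xy; lra.
move=> x y u; rewrite !hess_cubic_regularized.
rewrite (_ : _ - _ = (hess f x - hess f y) + gamma *:
    (cube_hess (x - c) - cube_hess (y - c))); last first.
  by rewrite scalerBr opprD !addrA; congr (_ - _); rewrite addrAC.
rewrite mulmxDr -scalemxAr (le_trans (l2normD _ _))// l2normZ ger0_norm//.
have := C2 (x - c) (y - c) u; rewrite opprB addrA subrK => C2xy.
by have := Q2 x y u; have := ler_wpM2l g0 C2xy; lra.
Qed.

Lemma cubic_regularized_uniformly_convex :
  0 <= gamma -> (forall x y, f x + dot (grad f x) (y - x) <= f y) ->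
  forall x y, h x + dot (grad h x) (y - x) + gamma / 48 * l2norm (y - x) ^+ 3 <= h y.
Proof.
move=> g0 cf x y; rewrite grad_cubic_regularized !dotE.
have := cube_bregman_ge (y - c) (x - c); rewrite opprB addrA subrK => bxy.
have := ler_wpM2l g0 bxy; have := cf x y.
by rewrite /cubic_regularized !dotE; lra.
Qed.

End cubic_regularized.

(** * Convexity and minimizers *)

Section convexity.
Variables (R : realType) (d : nat) (f : 'rV[R]_d -> R).
Variables (H : 'rV[R]_d -> 'M[R]_d) (M : R).
Implicit Types (u v w x y z : 'rV[R]_d).
Hypothesis df : forall x, differentiable f x.
Hypothesis M0 : 0 <= M.
Hypothesis fM : second_order_lip M (grad f) H.

Lemma second_order_taylor1 x : exists2 K, 0 <= K & forall u,
  `|f (x + u) - f x - dot (grad f x) u| <= (K + M * l2norm u) * l2norm u ^+ 2.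
Proof.
have [Q1 _] := fM; have [K K0 HK] := mulmx_l2norm_bounded (H x).
exists K => // u; have [t [t0 t1 ->]] := line_MVT x u df.
have tu : l2norm (t *: u) <= l2norm u.
  by rewrite l2normZ gtr0_norm// ler_piMl ?l2norm_ge0// ltW.
have tu2 : l2norm (t *: u) ^+ 2 <= l2norm u ^+ 2.
  by rewrite ler_pXn2r// ?nnegrE ?l2norm_ge0.
have := Q1 x (x + t *: u); rewrite [x + _]addrC addrK.
set e := (X in l2norm X) => He.
rewrite -dotBl (_ : _ - _ = e + t *: u *m H x); last by rewrite /e subrK.
rewrite (le_trans (Cauchy_Schwarz_abs _ _))// expr2 mulrA ler_wpM2r ?l2norm_ge0//.
rewrite (le_trans (l2normD _ _))//; have := HK (t *: u).
by have := ler_wpM2l M0 tu2; have := ler_wpM2l K0 tu; lra.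
Qed.

Lemma convex_above_tangent : convex_function setT f ->
  forall x y, f x + dot (grad f x) (y - x) <= f y.
Proof.
move=> cf x y; set v := y - x; have [K K0 HK] := second_order_taylor1 x.
have v0 := l2norm_ge0 v.
rewrite -subr_le0; apply: (@le0_of_le_small _ _ ((K + M * l2norm v) * l2norm v ^+ 2)).
move=> s s0 s1.
have fs : f (x + s *: v) <= s * f y + (1 - s) * f x.
  have : f (s *: y + (1 - s) *: x) <= s * f y + (1 - s) * f x.
    exact: cf (Itv01 (ltW s0) s1) y x (in_setT _) (in_setT _).
  rewrite (_ : s *: y + _ = x + s *: v)//.
  by rewrite /v scalerBl scalerBr scale1r addrCA addrA addrAC.
have := HK (s *: v); rewrite ler_norml => /andP[+ _].
rewrite dotZr l2normZ gtr0_norm// exprMn => h.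
have h2 : M * (s * l2norm v) <= M * l2norm v by rewrite ler_wpM2l// ler_piMl.
have h3 : (K + M * (s * l2norm v)) * (s ^+ 2 * l2norm v ^+ 2) <=
  (K + M * l2norm v) * (s ^+ 2 * l2norm v ^+ 2).
  by apply: ler_wpM2r; [rewrite mulr_ge0 ?sqr_ge0 | rewrite lerD2l].
have : s * (f x + dot (grad f x) v - f y) <= s *
    ((K + M * l2norm v) * l2norm v ^+ 2 * s) by lra.
by rewrite ler_pM2l.
Qed.

(** The tangent inequalities from x to x + s u and back add up to monotonicity of the gradient,
    whose leading term is s^2 times the quadratic form. *)
Lemma convex_hessian_ge0 : (forall x y, f x + dot (grad f x) (y - x) <= f y) ->
  forall x u, 0 <= dot (u *m H x) u.
Proof.
move=> cf x u; have [Q1 _] := fM.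
rewrite -oppr_le0; apply: (@le0_of_le_small _ _ (M * l2norm u ^+ 3)) => s s0 s1.
have := cf x (x + s *: u); have := cf (x + s *: u) x; have := Q1 x (x + s *: u).
rewrite opprD addNKr [x + _]addrC addrK dotNr.
set e := (X in l2norm X) => He h1 h2.
have gE : grad f (s *: u + x) = grad f x + e + s *: u *m H x.
  by rewrite /e addrA subrK addrC subrK.
move: e He gE => e He gE.
have eu : dot e u <= M * l2norm (s *: u) ^+ 2 * l2norm u.
  by rewrite (le_trans (Cauchy_Schwarz _ _))// ler_wpM2r ?l2norm_ge0.
rewrite l2normZ gtr0_norm// in eu.
have : s ^+ 2 * - dot (u *m H x) u <= s ^+ 2 * (M * l2norm u ^+ 3 * s).
  have seu := ler_wpM2l (ltW s0) eu.
  rewrite gE -scalemxAl !dotE in h1; rewrite !dotE in h2; lra.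
by rewrite ler_pM2l// exprn_gt0.
Qed.

Lemma argmin_grad0 p : argmin_on setT f p -> grad f p = 0.
Proof.
move=> [_ fp]; have [K K0 HK] := second_order_taylor1 p.
set g := grad f p; apply: dot_eq0; apply/eqP; rewrite eq_le dot_ge0 andbT.
apply: (@le0_of_le_small _ _ ((K + M * l2norm g) * l2norm g ^+ 2)) => s s0 s1.
have g0 := l2norm_ge0 g.
have := HK (- s *: g); rewrite ler_norml => /andP[_].
rewrite dotZr l2normZ normrN gtr0_norm// exprMn => h.
have h2 : M * (s * l2norm g) <= M * l2norm g by rewrite ler_wpM2l// ler_piMl.
have h3 : (K + M * (s * l2norm g)) * (s ^+ 2 * l2norm g ^+ 2) <=
  (K + M * l2norm g) * (s ^+ 2 * l2norm g ^+ 2).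
  by apply: ler_wpM2r; [rewrite mulr_ge0 ?sqr_ge0 | rewrite lerD2l].
have h4 := fp (p + - s *: g) I.
have : s * dot g g <= s * ((K + M * l2norm g) * l2norm g ^+ 2 * s).
  by rewrite -/g in h; lra.
by rewrite ler_pM2l.
Qed.

End convexity.

Section argmin.
Variables (R : realType) (d : nat).
Implicit Types (u v w x y z : 'rV[R]_d) (phi : 'rV[R]_d -> R) (A : set 'rV[R]_d).

(** Variational inequality with the directional derivative replaced by an upper expansion along the
    segment, so that [phi] need not be differentiated. *)
Lemma argmin_first_order A phi p q a C : argmin_on A phi p ->
  (forall s, 0 < s -> s <= 1 -> A (p + s *: (q - p))) ->
  (forall s, 0 < s -> s <= 1 -> phi (p + s *: (q - p)) - phi p <= s * a + C * s ^+ 2) ->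
  0 <= a.
Proof.
move=> [_ pmin] pqA phia; rewrite -oppr_le0.
apply: (@le0_of_le_small _ _ C) => s s0 s1.
have := phia s s0 s1; have := pmin _ (pqA s s0 s1) => h1 h2.
have : s * - a <= s * (C * s) by lra.
by rewrite ler_pM2l.
Qed.

Lemma l2ball_segment r p q (s : R) : @l2ball R d r p -> @l2ball R d r q -> 0 < s -> s <=
    1 ->
  l2ball r (p + s *: (q - p)).
Proof.
move=> pr qr s0 s1; rewrite /l2ball/= in pr qr *.
have -> : p + s *: (q - p) = (1 - s) *: p + s *: q.
  by rewrite scalerBl scalerBr scale1r addrA addrAC.
rewrite (le_trans (l2normD _ _))// !l2normZ (gtr0_norm s0) ger0_norm ?subr_ge0//.
have := ler_wpM2l (ltW s0) qr; have : (1 - s) * l2norm p <= (1 - s) * r.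
  by rewrite ler_wpM2l ?subr_ge0.
lra.
Qed.

Lemma argmin_closed_ball c r phi : 0 <= r -> continuous phi ->
  argmin_on [set y | l2norm (y - c) <= r] phi !=set0.
Proof.
move=> r0 cphi; set A := [set y | _].
have cA : compact A.
  apply: bounded_closed_compact.
    exists (r + l2norm c); split; first exact: num_real.
    move=> b rb y; rewrite /A/= => yc; rewrite (le_trans (norm_le_l2norm _))//.
    by rewrite -(subrK c y) (le_trans (l2normD _ _))// (le_trans _ (ltW rb))// lerD2r.
  rewrite (_ : A = (fun y => l2norm (y - c)) @^-1` [set t | t <= r]); last by [].
  apply: closed_comp; last exact: closed_le.
  move=> y _; apply: (@continuous_l2norm R d _ (fun y : 'rV[R]_d => y - c)) => z.
  apply: (@continuousB _ _ _ id (cst c)); [by move=> ?|exact: cst_continuous].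
have A0 : A !=set0 by exists c; rewrite /A/= subrr l2norm0.
have [|p pA pmin] := EVT_min_rV A0 cA (f := phi); first exact: continuous_subspaceT.
exists p; split; first by rewrite inE in pA.
by move=> y Ay; apply: pmin; rewrite inE.
Qed.

Lemma argmin_l2ball r phi : 0 <= r -> continuous phi -> argmin_on (l2ball r) phi !=set0.
Proof.
move=> r0 cphi; have := argmin_closed_ball 0 r0 cphi.
by rewrite (_ : [set y | _] = l2ball r)//; apply/seteqP; split => y; rewrite /l2ball/=
    subr0.
Qed.

Lemma argmin_coercive c r phi : continuous phi ->
  (forall y, r < l2norm (y - c) -> phi c <= phi y) -> argmin_on setT phi !=set0.
Proof.
(* The given radius may be negative, hence the maximum with 0. *)
move=> cphi phic; have r0 : 0 <= Num.max 0 r by rewrite le_max lexx.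
have [p [_ pmin]] := argmin_closed_ball c r0 cphi.
exists p; split => // y _.
have [yr|yr] := leP (l2norm (y - c)) (Num.max 0 r); first exact: pmin.
rewrite (@le_trans _ _ (phi c))//; last by rewrite phic// (le_lt_trans _ yr)// le_max
    lexx orbT.
by apply: pmin => /=; rewrite subrr l2norm0.
Qed.

(** Optimality condition of both subproblems of NALEN; symmetry of A makes (2 c) (p - b) A the
    gradient of the quadratic term. *)
Lemma argmin_quadratic r (g : 'rV[R]_d) (A : 'M[R]_d) (b v : 'rV[R]_d) (c k : R) p q :
  (forall u w, dot (u *m A) w = dot (w *m A) u) ->
  argmin_on (l2ball r) (fun w => dot g w + c * dot ((w - b) *m A) (w - b)
     + k * l2norm (w - v) ^+ 2) p ->
  @l2ball R d r q ->
  0 <= dot (g + (2 * c) *: ((p - b) *m A) + (2 * k) *: (p - v)) (q - p).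
Proof.
move=> symA pmin qr; set u := q - p.
apply: (argmin_first_order (q := q) (C := c * dot (u *m A) u + k * dot u u) pmin).
  by move=> s s0 s1; have [pr _] := pmin; exact: l2ball_segment.
move=> s s0 s1; rewrite -/u; move: u => u; rewrite !l2norm_sqr.
rewrite !(addrAC p (s *: u)) !mulmxDl !mulNmx -!scalemxAl !dotE (symA u p) (symA u b)
    (dotC u p) (dotC u v).
by rewrite le_eqVlt; apply/orP; left; apply/eqP; ring.
Qed.

End argmin.

(** * Analysis of NALEN *)

Section regret.
Variables (R : realType) (d m N : nat) (h : 'rV[R]_d -> R) (M D eta : R).
Variables (x z y Delta v : nat -> 'rV[R]_d).
Hypotheses (m_gt0 : (0 < m)%N) (M_ge0 : 0 <= M) (D_gt0 : 0 < D) (eta_gt0 : 0 < eta).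
Hypothesis eta_le : eta * (m%:R * M * D) <= 1 / 4.
Hypothesis dh : forall x, differentiable h x.
Hypothesis hM : second_order_lip M (grad h) (hess h).
Hypotheses (Delta0_le : l2norm (Delta 0%N) <= D) (v0_le : l2norm (v 0%N) <= D).
Hypothesis trace : forall n, (n < N)%N ->
  [/\ z n = x n + 2^-1 *: Delta n,
      argmin_on (l2ball D) (fun D =>
          dot (grad h (z n)) D
          + 4^-1 * dot ((D - Delta n) *m hess h (z (period_start m n)))
                       (D - Delta n)
          + (2 * eta)^-1 * l2norm (D - v n) ^+ 2)
        (Delta n.+1),
      x n.+1 = x n + Delta n.+1,
      y n.+1 = x n + 2^-1 *: Delta n.+1 &
      argmin_on (l2ball D) (fun w =>
          dot (grad h (y n.+1)) w
          + (2 * eta)^-1 * l2norm (w - v n) ^+ 2)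
        (v n.+1)].

Lemma Delta_le n : (n <= N)%N -> l2norm (Delta n) <= D.
Proof. by case: n => // n nN; have [_ []] := trace nN. Qed.

Lemma v_le n : (n <= N)%N -> l2norm (v n) <= D.
Proof. by case: n => // n nN; have [_ _ _ _ []] := trace nN. Qed.

Lemma x_drift n i : (n + i <= N)%N -> l2norm (x (n + i)%N - x n) <= i%:R * D.
Proof.
elim: i => [|i ih] niN; first by rewrite addn0 subrr l2norm0 mul0r.
rewrite addnS in niN *; have [_ _ -> _ _] := trace niN.
rewrite addrAC (le_trans (l2normD _ _))//.
have := ih (ltnW niN); have := Delta_le niN; rewrite -natr1; lra.
Qed.

(** At most m - 1 steps of length D separate the two x iterates, and the half steps add at most
    D. *)
Lemma z_drift n : (n < N)%N -> l2norm (z n - z (period_start m n)) <= m%:R * D.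
Proof.
move=> nN; set p := period_start m n.
have pn : (p + n %% m)%N = n by rewrite subnK// leq_mod.
have pN : (p < N)%N by rewrite (leq_ltn_trans _ nN)// leq_subr.
have [-> _ _ _ _] := trace nN; have [-> _ _ _ _] := trace pN.
have := x_drift (n := p) (i := n %% m); rewrite pn => /(_ (ltnW nN)) xnp.
have -> : x n + 2^-1 *: Delta n - (x p + 2^-1 *: Delta p)
   = (x n - x p) + 2^-1 *: (Delta n - Delta p).
  by rewrite scalerBr opprD addrACA.
rewrite (le_trans (l2normD _ _))// l2normZ gtr0_norm//.
have := l2normB (Delta n) (Delta p).
have := Delta_le (ltnW nN); have := Delta_le (ltnW pN).
have : (n %% m)%:R + 1 <= m%:R :> R by rewrite natr1 ler_nat ltn_pmod.
by move=> /(ler_wpM2r (ltW D_gt0)); lra.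
Qed.

(* The second term pays for the prediction error of the lazy Hessian in the next step. *)
Definition potential n u : R :=
  2^-1 * l2norm (u - v n) ^+ 2 + 4^-1 * l2norm (Delta n - v n) ^+ 2.

Lemma potential_ge0 n u : 0 <= potential n u.
Proof. by rewrite addr_ge0// mulr_ge0 ?sqr_ge0. Qed.

Lemma potential_le n u : (n <= N)%N -> l2norm u <= D -> potential n u <= 3 * D ^+ 2.
Proof.
move=> nN uD; have vD := v_le nN; have DD := Delta_le nN.
have le w : l2norm w <= D -> l2norm (w - v n) ^+ 2 <= 4 * D ^+ 2.
  move=> wD; have := l2normB w (v n) => wv.
  rewrite (_ : 4 * D ^+ 2 = (2 * D) ^+ 2); last by ring.
  by have D0 := D_gt0; rewrite ler_pXn2r// ?nnegrE ?l2norm_ge0//; lra.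
by rewrite /potential; have := le _ uD; have := le _ DD; lra.
Qed.

(** The regret is split as in [E]: the mirror step against u, the hint against [v n.+1], and the
    error e of the hint. The hint contains [Delta n.+1] itself: it is the gradient at [z n]
    corrected to [y n.+1] by the lazy Hessian. *)
Lemma regret_step n u : (n < N)%N -> l2norm u <= D ->
  eta * dot (grad h (y n.+1)) (Delta n.+1 - u) <= potential n u - potential n.+1 u.
Proof.
move=> nN uD; have [zE Dmin _ yE vmin] := trace nN.
have [Q1 Q2] := hM; set A := hess h _ in Dmin.
have symA a b : dot (a *m A) b = dot (b *m A) a by apply: second_order_sym dh M_ge0 hM _
    _ _.
have vn1D : @l2ball R d D (v n.+1) by exact: v_le.
have VI1 := argmin_quadratic symA Dmin vn1D.
have VI2 : 0 <= dot (grad h (y n.+1) + (2 * (2 * eta)^-1) *: (v n.+1 - v n)) (u - v n.+1).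
  have sym0 (a b : 'rV[R]_d) : dot (a *m (0 : 'M[R]_d)) b = dot (b *m 0) a.
    by rewrite !mulmx0 !dot0l.
  (* The mirror step is the case of a zero quadratic form. *)
  have := @argmin_quadratic R d D (grad h (y n.+1)) 0 0 (v n) 0 (2 * eta)^-1 (v n.+1) u
      sym0.
  rewrite mulmx0 scaler0 addr0; apply => //.
  by under eq_fun do rewrite mul0r addr0.
have {Dmin vmin} etaE : eta * (2 * (2 * eta)^-1) = 1.
  by field; rewrite gt_eqF.
have yzE : y n.+1 - z n = 2^-1 *: (Delta n.+1 - Delta n).
  by rewrite yE zE opprD addrACA subrr add0r scalerBr.
set e := grad h (y n.+1) - grad h (z n) - (y n.+1 - z n) *m A.
have eE : grad h (y n.+1) = grad h (z n) + 2^-1 *: ((Delta n.+1 - Delta n) *m A) + e.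
  by rewrite /e yzE -scalemxAl -addrA (addrC (_ *: _)) subrK addrC subrK.
(* The error has two sources, the Taylor remainder from [z n] to [y n.+1] and the age of the
   Hessian; the bound on eta makes both small relative to the change of Delta. *)
have He : eta * l2norm e <= 4^-1 * l2norm (Delta n.+1 - Delta n).
  have := Q1 (z n) (y n.+1); have := Q2 (z n) (z (period_start m n)) (y n.+1 - z n).
  rewrite -/A => q2 q1.
  have {q1 q2} : l2norm e <= M * l2norm (y n.+1 - z n) ^+ 2 +
      M * l2norm (z n - z (period_start m n)) * l2norm (y n.+1 - z n).
    apply: le_trans (lerD q1 q2); apply: le_trans (l2normD _ _).
    by rewrite mulmxBr addrA subrK.
  have := z_drift nN; have := Delta_le nN; have := Delta_le (ltnW nN).
  rewrite yzE l2normZ gtr0_norm//; set del := l2norm (Delta n.+1 - _) => D1 D2 zd ele.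
  have del0 : 0 <= del by exact: l2norm_ge0.
  have delD : del <= 2 * D by have := l2normB (Delta n.+1) (Delta n); rewrite -/del; lra.
  have m1 : 1 <= m%:R :> R by rewrite ler1n.
  have D0 := D_gt0.
  have ele2 : l2norm e <= M * (m%:R * D) * del.
    have h1 : M * l2norm (z n - z (period_start m n)) * (2^-1 * del) <= M * (m%:R * D) *
        (2^-1 * del).
      by rewrite ler_wpM2r ?mulr_ge0// ler_wpM2l.
    have h2 : M * (2^-1 * del) ^+ 2 <= M * (m%:R * D * (2^-1 * del)).
      rewrite ler_wpM2l// expr2 ler_wpM2r ?mulr_ge0//.
      by have := ler_wpM2r (ltW D_gt0) m1; lra.
    by lra.
  have := ler_wpM2l (ltW eta_gt0) ele2; have := ler_wpM2r del0 eta_le; lra.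
have h1 : eta * dot (grad h (y n.+1)) (v n.+1 - u) <= dot (v n.+1 - v n) (u - v n.+1).
  have := mulr_ge0 (ltW eta_gt0) VI2.
  rewrite dotDl dotZl mulrDr mulrA etaE mul1r -(opprB u) dotNr; lra.
have h2 : eta * dot (grad h (z n) + 2^-1 *: ((Delta n.+1 - Delta n) *m A))
    (Delta n.+1 - v n.+1)
   <= dot (Delta n.+1 - v n) (v n.+1 - Delta n.+1).
  have := mulr_ge0 (ltW eta_gt0) VI1.
  rewrite (_ : 2 * 4^-1 = 2^-1); last by lra.
  rewrite dotDl [dot (_ *: (_ - v n)) _]dotZl mulrDr mulrA etaE mul1r.
  rewrite -(opprB (v n.+1) (Delta n.+1)) !dotNr; lra.
have h3 : eta * dot e (Delta n.+1 - v n.+1) <=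
    4^-1 * l2norm (Delta n.+1 - Delta n) * l2norm (Delta n.+1 - v n.+1).
  have := ler_wpM2l (ltW eta_gt0) (Cauchy_Schwarz e (Delta n.+1 - v n.+1)).
  by have := ler_wpM2r (l2norm_ge0 (Delta n.+1 - v n.+1)) He; lra.
have h4 : l2norm (Delta n.+1 - Delta n) <= l2norm (Delta n.+1 - v n) + l2norm
    (Delta n - v n).
  by have := l2normB (Delta n.+1 - v n) (Delta n - v n); rewrite opprB addrA subrK.
have E : eta * dot (grad h (y n.+1)) (Delta n.+1 - u) =
   eta * dot (grad h (y n.+1)) (v n.+1 - u) +
   eta * dot (grad h (z n) + 2^-1 *: ((Delta n.+1 - Delta n) *m A)) (Delta n.+1 - v n.+1) +
   eta * dot e (Delta n.+1 - v n.+1).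
  rewrite -addrA -mulrDr -dotDl -eE -mulrDr -dotDr; congr (_ * dot _ _).
  by rewrite [RHS]addrC addrA subrK.
rewrite E /potential.
(* The squares of [v n.+1 - v n] in [t1] and [t2] cancel; the cross terms p b and q b are absorbed
   by squares, the q^2 by the second term of [potential]. *)
have t1 : dot (v n.+1 - v n) (u - v n.+1) = 2^-1 * (l2norm (u - v n) ^+ 2
   - l2norm (u - v n.+1) ^+ 2 - l2norm (v n.+1 - v n) ^+ 2).
  rewrite !l2norm_sqr !dotE (dotC (v n.+1) u) (dotC (v n) u) (dotC (v n) (v n.+1)); lra.
have t2 : dot (Delta n.+1 - v n) (v n.+1 - Delta n.+1) = 2^-1 * (l2norm (v n.+1 - v n) ^+ 2
   - l2norm (Delta n.+1 - v n) ^+ 2 - l2norm (Delta n.+1 - v n.+1) ^+ 2).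
  rewrite !l2norm_sqr !dotE (dotC (v n) (v n.+1)) (dotC (v n) (Delta n.+1))
      (dotC (v n.+1) (Delta n.+1)); lra.
have := l2norm_ge0 (Delta n.+1 - v n.+1); rewrite t1 in h1; rewrite t2 in h2.
move: h1 h2 h3 h4; set p := l2norm (Delta n.+1 - v n); set q := l2norm (Delta n - v n).
set b := l2norm (Delta n.+1 - v n.+1) => h1 h2 h3 h4 b0.
have := ler_wpM2r b0 h4.
have := sqr_ge0 (p - b / 2); have := sqr_ge0 (q - b / 2); have := sqr_ge0 p; have :=
    sqr_ge0 b.
lra.
Qed.

(** [y n.+1] is the midpoint of [x n] and [x n.+1], so no Hessian term appears; the half step turns
    2 M into M / 4. *)
Lemma descent_step n : (n < N)%N ->
  h (x n.+1) - h (x n) <= dot (grad h (y n.+1)) (Delta n.+1) + M * D ^+ 3 / 4.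
Proof.
move=> nN; have [_ _ xE yE _] := trace nN.
have := second_order_midpoint dh M_ge0 hM (y n.+1) (2^-1 *: Delta n.+1).
have -> : y n.+1 - 2^-1 *: Delta n.+1 = x n by rewrite yE addrK.
have -> : y n.+1 + 2^-1 *: Delta n.+1 = x n.+1.
  by rewrite yE xE -addrA -scalerDl (_ : 2^-1 + 2^-1 = 1) ?scale1r//; lra.
rewrite dotZr l2normZ gtr0_norm// exprMn => le.
have : l2norm (Delta n.+1) ^+ 3 <= D ^+ 3.
  by rewrite ler_pXn2r// ?nnegrE ?l2norm_ge0 ?(ltW D_gt0)// Delta_le.
by move/(ler_wpM2l M_ge0); lra.
Qed.

Lemma block_regret a T u : (a + T <= N)%N -> l2norm u <= D ->
  h (x (a + T)%N) - h (x a) <=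
  dot (\sum_(t < T) grad h (y (a + t).+1)) u
  + (potential a u - potential (a + T) u) / eta + T%:R * (M * D ^+ 3 / 4).
Proof.
move=> + uD; elim: T => [|T ih] aTN.
  by rewrite addn0 !subrr big_ord0 dot0l !mul0r !addr0.
rewrite addnS in aTN *; have := ih (ltnW aTN).
have := descent_step aTN; have := regret_step aTN uD.
rewrite big_ord_recr /= dotDl -[T.+1%:R]natr1 dotBr => h1 h2 h3.
have : dot (grad h (y (a + T).+1)) (Delta (a + T).+1) - dot (grad h (y (a + T).+1)) u <=
    (potential (a + T) u - potential (a + T).+1 u) / eta.
  by rewrite ler_pdivlMr// mulrC.
lra.
Qed.

Lemma block_gradient_sum a T : (a + T <= N)%N ->
  D * l2norm (\sum_(t < T) grad h (y (a + t).+1)) <=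
  h (x a) - h (x (a + T)%N) + 3 * D ^+ 2 / eta + T%:R * (M * D ^+ 3 / 4).
Proof.
move=> aTN; set G := \sum_(t < T) _.
have D0 := D_gt0; have := @block_regret a T (- (D / l2norm G) *: G) aTN; rewrite -/G.
have uD : l2norm (- (D / l2norm G) *: G) <= D.
  rewrite scaleNr l2normN -scalerA l2normZ gtr0_norm//.
  by rewrite ler_piMr ?l2norm_normalize// ltW.
move=> /(_ uD).
have -> : dot G (- (D / l2norm G) *: G) = - (D * l2norm G).
  rewrite scaleNr dotNr dotZr -l2norm_sqr; have [->|G0] := eqVneq (l2norm G) 0.
    by rewrite expr0n !mulr0.
  by rewrite expr2 mulrA divfK.
have aN : (a <= N)%N by rewrite (leq_trans _ aTN)// leq_addr.
have := potential_le aN uD; have := potential_ge0 (a + T) (- (D / l2norm G) *: G) => p0 p1.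
have : (potential a (- (D / l2norm G) *: G) - potential (a + T) (- (D / l2norm G) *: G))
    / eta
    <= 3 * D ^+ 2 / eta.
  by rewrite ler_wpM2r ?invr_ge0 ?(ltW eta_gt0)//; lra.
lra.
Qed.

Lemma y_drift a s t T : (a + T <= N)%N -> (s < T)%N -> (t < T)%N ->
  l2norm (y (a + t).+1 - y (a + s).+1) <= T%:R * D.
Proof.
move=> aTN; wlog st : s t / (s <= t)%N => [hw sT tT|sT tT].
  by have [st|/ltnW ts] := leqP s t; [exact: hw | rewrite l2distC; exact: hw].
have asN : (a + s < N)%N by rewrite (leq_trans _ aTN)// ltn_add2l.
have atN : (a + t < N)%N by rewrite (leq_trans _ aTN)// ltn_add2l.
have [_ _ _ -> _] := trace asN; have [_ _ _ -> _] := trace atN.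
have := @x_drift (a + s) (t - s); rewrite -addnA subnKC// => /(_ (ltnW atN)) xD.
have -> : x (a + t)%N + 2^-1 *: Delta (a + t).+1 - (x (a + s)%N + 2^-1 *: Delta (a + s).+1)
   = (x (a + t)%N - x (a + s)%N) + 2^-1 *: (Delta (a + t).+1 - Delta (a + s).+1).
  by rewrite scalerBr opprD addrACA.
rewrite (le_trans (l2normD _ _))// l2normZ gtr0_norm//.
have := l2normB (Delta (a + t).+1) (Delta (a + s).+1).
have := Delta_le asN; have := Delta_le atN.
have : (t - s)%:R + 1 <= T%:R :> R.
  by rewrite natr1 ler_nat (leq_ltn_trans _ tT)// leq_subr.
by move=> /(ler_wpM2r (ltW D_gt0)); lra.
Qed.

(** Each gradient is expanded at the average; the linear terms cancel because the deviations from
    the average sum to 0. *)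
Lemma block_average_gradient a T ybar : (0 < T)%N -> (a + T <= N)%N ->
  ybar = T%:R^-1 *: \sum_(t < T) y (a + t).+1 ->
  T%:R * l2norm (grad h ybar) <=
  l2norm (\sum_(t < T) grad h (y (a + t).+1)) + T%:R * (M * (T%:R * D) ^+ 2).
Proof.
move=> T0 aTN ybarE; have [Q1 _] := hM.
have T0' : 0 < T%:R :> R by rewrite ltr0n.
have sumy : T%:R *: ybar = \sum_(t < T) y (a + t).+1.
  by rewrite ybarE scalerA divff ?scale1r// gt_eqF.
have ydist (t : 'I_T) : l2norm (y (a + t).+1 - ybar) <= T%:R * D.
  have : T%:R * l2norm (y (a + t).+1 - ybar) <= T%:R * (T%:R * D).
    rewrite -{1}(gtr0_norm T0') -l2normZ scalerBr sumy.
    have -> : T%:R *: y (a + t).+1 - \sum_(s < T) y (a + s).+1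
      = \sum_(s < T) (y (a + t).+1 - y (a + s).+1).
      by rewrite sumrB sumr_const card_ord scaler_nat.
    rewrite (le_trans (l2norm_sum _ _ _))//.
    apply: (@le_trans _ _ (\sum_(s < T) T%:R * D)).
      by apply: ler_sum => s _; exact: y_drift.
    by rewrite sumr_const card_ord -[leLHS]mulr_natl.
  by rewrite ler_pM2l.
have -> : T%:R * l2norm (grad h ybar) = l2norm (T%:R *: grad h ybar).
  by rewrite l2normZ gtr0_norm.
have -> : T%:R *: grad h ybar = \sum_(t < T) grad h (y (a + t).+1) -
   \sum_(t < T) (grad h (y (a + t).+1) - grad h ybar - (y (a + t).+1 - ybar) *m hess h
       ybar).
  have sum0 : \sum_(t < T) (y (a + t).+1 - ybar) = 0.
    by rewrite sumrB sumr_const card_ord -scaler_nat sumy subrr.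
  have sumg : \sum_(t < T) (grad h (y (a + t).+1) - grad h ybar) =
      \sum_(t < T) grad h (y (a + t).+1) - T%:R *: grad h ybar.
    by rewrite sumrB sumr_const card_ord scaler_nat.
  by rewrite sumrB -mulmx_suml sum0 mul0mx subr0 sumg subKr.
rewrite (le_trans (l2normB _ _))// lerD2l (le_trans (l2norm_sum _ _ _))//.
apply: (@le_trans _ _ (\sum_(s < T) M * (T%:R * D) ^+ 2)); last first.
  by rewrite sumr_const card_ord -[leLHS]mulr_natl.
apply: ler_sum => t _; rewrite (le_trans (Q1 _ _))// ler_wpM2l//.
by rewrite ler_pXn2r// ?nnegrE ?l2norm_ge0 ?mulr_ge0 ?(ltW D_gt0).
Qed.

Lemma best_average_gradient T K G : (0 < T)%N -> (K * T <= N)%N -> 0 <= G ->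
  (forall i, (i < K)%N ->
     G <= l2norm (grad h (T%:R^-1 *: \sum_(t < T) y (i * T + t).+1))) ->
  K%:R * (T%:R * (D * G)) <= h (x 0%N) - h (x (K * T)%N) +
    K%:R * (3 * D ^+ 2 / eta + T%:R * (M * D ^+ 3 / 4) + T%:R * D * (M * (T%:R * D) ^+ 2)).
Proof.
move=> T0 + G0; elim: K => [|K ih] KTN Gle.
  by rewrite mul0n !mul0r subrr addr0.
have KTN' : (K * T + T <= N)%N by rewrite -mulSnr.
have {ih} := ih _ _ => /(_ (leq_trans (leq_addr _ _) KTN')).
move=> /(_ (fun i iK => Gle i (ltnW iK))).
have := block_gradient_sum KTN'; have := block_average_gradient T0 KTN' erefl.
have := Gle K (ltnSn K) => /=; rewrite -mulSnr -natr1.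
set g := l2norm (grad h _); set s := l2norm (\sum_(t < T) _) => Gg Tg Ds ih.
have TD0 : 0 <= T%:R * D by rewrite mulr_ge0// ltW.
have := ler_wpM2l TD0 Gg; have := ler_wpM2l (ltW D_gt0) Tg; lra.
Qed.

End regret.

(** * Rounding and fractional powers *)

Section rounding.
Variable R : realType.
Implicit Type x : R.

Lemma nat_ceilE x : 0 <= x -> (nat_ceil x)%:R = (Num.ceil x)%:~R :> R.
Proof.
by move=> x0; rewrite /nat_ceil natr_absz ger0_norm// ceil_ge0 (lt_le_trans _ x0).
Qed.

Lemma nat_ceil_ge x : 0 <= x -> x <= (nat_ceil x)%:R.
Proof. by move=> x0; rewrite nat_ceilE// ceil_ge. Qed.

Lemma nat_ceil_le x : 0 <= x -> (nat_ceil x)%:R <= x + 1.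
Proof.
by move=> x0; rewrite nat_ceilE//; have := ceilB1_lt x; rewrite intrB; lra.
Qed.

(** The relation between the exponents is a hypothesis so that each use can settle it by
    arithmetic. *)
Lemma powR_natX x (a b : R) n : 0 <= x -> a * n%:R = b -> (x `^ a) ^+ n = x `^ b.
Proof. by move=> x0 <-; rewrite -powR_mulrn ?powR_ge0// -powRrM. Qed.

Lemma cube_root x : 0 <= x -> (x `^ (1 / 3)) ^+ 3 = x.
Proof.
move=> x0; rewrite (@powR_natX _ _ 1)// ?powRr1//.
by rewrite div1r mulVf// pnatr_eq0.
Qed.

Lemma cube_root_sqr x : 0 <= x -> x `^ (2 / 3) = (x `^ (1 / 3)) ^+ 2.
Proof. by move=> x0; rewrite (@powR_natX _ _ (2 / 3))//; lra. Qed.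

Lemma cube_root_ge1 x : 1 <= x -> 1 <= x `^ (1 / 3).
Proof. by move=> x1; rewrite -[leLHS](powRr0 x) ler_powR//; lra. Qed.

End rounding.

Section nalen_bound.
Variables (R : realType) (d : nat) (k : constants R) (m N : nat) (M : R).
Variables (h : 'rV[R]_d -> R) (x0 : 'rV[R]_d).
Hypotheses (kT : c_T' k = 1) (kD : c_D k = 1) (keta : c_eta k = 8^-1).
Hypotheses (m_gt0 : (0 < m)%N) (M_gt0 : 0 < M).
Hypothesis d2h : twice_differentiable h.
Hypothesis hM : second_order_lip (2 * M) (grad h) (hess h).
Hypothesis hlb : has_lbound (range h).
Hypothesis TN : (nalen_T' k m <= N)%N.

Local Notation H0 := (nalen_H0 h x0).
Local Notation T' := (nalen_T' k m).
Local Notation D := (nalen_D k m M h x0 N).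
Local Notation eta := (nalen_eta k m M h x0 N).
Local Notation mu := ((m%:R : R) `^ (1 / 3)).

Lemma nalen_H0_ge0 : 0 <= H0.
Proof. by rewrite subr_ge0; apply: ge_inf => //; exists x0. Qed.

Lemma mu_ge1 : 1 <= mu.
Proof. by rewrite cube_root_ge1// ler1n. Qed.

Lemma nalen_T'_bounds : mu <= T'%:R <= 2 * mu.
Proof.
have := mu_ge1 => mu1; rewrite /nalen_T' kT (mul1r (_ `^ _)).
have mu0 : 0 <= mu by lra.
by have := nat_ceil_ge mu0; have := nat_ceil_le mu0 => *; apply/andP; split; lra.
Qed.

Lemma nalen_T'_gt0 : (0 < T')%N.
Proof.
have := mu_ge1; have /andP[+ _] := nalen_T'_bounds => h1 h2.
by rewrite -(ltr_nat R); lra.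
Qed.

Lemma nalen_N_gt0 : 0 < N%:R :> R.
Proof. by rewrite ltr0n (leq_trans nalen_T'_gt0). Qed.

(** The choice of D balances the total available decrease against the second-order cost of N
    steps. *)
Lemma nalen_D_cube : D ^+ 3 * (N%:R * M * mu ^+ 2) = H0.
Proof.
have mu1 := mu_ge1; have N0 := nalen_N_gt0; have M0 := M_gt0.
have mu0 : 0 < mu by lra.
have p0 : 0 < N%:R * M * mu ^+ 2 by rewrite !mulr_gt0.
rewrite /nalen_D kD (mul1r (_ `^ _)) cube_root_sqr// cube_root ?divfK ?gt_eqF//.
by rewrite divr_ge0 ?nalen_H0_ge0// ltW.
Qed.

Lemma nalen_D_gt0 : H0 <> 0 -> 0 < D.
Proof.
move=> H0n0; rewrite /nalen_D kD (mul1r (_ `^ _)) powR_gt0// cube_root_sqr//.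
have mu1 := mu_ge1; have N0 := nalen_N_gt0; have M0 := M_gt0.
have mu0 : 0 < mu by lra.
rewrite divr_gt0 ?mulr_gt0//.
by rewrite lt_def nalen_H0_ge0 andbT; apply/eqP.
Qed.

Lemma nalen_K_bounds : (0 < nalen_K k m N)%N /\ N%:R <= 2 * ((nalen_K k m N)%:R * T'%:R)
    :> R.
Proof.
have T0 := nalen_T'_gt0; have K0 : (0 < nalen_K k m N)%N by rewrite divn_gt0.
split => //; rewrite -natrM -natrM ler_nat {1}(divn_eq N T') mul2n -addnn.
rewrite -/(nalen_K k m N) leq_add2l.
by rewrite (leq_trans (ltnW (ltn_pmod _ T0)))// leq_pmull.
Qed.

Lemma block_averageE (y : nat -> 'rV[R]_d) j :
  block_average k m y j = T'%:R^-1 *: \sum_(t < T') y (j * T' + t).+1.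
Proof.
rewrite /block_average big_add1 /= big_mkord; congr (_ *: _).
by apply: eq_bigr => t _; rewrite addnS.
Qed.

Lemma nalen_gradient out c : nalen k m M h x0 N out c ->
  l2norm (grad h out) ^+ 3 * N%:R ^+ 2 <= 35 ^+ 3 * M * mu ^+ 2 * H0 ^+ 2.
Proof.
have mu1 := mu_ge1; have M0 := M_gt0; have dh := d2h.1.
have M20 : 0 <= 2 * M by lra.
case => [H00|x z y Delta v j H0n0 [x0E v0E Delta0E tr] jK jmin].
  have /(argmin_grad0 dh M20 hM) -> : argmin_on setT h x0.
    split => // w _; move/eqP: H00; rewrite subr_eq0 => /eqP ->.
    by apply: ge_inf => //; exists w.
  by rewrite l2norm0 H00 !expr0n /= mul0r mulr0.
have D0 := nalen_D_gt0 H0n0; have m0 : 0 < m%:R :> R by rewrite ltr0n.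
have mMD0 := mulr_gt0 (mulr_gt0 m0 M0) D0.
have eta0 : 0 < eta by rewrite /nalen_eta keta divr_gt0.
(* The value 1/8 of [c_eta] is the required 1/4 halved, because the smoothness constant is 2 M. *)
have etaE : eta * (m%:R * (2 * M) * D) <= 1 / 4.
  rewrite /nalen_eta keta le_eqVlt; apply/orP; left; apply/eqP; field.
  by rewrite !gt_eqF.
have v0D : l2norm (v 0%N) <= D.
  rewrite v0E scaleNr l2normN -scalerA l2normZ gtr0_norm// ler_piMr ?(ltW D0)//.
  exact: l2norm_normalize.
have Delta0D : l2norm (Delta 0%N) <= D by rewrite Delta0E.
have [K0 NK] := nalen_K_bounds; set K := nalen_K k m N in K0 NK jK jmin.
have KTN : (K * T' <= N)%N by rewrite leq_trunc_div.
have T0 := nalen_T'_gt0.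
set G := l2norm _.
have G0 : 0 <= G by exact: l2norm_ge0.
have Gle i : (i < K)%N ->
    G <= l2norm (grad h (T'%:R^-1 *: \sum_(t < T') y (i * T' + t).+1)).
  by move=> iK; rewrite -block_averageE; exact: jmin.
have := best_average_gradient m_gt0 M20 D0 eta0 etaE dh hM Delta0D v0D tr T0 KTN G0 Gle.
have hinf : inf (range h) <= h (x (K * T')%N) by apply: ge_inf => //; exists (x (K * T')%N).
have HE : h (x 0%N) - h (x (K * T')%N) <= D ^+ 3 * (N%:R * M * mu ^+ 2).
  by rewrite nalen_D_cube /nalen_H0 x0E lerD2l lerN2.
have -> : 3 * D ^+ 2 / eta = 24 * mu ^+ 3 * M * D ^+ 3.
  rewrite cube_root// /nalen_eta keta; field.
  by rewrite !gt_eqF.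
have /andP[T1 T2] := nalen_T'_bounds.
have K0' : 0 < K%:R :> R by rewrite ltr0n.
have T0' : 0 < T'%:R :> R by rewrite ltr0n.
have P0 : 0 <= M * D ^+ 3 by rewrite mulr_ge0// ?exprn_ge0// ltW.
(* 35 rounds up 2 + 24 + 1/2 + 8: the decrease of h, the regret, the midpoint error and the
   averaging error, each in units of M mu^2 D^2. *)
move=> main; suff Gle35 : G <= 35 * (M * mu ^+ 2 * D ^+ 2).
  rewrite -nalen_D_cube.
  have : G ^+ 3 <= (35 * (M * mu ^+ 2 * D ^+ 2)) ^+ 3.
    by rewrite ler_pXn2r// nnegrE ?(le_trans G0).
  by move/(ler_wpM2r (sqr_ge0 N%:R)); lra.
have h1 : D ^+ 3 * (N%:R * M * mu ^+ 2) <= 2 * (K%:R * T'%:R) * (M * D ^+ 3 * mu ^+ 2).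
  have := ler_wpM2r (mulr_ge0 P0 (sqr_ge0 mu)) NK; lra.
have KP0 : 0 <= K%:R * (M * D ^+ 3) by rewrite mulr_ge0.
have mu20 := sqr_ge0 mu.
have h2 : K%:R * (24 * mu ^+ 3 * M * D ^+ 3) <= K%:R * (M * D ^+ 3) *
    (24 * mu ^+ 2 * T'%:R).
  have := ler_wpM2l KP0 (ler_wpM2l mu20 T1); lra.
have KTP0 : 0 <= K%:R * (M * D ^+ 3) * T'%:R by rewrite mulr_ge0// ltW.
have h3 : K%:R * (M * D ^+ 3) * T'%:R <= K%:R * (M * D ^+ 3) * T'%:R * mu ^+ 2.
  by rewrite ler_peMr// expr_ge1.
have h4 : K%:R * (M * D ^+ 3) * T'%:R * T'%:R ^+ 2 <= K%:R * (M * D ^+ 3) * T'%:R *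
    (2 * mu) ^+ 2.
  by rewrite ler_wpM2l// ler_pXn2r// ?nnegrE// mulr_ge0//; lra.
have KTD := mulr_gt0 (mulr_gt0 K0' T0') D0.
rewrite -(ler_pM2l KTD); lra.
Qed.

End nalen_bound.

(** * Continuity of the objective functions *)

Section continuity.
Variables (R : realType) (d : nat).
Implicit Types (u v w b c : 'rV[R]_d).

Lemma continuous_subr (V : normedModType R) (c : V) : continuous (fun y : V => y - c).
Proof. by move=> z; apply: (@continuousB _ _ _ id (cst c));
    [move=> ? | exact: cst_continuous]. Qed.

Lemma continuous_quadratic (A : 'M[R]_d) b : continuous
    (fun w : 'rV[R]_d => dot ((w - b) *m A) (w - b)).
Proof.
apply: (@continuous_dot R d _ (fun w : 'rV[R]_d => (w - b) *m A) (fun w => w - b)); last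
    exact: continuous_subr.
move=> w; apply: (@continuous_comp _ _ _ (fun w : 'rV[R]_d => w - b) (fun w => w *m A)).
  exact: continuous_subr.
exact: continuous_mulmxr.
Qed.

Lemma continuous_l2dist b : continuous (fun w : 'rV[R]_d => l2norm (w - b)).
Proof. exact: (@continuous_l2norm R d _ (fun w => w - b) (@continuous_subr _ b)). Qed.

Lemma continuous_dotl (g : 'rV[R]_d) : continuous (dot g).
Proof. by apply: (@continuous_dot R d _ (cst g) id) => w;
    [exact: cst_continuous | move=> ?]. Qed.

Lemma continuous_quadratic_objective (g : 'rV[R]_d) (A : 'M[R]_d) b v (a k : R) :
  continuous (fun w => dot g w + a * dot ((w - b) *m A) (w - b) + k * l2norm (w - v) ^+ 2).
Proof.
have c1 := @continuous_dotl g.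
have c2 w : {for w, continuous (fun w => a * dot ((w - b) *m A) (w - b))}.
  by apply: continuousM; [exact: cst_continuous | exact: continuous_quadratic].
have c3 w : {for w, continuous (fun w => k * l2norm (w - v) ^+ 2)}.
  apply: continuousM; first exact: cst_continuous.
  by apply: continuousM; exact: continuous_l2dist.
by move=> w; exact: (continuousD (continuousD (c1 w) (c2 w)) (c3 w)).
Qed.

Lemma continuous_l2dist_objective (g : 'rV[R]_d) v (k : R) :
  continuous (fun w => dot g w + k * l2norm (w - v) ^+ 2).
Proof.
have c1 := @continuous_dotl g.
have c3 w : {for w, continuous (fun w => k * l2norm (w - v) ^+ 2)}.
  apply: continuousM; first exact: cst_continuous.
  by apply: continuousM; exact: continuous_l2dist.
by move=> w; exact: (continuousD (c1 w) (c3 w)).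
Qed.

End continuity.

(** * Existence of runs of NALEN *)

Section nalen_existence.
Variables (R : realType) (d : nat) (k : constants R) (m N : nat) (M : R).
Variables (h : 'rV[R]_d -> R) (x0 : 'rV[R]_d).
Hypotheses (kT : c_T' k = 1) (kD : c_D k = 1).
Hypotheses (m_gt0 : (0 < m)%N) (M_gt0 : 0 < M).
Hypothesis hlb : has_lbound (range h).
Hypothesis TN : (nalen_T' k m <= N)%N.

Local Notation D := (nalen_D k m M h x0 N).
Local Notation eta := (nalen_eta k m M h x0 N).

Let model z w0 Delta v (w : 'rV[R]_d) : R :=
  dot (grad h z) w + 4^-1 * dot ((w - Delta) *m hess h w0) (w - Delta)
  + (2 * eta)^-1 * l2norm (w - v) ^+ 2.

Let mirror y v (w : 'rV[R]_d) : R := dot (grad h y) w + (2 * eta)^-1 * l2norm (w - v) ^+ 2.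

(* State of a run: the iterate, the last step, the mirror point, and the point at
   which the current lazy Hessian was evaluated. *)
Let state : Type := 'rV[R]_d * 'rV[R]_d * 'rV[R]_d * 'rV[R]_d.

Let half_step (s : state) : 'rV[R]_d := s.1.1.1 + 2^-1 *: s.1.1.2.

Let next (n : nat) (s : state) : state :=
  let: (x, Delta, v, w) := s in
  let w' := if (n %% m == 0)%N then half_step s else w in
  let Delta' := xget 0 (argmin_on (l2ball D) (model (half_step s) w' Delta v)) in
  let v' := xget 0 (argmin_on (l2ball D) (mirror (x + 2^-1 *: Delta') v)) in
  (x + Delta', Delta', v', w').

Let v0 := - (D / l2norm (grad h x0)) *: grad h x0.

(** The initial Hessian point 0 is a dummy: 0 is a multiple of m, so [next] replaces it at the first
    step. *)
Fixpoint run (n : nat) : state :=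
  if n is n'.+1 then next n' (run n') else (x0, v0, v0, 0).

(** The point carried along by the one-step recursion is the one that [nalen_trace] names by its
    index. *)
Lemma run_hessian_point n : (run n.+1).2 = half_step (run (period_start m n)).
Proof.
have step j : (run j.+1).2 = if (j %% m == 0)%N then half_step (run j) else (run j).2.
  by rewrite /=; case: (run j) => [[[x De] v] w].
elim: n => [|n ih]; rewrite step; first by rewrite mod0n /period_start mod0n.
have [n0|n0] := eqVneq (n.+1 %% m)%N 0%N; first by rewrite /period_start n0 subn0.
rewrite ih; congr (half_step (run _)); rewrite /period_start.
by move: n0; rewrite modnS; case: ifP => // _ _; rewrite subSS.
Qed.

Lemma nalen_trace_exists : 0 <= D -> exists x z y Delta v, nalen_trace k m M h x0 N x z
    y Delta v.
Proof.
move=> D0.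
exists (fun n => (run n).1.1.1), (fun n => half_step (run n)),
  (* [y 0] is a dummy value: the trace and the block averages start at index 1. *)
  (fun n => if n is n'.+1 then (run n').1.1.1 + 2^-1 *: (run n).1.1.2 else 0),
  (fun n => (run n).1.1.2), (fun n => (run n).1.2).
split => // n _.
have step j : let: (x, Delta, v, w) := run j in
   [/\ (run j.+1).1.1.2 = xget 0 (argmin_on (l2ball D)
       (model (half_step (run j)) (run j.+1).2 Delta v)),
      (run j.+1).1.1.1 = x + (run j.+1).1.1.2 &
      (run j.+1).1.2 = xget 0 (argmin_on (l2ball D)
          (mirror (x + 2^-1 *: (run j.+1).1.1.2) v))].
  by rewrite /=; case: (run j) => [[[x De] v] w].
have := step n; rewrite run_hessian_point; case E : (run n) => [[[x De] v] w].
move=> [DeE xE vE]; split => //.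
- rewrite DeE; apply: xgetPex; apply: argmin_l2ball => //.
  exact: continuous_quadratic_objective.
- rewrite vE; apply: xgetPex; apply: argmin_l2ball => //.
  rewrite /mirror; apply: (@continuous_l2dist_objective R d).
Qed.

Lemma nalen_exists : exists out c, nalen k m M h x0 N out c.
Proof.
have [H00|H0n0] := pselect (nalen_H0 h x0 = 0).
  by exists x0, no_cost; exact: nalen_minimizer.
have D0 := nalen_D_gt0 kT kD m_gt0 M_gt0 hlb TN H0n0.
have [x [z [y [De [v tr]]]]] := nalen_trace_exists (ltW D0).
have [K0 _] := nalen_K_bounds kT m_gt0 TN.
pose F (i : 'I_(nalen_K k m N)) := l2norm (grad h (block_average k m y i)).
have [i _ imin] := @Order.TotalTheory.arg_minP _ _ _ (Ordinal K0) xpredT F isT.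
exists (block_average k m y i), (nalen_cost k m N).
by apply: (nalen_return H0n0 tr (ltn_ord i)) => j jK; exact: (imin (Ordinal jK) isT).
Qed.

End nalen_existence.

(** * The sub-solver *)

Section subsolver_analysis.
Variables (R : realType) (d : nat) (k : constants R) (m S N : nat) (L gamma sigma : R).
Variables (f : 'rV[R]_d -> R) (xstar x : 'rV[R]_d).
Hypotheses (kT : c_T' k = 1) (kD : c_D k = 1) (keta : c_eta k = 8^-1).
Hypotheses (m_gt0 : (0 < m)%N) (L_gt0 : 0 < L) (gamma_gt0 : 0 < gamma).
Hypotheses (sigma_gt0 : 0 < sigma) (sigma_le1 : sigma <= 1).
Hypothesis d2f : twice_differentiable f.
Hypothesis fL : second_order_lip L (grad f) (hess f).
Hypothesis cf : forall x y, f x + dot (grad f x) (y - x) <= f y.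
Hypothesis fmin : forall x, f xstar <= f x.
Hypothesis TN : (nalen_T' k m <= N)%N.

Local Notation M := (L + 2 * gamma).
Local Notation h := (cubic_regularized gamma f x).
Local Notation mu := ((m%:R : R) `^ (1 / 3)).

(** What N and S have to achieve. [hN] turns [nalen_gradient] into a contraction; [hS] makes 9^S
    exceed the cube of the ratio between the initial gradient 128 M rho^2 and the tolerated sigma
    gamma rho^2 / 192. *)
Hypothesis hN : 4 * 35 ^+ 4 * mu ^+ 2 * M <= gamma * N%:R ^+ 2.
Hypothesis hS : (128 * 192 * M) ^+ 3 <= 9 ^+ S * (sigma * gamma) ^+ 3.

Let M_gt0 : 0 < M.
Proof. by rewrite addr_gt0// mulr_gt0. Qed.

Let d2h : twice_differentiable h.
Proof. exact: cubic_regularized_twice_differentiable. Qed.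

Let hM : second_order_lip (2 * M) (grad h) (hess h).
Proof.
rewrite (_ : 2 * M = L + 4 * gamma + L); last by ring.
have [Q1 Q2] := cubic_regularized_second_order x d2f (ltW gamma_gt0) fL.
have L0 := ltW L_gt0; split => [a b|a b u].
  rewrite (le_trans (Q1 a b))// ler_wpM2r ?sqr_ge0//; lra.
rewrite (le_trans (Q2 a b u))// !ler_wpM2r ?l2norm_ge0//; lra.
Qed.

Let unif_convex := cubic_regularized_uniformly_convex x d2f (ltW gamma_gt0) cf.

Let h_ge y : f xstar <= h y.
Proof.
rewrite (le_trans (fmin y))// lerDl mulr_ge0 ?exprn_ge0 ?l2norm_ge0//.
by rewrite divr_ge0// ltW.
Qed.

Lemma cubic_regularized_lbound : has_lbound (range h).
Proof. by exists (f xstar) => _ [y _ <-]; exact: h_ge. Qed.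

Let continuous_h : continuous h.
Proof. by move=> y; apply: differentiable_continuous; exact: d2h.1. Qed.

Lemma cubic_regularized_argmin : argmin_on setT h !=set0.
Proof.
have g0 := gamma_gt0; have fx := fmin x.
(* The summand 1 gives r >= 1, hence r <= r^3, so that the cubic term outweighs f x - f xstar. *)
apply: (@argmin_coercive _ _ x (1 + 3 * (f x - f xstar) / gamma) _ continuous_h) => y.
set r := l2norm (y - x) => hr.
have q0 : 0 <= 3 * (f x - f xstar) / gamma by rewrite divr_ge0 ?mulr_ge0 ?subr_ge0// ltW.
have r1 : 1 <= r by lra.
have -> : h x = f x by rewrite /cubic_regularized subrr l2norm0 expr0n mulr0 addr0.
rewrite /cubic_regularized -/r.
have : 3 * (f x - f xstar) <= gamma * r ^+ 3.
  have h1 : 3 * (f x - f xstar) / gamma <= r by lra.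
  rewrite ler_pdivrMr// in h1; rewrite (le_trans h1)// mulrC ler_pM2l//.
  by rewrite exprS ler_peMr ?expr_ge1//; lra.
by have := fmin y; lra.
Qed.

Let gradh y : grad h y = grad f y + gamma *: cube_grad (y - x).
Proof. exact: grad_cubic_regularized. Qed.

Lemma l2norm_cube_grad (u : 'rV[R]_d) : l2norm (cube_grad u) = l2norm u ^+ 2.
Proof. by rewrite l2normZ ger0_norm ?l2norm_ge0. Qed.

Lemma cubic_model_first_order y0 w : argmin_on setT (cubic_model L gamma f x) y0 ->
  0 <= dot (grad f x + (y0 - x) *m hess f x + M *: cube_grad (y0 - x)) w.
Proof.
move=> ymin; have M0 := M_gt0; have sym := second_order_sym d2f.1 (ltW L_gt0) fL.
have dir : y0 + w - y0 = w by rewrite addrC addKr.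
pose C := 2^-1 * dot (w *m hess f x) w + M *
    (l2norm (y0 - x) * l2norm w ^+ 2 + l2norm w ^+ 3 / 3).
apply: (argmin_first_order (q := y0 + w) (C := C) ymin) => // s s0 s1.
rewrite dir /cubic_model (addrAC y0) /C {C}; move: (y0 - x) => q.
have := cube_bregman_le (q + s *: w) q; rewrite [q + s *: w]addrC addrK.
rewrite l2normZ (gtr0_norm s0) !exprMn => hb.
have s3 : s ^+ 3 <= s ^+ 2 by rewrite exprSr ler_piMr// sqr_ge0.
have h1 := ler_wpM2l (ltW M0) hb.
have h2 := ler_wpM2l (mulr_ge0 (ltW M0) (exprn_ge0 3 (l2norm_ge0 w))) s3.
move: h1 h2; rewrite mulmxDl -!scalemxAl !dotE (sym x w q); lra.
Qed.

Lemma cubic_model_grad0 y0 : argmin_on setT (cubic_model L gamma f x) y0 ->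
  grad f x + (y0 - x) *m hess f x + M *: cube_grad (y0 - x) = 0.
Proof.
move=> ymin; set g := (X in X = 0).
apply: dot_eq0; apply/eqP; rewrite eq_le dot_ge0 andbT -oppr_ge0 -dotNr.
exact: cubic_model_first_order.
Qed.

Lemma nalen_gap z : 0 <= nalen_H0 h z /\
  gamma * nalen_H0 h z ^+ 2 <= 8 * l2norm (grad h z) ^+ 3.
Proof.
have H0 : 0 <= nalen_H0 h z := nalen_H0_ge0 z cubic_regularized_lbound.
split => //; have [p [_ pmin]] := cubic_regularized_argmin.
have infE : h p <= inf (range h).
  by apply: lb_le_inf => [|_ [y _ <-]]; [exists (h p), p | exact: pmin].
have := unif_convex z p; have := Cauchy_Schwarz (- grad h z) (p - z).
rewrite dotNl l2normN; set G := l2norm (grad h z); set r := l2norm (p - z) => cs uc.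
set H := nalen_H0 h z in H0 *.
have r0 : 0 <= r := l2norm_ge0 _.
have HB : H <= G * r - gamma / 48 * r ^+ 3 by rewrite /H /nalen_H0; lra.
set B := G * r - gamma / 48 * r ^+ 3 in HB.
have B0 : 0 <= B by lra.
have HB2 : H ^+ 2 <= B ^+ 2 by rewrite ler_pXn2r.
have g0 := gamma_gt0.
have [/eqP rz|rn0] := boolP (r == 0).
  have -> : H = 0 by apply/eqP; rewrite eq_le H0 andbT (le_trans HB)// /B rz; lra.
  by rewrite expr0n mulr0 mulr_ge0// exprn_ge0// l2norm_ge0.
have rp : 0 < r by rewrite lt_def rn0.
pose s := G / (gamma / 48); have GE : G = gamma / 48 * s.
  by rewrite /s mulrCA divff ?mulr1// gt_eqF// divr_gt0.
have BE : B = gamma / 48 * r * (s - r ^+ 2) by rewrite /B GE; ring.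
have sr : r ^+ 2 <= s.
  have c0 : 0 < gamma / 48 * r by rewrite mulr_gt0// divr_gt0.
  by rewrite -subr_ge0 -(pmulr_rge0 _ c0) -BE.
(* r (s - r^2) is largest at r^2 = s / 3, the double root of the difference. The resulting constant
   48 * 4 / 27 is below 8. *)
have key : 27 * (r ^+ 2 * (s - r ^+ 2) ^+ 2) <= 4 * s ^+ 3.
  rewrite -subr_ge0.
  have -> : 4 * s ^+ 3 - 27 * (r ^+ 2 * (s - r ^+ 2) ^+ 2) =
    (s - 3 * r ^+ 2) ^+ 2 * (4 * s - 3 * r ^+ 2) by ring.
  rewrite mulr_ge0 ?sqr_ge0//; have := sqr_ge0 r; lra.
have g3 : 0 <= (gamma / 48) ^+ 3 by rewrite exprn_ge0// divr_ge0// ltW.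
have := ler_wpM2l g3 key; have := ler_wpM2l (ltW g0) HB2.
have s30 : 0 <= (gamma / 48) ^+ 3 * s ^+ 3.
  by rewrite mulr_ge0// exprn_ge0// (le_trans _ sr)// sqr_ge0.
have -> : G ^+ 3 = (gamma / 48) ^+ 3 * s ^+ 3 by rewrite GE exprMn.
by rewrite BE; lra.
Qed.

Section prox_point.
Variable ystar : 'rV[R]_d.
Hypothesis ystar_min : argmin_on setT h ystar.

Local Notation rho := (l2norm (ystar - x)).

Lemma prox_grad : grad f ystar = - (gamma *: cube_grad (ystar - x)).
Proof.
apply/eqP; rewrite -subr_eq0 opprK -gradh; apply/eqP.
by apply: (argmin_grad0 d2h.1 _ hM) => //; have M0 := M_gt0; rewrite mulr_ge0// ltW.
Qed.

(** w is the gradient of the model at the proximal point, of size at most 2 M rho^2. The gradient of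
    the model is uniformly monotone and vanishes at y0, so the two points are within sqrt 48 <= 7
    times rho. *)
Lemma model_dist y0 : argmin_on setT (cubic_model L gamma f x) y0 ->
  l2norm (y0 - x) <= 8 * rho.
Proof.
move=> /cubic_model_grad0 g0; have [Q1 _] := fL.
set q := y0 - x in g0 *; set p := ystar - x.
have p0 := l2norm_ge0 p; have L0 := L_gt0; have ga0 := gamma_gt0.
pose w := grad f x + p *m hess f x + M *: cube_grad p.
have wE : w = - (grad f ystar - grad f x - (ystar - x) *m hess f x) + (L + gamma) *:
    cube_grad p.
  rewrite /w prox_grad -/p; apply/rowP => i; rewrite !mxE; ring.
have wle : l2norm w <= 2 * M * l2norm p ^+ 2.
  rewrite wE (le_trans (l2normD _ _))// l2normN l2normZ l2norm_cube_grad.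
  rewrite gtr0_norm; last by rewrite addr_gt0.
  have := Q1 x ystar; rewrite -/p; have := mulr_ge0 (ltW ga0) (sqr_ge0 (l2norm p)); lra.
have mono : M * (l2norm (p - q) ^+ 3 / 24) <= dot w (p - q).
  have -> : dot w (p - q) = dot (w - (grad f x + q *m hess f x + M *: cube_grad q)) (p - q).
    by rewrite g0 subr0.
  have -> : w - (grad f x + q *m hess f x + M *: cube_grad q)
     = (p - q) *m hess f x + M *: (cube_grad p - cube_grad q).
    rewrite (mulmxBl p q) /w; move: (p *m _) (q *m _) (cube_grad p) (cube_grad q) => a b
        a' b'.
    by apply/rowP => i; rewrite !mxE; ring.
  rewrite dotDl dotZl; have := ler_wpM2l (ltW M_gt0) (cube_grad_monotone p q).
  have := convex_hessian_ge0 fL cf x (p - q); lra.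
have cs := Cauchy_Schwarz w (p - q); set r := l2norm (p - q) in mono cs.
have r0 : 0 <= r := l2norm_ge0 _.
have r7 : r <= 7 * l2norm p.
  have [/eqP ->|rn0] := boolP (r == 0); first by rewrite mulr_ge0.
  have rp : 0 < r by rewrite lt_def rn0.
  have h1 : M * r * (r ^+ 2) <= M * r * (48 * l2norm p ^+ 2).
    by have := ler_wpM2r r0 wle; lra.
  rewrite ler_pM2l ?mulr_gt0// in h1.
  rewrite -(@ler_pXn2r _ 2)// ?nnegrE ?mulr_ge0// exprMn.
  by have := sqr_ge0 (l2norm p); lra.
have := l2normB p (p - q); rewrite subKr -/r; lra.
Qed.

(** At y0 the gradient of the model vanishes, and it differs from that of h by at most 2 M |y0 -
    x|^2; 128 = 2 * 8^2. *)
Lemma model_gradient y0 : argmin_on setT (cubic_model L gamma f x) y0 ->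
  l2norm (grad h y0) <= 128 * M * rho ^+ 2.
Proof.
move=> ymin; have r8 := model_dist ymin; have := cubic_model_grad0 ymin.
have [Q1 _] := fL; have L0 := L_gt0; have ga0 := gamma_gt0.
move=> g0; have := Q1 x y0; rewrite gradh; set q := y0 - x in g0 r8 *.
set e := grad f y0 - _ - _ => He.
have -> : grad f y0 + gamma *: cube_grad q = e - (L + gamma) *: cube_grad q.
  rewrite -[LHS]subr0 -g0 /e; apply/rowP => i; rewrite !mxE; ring.
rewrite (le_trans (l2normB _ _))// l2normZ l2norm_cube_grad gtr0_norm; last by rewrite
    addr_gt0.
have q2 : l2norm q ^+ 2 <= (8 * rho) ^+ 2 by rewrite ler_pXn2r// nnegrE ?mulr_ge0
    ?l2norm_ge0.
have := ler_wpM2l (ltW M_gt0) q2; have := mulr_ge0 (ltW ga0) (sqr_ge0 (l2norm q)); lra.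
Qed.

(** 192 = 4 * 48: uniform convexity with modulus gamma / 48 then puts y within rho / 2 of the
    proximal point, so |y - x| >= rho / 2 and the tolerance can be expressed by |y - x|, as the
    outer loop requires. *)
Lemma prox_inexact y : l2norm (grad h y) <= sigma * gamma / 192 * rho ^+ 2 ->
  l2norm (grad h y) <= sigma * gamma * l2norm (y - x) ^+ 2.
Proof.
move=> Gle; have g0 := gamma_gt0; have s0 := sigma_gt0; have s1 := sigma_le1.
have := unif_convex y ystar; have := ystar_min.2 y I.
have := Cauchy_Schwarz (- grad h y) (ystar - y); rewrite dotNl l2normN.
set r := l2norm (ystar - y); set G := l2norm (grad h y) in Gle * => cs hmin uc.
have r0 : 0 <= r := l2norm_ge0 _; have rho0 := l2norm_ge0 (ystar - x).
have r2 : r <= rho / 2.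
  have [/eqP ->|rn0] := boolP (r == 0); first by rewrite divr_ge0.
  have rp : 0 < r by rewrite lt_def rn0.
  have h1 : r * (gamma * r ^+ 2) <= r * (48 * G) by lra.
  rewrite ler_pM2l// in h1.
  rewrite -(@ler_pXn2r _ 2)// ?nnegrE ?divr_ge0// -(ler_pM2l g0).
  have := ler_wpM2r (mulr_ge0 (ltW g0) (sqr_ge0 rho)) s1; lra.
have yx : rho / 2 <= l2norm (y - x).
  have := l2normD (ystar - y) (y - x); rewrite addrA subrK -/r; lra.
rewrite (le_trans Gle)//.
have h2 : (rho / 2) ^+ 2 <= l2norm (y - x) ^+ 2.
  by rewrite ler_pXn2r// nnegrE ?l2norm_ge0 ?divr_ge0.
have sg : 0 <= sigma * gamma by rewrite mulr_ge0 ?(ltW s0) ?(ltW g0).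
have := ler_wpM2l sg h2; have := mulr_ge0 sg (sqr_ge0 rho); lra.
Qed.

End prox_point.

Lemma nalen_contraction y out c : nalen k m M h y N out c ->
  140 * l2norm (grad h out) ^+ 3 <= gamma * nalen_H0 h y ^+ 2.
Proof.
move=> run; have M0 := M_gt0.
have := nalen_gradient kT kD keta m_gt0 M_gt0 d2h hM cubic_regularized_lbound TN run.
have := hN; set G := l2norm _; set H := nalen_H0 _ _ => hN' b.
have mu0 : 0 < mu by have := mu_ge1 R m_gt0; lra.
have c0 : 0 < 35 ^+ 3 * mu ^+ 2 * M by rewrite !mulr_gt0 ?exprn_gt0.
rewrite -(ler_pM2l c0).
have G0 : 0 <= G ^+ 3 by rewrite exprn_ge0// l2norm_ge0.
by have := ler_wpM2r G0 hN'; have := ler_wpM2l (ltW gamma_gt0) b; lra.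
Qed.

(** The first S runs shrink the squared gap, and the last one converts the gap back into a gradient
    bound. *)
Lemma subsolver_inexact out c : subsolver k m L gamma S N f x out c ->
  l2norm (grad f out + gamma *: cube_grad (out - x)) <= sigma * gamma * l2norm (out - x)
      ^+ 2.
Proof.
move=> [y [cs [ymin run -> _]]]; rewrite -gradh.
have [p pmin] := cubic_regularized_argmin; apply: (prox_inexact pmin).
have M0 := M_gt0; have g0 := gamma_gt0.
(* One run gives gamma H'^2 <= 8 G^3 <= (8 / 140) gamma H^2, and 9 * 8 <= 140. *)
have decay s : (s <= S)%N -> 9 ^+ s * nalen_H0 h (y s) ^+ 2 <= nalen_H0 h (y 0%N) ^+ 2.
  elim: s => [|s ih] sS; first by rewrite expr0 mul1r.
  rewrite (le_trans _ (ih (ltnW sS)))// exprSr -mulrA ler_wpM2l ?exprn_ge0//.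
  have := nalen_contraction (run s (ltnW sS)); have [_] := nalen_gap (y s.+1).
  have := mulr_ge0 (ltW g0) (sqr_ge0 (nalen_H0 h (y s.+1))) => h1 h2 h3.
  by rewrite -(ler_pM2l g0); lra.
have := decay S (leqnn S); have := nalen_contraction (run S (leqnn S)).
have [_] := nalen_gap (y 0%N); have := model_gradient pmin ymin.
set G := l2norm (grad h (y S.+1)); set G0 := l2norm (grad h (y 0%N)).
set HS := nalen_H0 _ _; set H := nalen_H0 _ _; set rho := l2norm (p - x) => b0 b1 b2 b3.
have rho0 : 0 <= rho := l2norm_ge0 _.
have b4 : G0 ^+ 3 <= (128 * M * rho ^+ 2) ^+ 3.
  by rewrite ler_pXn2r// nnegrE ?l2norm_ge0// !mulr_ge0 ?(ltW M0) ?sqr_ge0.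
have rho6 : 0 <= rho ^+ 6 by rewrite exprn_ge0.
have nine : 0 < 9 ^+ S :> R by rewrite exprn_gt0.
have sg0 : 0 <= sigma * gamma / 192 * rho ^+ 2.
  by rewrite !mulr_ge0 ?invr_ge0 ?sqr_ge0// ltW// ?sigma_gt0.
rewrite -(@ler_pXn2r _ 3)// ?nnegrE ?l2norm_ge0// -(ler_pM2l nine).
have b5 := ler_wpM2l (ltW nine) b2; have b6 := ler_wpM2l (ltW g0) b3.
have b7 := ler_wpM2r rho6 hS.
have G30 : 0 <= 9 ^+ S * G ^+ 3 by rewrite mulr_ge0 ?exprn_ge0// ?l2norm_ge0// ltW.
have c192 : 0 < 192 ^+ 3 :> R by rewrite exprn_gt0.
rewrite -(ler_pM2l c192).
have -> : 192 ^+ 3 * (9 ^+ S * (sigma * gamma / 192 * rho ^+ 2) ^+ 3) =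
     9 ^+ S * (sigma * gamma) ^+ 3 * rho ^+ 6 by field.
by apply: le_trans b7; lra.
Qed.

End subsolver_analysis.

Section subsolver_existence.
Variables (R : realType) (d : nat) (k : constants R) (m S N : nat) (L gamma : R).
Variables (f : 'rV[R]_d -> R) (xstar x : 'rV[R]_d).
Hypotheses (kT : c_T' k = 1) (kD : c_D k = 1).
Hypotheses (m_gt0 : (0 < m)%N) (L_gt0 : 0 < L) (gamma_gt0 : 0 < gamma).
Hypothesis fL : second_order_lip L (grad f) (hess f).
Hypothesis cf : forall x y, f x + dot (grad f x) (y - x) <= f y.
Hypothesis fmin : forall x, f xstar <= f x.
Hypothesis TN : (nalen_T' k m <= N)%N.

Local Notation M := (L + 2 * gamma).
Local Notation h := (cubic_regularized gamma f x).

Lemma cubic_model_argmin : argmin_on setT (cubic_model L gamma f x) !=set0.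
Proof.
have M0 : 0 < M by rewrite addr_gt0// mulr_gt0.
set g := grad f x.
apply: (@argmin_coercive _ _ x (1 + 3 * l2norm g / M)).
  (* A third term with coefficient 0 makes the quadratic part an instance of this lemma. *)
  have c1 := @continuous_quadratic_objective _ _ g (hess f x) x 0 2^-1 0.
  have c2 w : {for w, continuous (fun y : 'rV[R]_d => M / 3 * l2norm (y - x) ^+ 3)}.
    apply: continuousM; first exact: cst_continuous.
    apply: continuousM; first exact: continuous_l2dist.
    by apply: continuousM; exact: continuous_l2dist.
  rewrite (_ : cubic_model _ _ _ _ = fun y : 'rV[R]_d =>
      dot g y + 2^-1 * dot ((y - x) *m hess f x) (y - x) + 0 * l2norm (y - 0) ^+ 2
      + M / 3 * l2norm (y - x) ^+ 3).
    by move=> w; exact: (continuousD (c1 w) (c2 w)).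
  by apply/funext => y; rewrite mul0r addr0.
move=> y; set r := l2norm (y - x) => hr.
have q0 : 0 <= 3 * l2norm g / M by rewrite divr_ge0 ?mulr_ge0 ?l2norm_ge0// ltW.
rewrite /cubic_model -/r -/g subrr mul0mx dot0l l2norm0 expr0n !mulr0 !addr0.
have psd := convex_hessian_ge0 fL cf x (y - x).
have := Cauchy_Schwarz (- g) (y - x); rewrite dotNl dotBr l2normN -/r => cs.
have h1 : 3 * l2norm g / M <= r by lra.
rewrite ler_pdivrMr// in h1.
have r1 : 1 <= r by lra.
have h2 : r * (r * M) <= r * (r ^+ 2 * M).
  by rewrite ler_pM2l ?ler_wpM2r ?(ltW M0)// ?expr2 ?ler_peMr//; lra.
have r0 : 0 <= r by lra.
have h3 := ler_wpM2l r0 h1; lra.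
Qed.

Lemma subsolver_exists : exists out c, subsolver k m L gamma S N f x out c.
Proof.
have M0 : 0 < M by rewrite addr_gt0// mulr_gt0.
have hlb := cubic_regularized_lbound x gamma_gt0 fmin.
have ex y : exists oc : 'rV[R]_d * cost, nalen k m M h y N oc.1 oc.2.
  by have [out [c oc]] := nalen_exists y kT kD m_gt0 M0 hlb TN; exists (out, c).
pose next y := projT1 (cid (ex y)).
have nextP y : nalen k m M h y N (next y).1 (next y).2 := projT2 (cid (ex y)).
have [y0 y0min] := cubic_model_argmin.
pose y s := iter s (fun z => (next z).1) y0.
exists (y S.+1), (add_cost (Cost 0 1 1) (\big[add_cost/no_cost]_(s < S.+1) (next (y s)).2)).
exists y, (fun s => (next (y s)).2); split => // s _.
Qed.

(** [phi] is any additive measure of cost, so that iterations and equivalent gradients are bounded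
    by the same argument. *)
Lemma subsolver_cost (phi : cost -> R) B out c :
  phi no_cost = 0 -> {morph phi : c c' / add_cost c c' >-> c + c'} ->
  0 <= B -> phi (nalen_cost k m N) <= B ->
  subsolver k m L gamma S N f x out c -> phi c <= phi (Cost 0 1 1) + S.+1%:R * B.
Proof.
move=> phi0 phiD B0 phiB [y [cs [_ run _ ->]]].
rewrite phiD lerD2l (big_morph phi phiD phi0).
apply: (@le_trans _ _ (\sum_(s < S.+1) B)); last by rewrite sumr_const card_ord mulr_natl.
apply: ler_sum => s _; case: (run s (ltn_ord s)) => [_|]; first by rewrite phi0.
by move=> *.
Qed.

End subsolver_existence.

(** * The outer loop *)

Section outer_step.
Variables (R : realType) (d : nat) (f : 'rV[R]_d -> R) (gamma sigma : R).
Variables (xstar : 'rV[R]_d).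
Hypothesis gamma_gt0 : 0 < gamma.
Hypothesis cf : forall x y, f x + dot (grad f x) (y - x) <= f y.
Implicit Types (x y v g : 'rV[R]_d) (s : calen_state R d).

Local Notation tau := (1 - sigma ^+ 2).
Hypothesis tau_ge0 : 0 <= tau.

Definition energy s : R :=
  st_A s * (f (st_x s) - f xstar) + 2^-1 * l2norm (st_v s - xstar) ^+ 2.

(* Obtained by squaring the inexactness condition. *)
Lemma inexact_correlation x y g lambda :
  0 < lambda -> lambda * (gamma * l2norm (y - x)) = 1 ->
  l2norm (g + gamma *: cube_grad (y - x)) <= sigma * gamma * l2norm (y - x) ^+ 2 ->
  lambda * l2norm g ^+ 2 + tau * (gamma * l2norm (y - x) ^+ 3) <= 2 * dot g (x - y).
Proof.
move=> l0; rewrite -(opprB y x) dotNr; move: (y - x) => u lE; set r := l2norm u in lE *.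
have r0 : 0 <= r := l2norm_ge0 _; have g0 := gamma_gt0 => le.
have : l2norm (g + gamma *: cube_grad u) ^+ 2 <= (sigma * gamma * r ^+ 2) ^+ 2.
  by rewrite ler_pXn2r// nnegrE ?l2norm_ge0// (le_trans (l2norm_ge0 _) le).
rewrite /cube_grad l2norm_sqr !dotDl !dotDr !dotZl !dotZr -/r -!l2norm_sqr -/r (dotC u g).
move/(ler_wpM2l (ltW l0)); set dd := dot g _; set gg := l2norm g ^+ 2.
have e1 : lambda * (gamma * (r * dd)) = dd.
  by transitivity (lambda * (gamma * r) * dd); [ring | rewrite lE mul1r].
have e2 : lambda * (gamma * (gamma * r ^+ 4)) = gamma * r ^+ 3.
  by transitivity (lambda * (gamma * r) * (gamma * r ^+ 3)); [ring | rewrite lE mul1r].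
have e3 : lambda * (sigma * gamma * r ^+ 2) ^+ 2 = sigma ^+ 2 * (gamma * r ^+ 3).
  transitivity (lambda * (gamma * r) * (sigma ^+ 2 * (gamma * r ^+ 3))); first by ring.
  by rewrite lE mul1r.
rewrite e3; move: e1 e2; lra.
Qed.

(** Weighted tangents at z. The weights are not normalized, which avoids dividing by A + a. *)
Lemma two_point_jensen p q x y z : 0 <= p -> 0 <= q ->
  (p + q) *: z = p *: x + q *: y -> (p + q) * f z <= p * f x + q * f y.
Proof.
move=> p0 q0 zE.
have := ler_wpM2l p0 (cf z x); have := ler_wpM2l q0 (cf z y).
have : dot (grad f z) (p *: x + q *: y - (p + q) *: z) = 0 by rewrite zE subrr dot0r.
rewrite !dotBr dotDr !dotZr; lra.
Qed.

(** Treats both branches: [beta = 1] and x' = y is the full step. Tangents at y towards x and xstar,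
    with weights A and a', bound the linear term of the expanded square, and a'^2 = lambda' A'
    rewrites its quadratic term. *)
Lemma energy_step x v xbar y A a' beta x' (lambda' : R) :
  0 <= A -> 0 < a' -> 0 < beta -> beta <= 1 -> a' ^+ 2 = lambda' * (A + a') ->
  (A + a') *: xbar = A *: x + a' *: v ->
  (A + beta * a') *: x' = ((1 - beta) * A) *: x + (beta * (A + a')) *: y ->
  (A + beta * a') * (f x' - f xstar) + 2^-1 * l2norm
      (v - (beta * a') *: grad f y - xstar) ^+ 2 <=
  A * (f x - f xstar) + 2^-1 * l2norm (v - xstar) ^+ 2
  - beta * (A + a') * (dot (grad f y) (xbar - y) - beta * lambda' / 2 * l2norm
      (grad f y) ^+ 2).
Proof.
move=> A0 a0 b0 b1 aE xbarE x'E; set g := grad f y.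
have wE : (1 - beta) * A + beta * (A + a') = A + beta * a' by ring.
have J : (A + beta * a') * f x' <= (1 - beta) * A * f x + beta * (A + a') * f y.
  rewrite -wE; apply: two_point_jensen; last by rewrite wE.
    by rewrite mulr_ge0 ?subr_ge0.
  by rewrite mulr_ge0 ?addr_ge0// ltW.
have c1 := ler_wpM2l A0 (cf y x); have c2 := ler_wpM2l (ltW a0) (cf y xstar).
rewrite -/g in c1 c2.
have c : A * (f y - f x) + a' * (f y - f xstar) + (A + a') * dot g (xbar - y) <= a' *
    dot g (v - xstar).
  have : dot g ((A + a') *: xbar) = dot g (A *: x + a' *: v) by rewrite xbarE.
  move: c1 c2; rewrite !dotBr dotDr !dotZr; lra.
have vE : l2norm (v - (beta * a') *: g - xstar) ^+ 2 = l2norm (v - xstar) ^+ 2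
   - 2 * (beta * a') * dot g (v - xstar) + beta ^+ 2 * (lambda' * (A + a')) * l2norm g ^+ 2.
  by rewrite -aE !l2norm_sqr addrAC !dotE (dotC v g) (dotC xstar g); ring.
rewrite vE; have := ler_wpM2l (ltW b0) c; lra.
Qed.

Section step.
Variable s : calen_state R d.
Hypotheses (A_ge0 : 0 <= st_A s) (lambda'_gt0 : 0 < st_lambda' s).

Lemma step_a'_gt0 : 0 < step_a' s.
Proof. by rewrite /step_a' mulr_gt0// ltr_wpDr// sqrtr_ge0. Qed.

Lemma step_a'_sqr : step_a' s ^+ 2 = st_lambda' s * step_A' s.
Proof.
rewrite /step_A' /step_a'; set q := Num.sqrt _.
have : q ^+ 2 = st_lambda' s ^+ 2 + 4 * st_lambda' s * st_A s.
  by rewrite sqr_sqrtr// addr_ge0 ?sqr_ge0// !mulr_ge0// ltW.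
by move=> h; lra.
Qed.

Lemma step_A'_gt0 : 0 < step_A' s.
Proof. by rewrite ltr_wpDl// step_a'_gt0. Qed.

Lemma step_xbarE : step_A' s *: step_xbar s = st_A s *: st_x s + step_a' s *: st_v s.
Proof. by rewrite /step_xbar scalerA divff ?scale1r// gt_eqF// step_A'_gt0. Qed.

Variables (xbar y : 'rV[R]_d) (lambda : R).
Hypothesis xbarE : step_A' s *: xbar = st_A s *: st_x s + step_a' s *: st_v s.
Hypothesis lambdaE : lambda * (gamma * l2norm (y - xbar)) = 1.
Hypothesis lambda_gt0 : 0 < lambda.
Hypothesis inexact :
  l2norm (grad f y + gamma *: cube_grad (y - xbar)) <= sigma * gamma * l2norm (y - xbar)
      ^+ 2.

Let corr := inexact_correlation lambda_gt0 lambdaE inexact.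

(** lambda' <= lambda is what lets [inexact_correlation] absorb the square of the gradient. *)
Lemma calen_step_up : st_lambda' s <= lambda ->
  energy (calen_step f s y lambda) + tau / 2 *
      (step_A' s * (gamma * l2norm (y - xbar) ^+ 3)) <= energy s.
Proof.
move=> up; rewrite /calen_step up /energy/=.
have A'0 := step_A'_gt0.
have := @energy_step (st_x s) (st_v s) xbar y (st_A s) (step_a' s) 1 y (st_lambda' s)
  A_ge0 step_a'_gt0 ltr01 (lexx 1) step_a'_sqr xbarE.
rewrite !mul1r subrr mul0r scale0r add0r => /(_ erefl).
have := ler_wpM2l (ltW A'0) corr.
have := ler_wpM2r (mulr_ge0 (ltW A'0) (sqr_ge0 (l2norm (grad f y)))) up.
rewrite -/(step_A' s); lra.
Qed.

(** beta lambda' = lambda makes the squares of the gradient cancel. Since |y - xbar| = 1 / (gamma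
    lambda), the remaining gain is the stated one times (lambda' / lambda)^2 >= 1. *)
Lemma calen_step_down : lambda < st_lambda' s ->
  energy (calen_step f s y lambda) + tau / 2 *
      (step_A' s / (gamma ^+ 2 * st_lambda' s ^+ 3)) <= energy s.
Proof.
move=> down; rewrite /calen_step (leNgt (st_lambda' s)) down /energy/=; have A'0 :=
    step_A'_gt0.
set beta := lambda / st_lambda' s; have g0 := gamma_gt0.
have b0 : 0 < beta by rewrite divr_gt0.
have b1 : beta <= 1 by rewrite ler_pdivrMr// mul1r ltW.
have bE : beta * st_lambda' s = lambda by rewrite divfK// gt_eqF.
have Ap : 0 < st_A s + beta * step_a' s by rewrite ltr_wpDl// mulr_gt0// step_a'_gt0.
set x' := _ *: (_ + _).
have x'E : (st_A s + beta * step_a' s) *: x' =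
   ((1 - beta) * st_A s) *: st_x s + (beta * step_A' s) *: y.
  by rewrite /x' scalerA divff ?scale1r// gt_eqF.
have := @energy_step (st_x s) (st_v s) xbar y (st_A s) (step_a' s) beta x' (st_lambda' s)
  A_ge0 step_a'_gt0 b0 b1 step_a'_sqr xbarE x'E.
rewrite bE -/(step_A' s).
have := ler_wpM2l (mulr_ge0 (ltW b0) (ltW A'0)) corr.
have lE := lambdaE; set r := l2norm (y - xbar) in lE *.
have rE : gamma * r = lambda^-1.
  by rewrite -[RHS]mul1r -lE mulrAC divff ?mul1r// gt_eqF.
suff : step_A' s / (gamma ^+ 2 * st_lambda' s ^+ 3) <= beta * step_A' s * (gamma * r ^+ 3).
  by move/(ler_wpM2l tau_ge0); lra.
have l'0 := lambda'_gt0; have l0 := lambda_gt0.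
have -> : beta * step_A' s * (gamma * r ^+ 3) =
    step_A' s / (gamma ^+ 2 * st_lambda' s ^+ 3) * (st_lambda' s / lambda) ^+ 2.
  have -> : r = (gamma * lambda)^-1.
    by rewrite invfM -rE mulKf// gt_eqF.
  rewrite /beta; field; rewrite !gt_eqF//.
have ge1 : 1 <= st_lambda' s / lambda by rewrite ler_pdivlMr// mul1r ltW.
have den0 : 0 <= gamma ^+ 2 * st_lambda' s ^+ 3 by rewrite mulr_ge0// exprn_ge0// ltW.
by apply: ler_peMr; [exact: divr_ge0 (ltW A'0) den0 | exact: exprn_ege1].
Qed.

End step.

Lemma stationary_minimizer y z : grad f y = 0 -> f y <= f z.
Proof. by move=> g0; have := cf y z; rewrite g0 dot0l addr0. Qed.

End outer_step.

(** * Growth of A and counting of the halving steps *)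

Section growth.
Variable R : realType.
Implicit Types A B P Q w ell : R.

Lemma sixth_root A : 0 < A -> exists2 B, 0 < B & B ^+ 6 = A.
Proof.
move=> A0; exists (A `^ (1 / 6)); first exact: powR_gt0.
by rewrite (@powR_natX _ _ _ 1) ?powRr1 ?(ltW A0)// mulrC mulrA mulr1 mulfV// pnatr_eq0.
Qed.

(** In the variables B = A^(1/6) and ell = lambda'^(1/2) all powers are integral and a' = ell B'^3.
    Since ell' <= 3 (B'^3 - B^3), any factor above 9/2 would do when B' is close to B; 5 does
    always. *)
Lemma growth_up A B B' P ell ell' (a' : R) :
  0 < B -> 0 < B' -> 0 < a' -> 0 < ell -> 0 < ell' -> B ^+ 6 = A -> B' ^+ 6 = A + a' ->
  a' ^+ 2 = ell ^+ 2 * (A + a') -> ell' ^+ 2 = 2 * ell ^+ 2 ->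
  P / 4 + ell / B <= 5 * B ^+ 2 -> P / 4 + ell' / B' <= 5 * B' ^+ 2.
Proof.
move=> B0 B'0 a0 l0 l'0 BE B'E aE lE H.
have aE' : a' = ell * B' ^+ 3.
  apply/eqP; rewrite -(@eqrXn2 _ 2)// ?(ltW a0)//.
    by rewrite aE exprMn -exprM B'E.
  by rewrite mulr_ge0 ?(ltW l0)// exprn_ge0// ltW.
have B3 : 0 < B ^+ 3 by rewrite exprn_gt0.
have B'3 : 0 < B' ^+ 3 by rewrite exprn_gt0.
have BB : B <= B'.
  by rewrite -(@ler_pXn2r _ 6)// ?nnegrE ?ltW// BE B'E ltrDl.
have BB3 : B ^+ 3 <= B' ^+ 3 by rewrite ler_pXn2r// ?nnegrE ltW.
have h1 : ell <= 2 * (B' ^+ 3 - B ^+ 3).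
  rewrite -(ler_pM2r B'3) -aE'.
  by have := sqr_ge0 (B' ^+ 3 - B ^+ 3); lra.
have h2 : ell' <= 3 / 2 * ell.
  rewrite -(@ler_pXn2r _ 2)// ?nnegrE ?mulr_ge0 ?(ltW l0) ?(ltW l'0)//.
  by rewrite exprMn lE; have := sqr_ge0 ell; lra.
have h3 : ell' / B' <= 5 * (B' ^+ 2 - B ^+ 2).
  rewrite ler_pdivrMr//.
  have d0 : 0 <= B' - B by rewrite subr_ge0.
  have s0 : 0 <= B' + B by lra.
  have s20 : 0 <= B' + 2 * B by lra.
  have := mulr_ge0 (sqr_ge0 (B' - B)) s20.
  have := mulr_ge0 (mulr_ge0 d0 s0) (ltW B'0).
  by lra.
have : 0 <= ell / B by rewrite divr_ge0 ?ltW.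
lra.
Qed.

(** Halving lambda' scales ell by 1 / sqrt 2 <= 3/4; the freed quarter of ell / B pays for the new
    term of P, whence the division by 4. *)
Lemma growth_down B B1 B' P ell ell' :
  0 < B -> B <= B1 -> B <= B' -> 0 < ell -> 0 < ell' -> ell' ^+ 2 = ell ^+ 2 / 2 ->
  P / 4 + ell / B <= 5 * B ^+ 2 -> (P + ell / B1) / 4 + ell' / B' <= 5 * B' ^+ 2.
Proof.
move=> B0 BB1 BB' l0 l'0 lE H.
have h1 : ell / B1 <= ell / B.
  by rewrite ler_pM2l// lef_pV2// posrE (lt_le_trans B0).
have h2 : ell' <= 3 / 4 * ell.
  rewrite -(@ler_pXn2r _ 2)// ?nnegrE ?mulr_ge0 ?(ltW l0) ?(ltW l'0)//.
  by rewrite exprMn lE; have := sqr_ge0 ell; lra.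
have h3 : ell' / B' <= ell' / B.
  by rewrite ler_pM2l// lef_pV2// posrE (lt_le_trans B0).
have h4 : ell' / B <= 3 / 4 * (ell / B).
  by rewrite mulrA ler_wpM2r// invr_ge0 ltW.
have h5 : B ^+ 2 <= B' ^+ 2 by rewrite ler_pXn2r// nnegrE ltW// (lt_le_trans B0).
lra.
Qed.

Lemma count_down_step w ell B P Q (n : nat) : 0 < w -> 0 < ell -> 0 < B ->
  n%:R <= w * P + Q / w ^+ 6 ->
  n.+1%:R <= w * (P + ell / B) + (Q + B ^+ 6 / (ell ^+ 2) ^+ 3) / w ^+ 6.
Proof.
move=> w0 l0 B0 H; set s := w * (ell / B).
have s0 : 0 < s by rewrite mulr_gt0// divr_gt0.
have sE : B ^+ 6 / (ell ^+ 2) ^+ 3 / w ^+ 6 = (s ^+ 6)^-1.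
  by rewrite /s; field; rewrite !gt_eqF.
have : 1 <= s + (s ^+ 6)^-1.
  have [s1|s1] := leP 1 s; first by rewrite (le_trans s1)// lerDl invr_ge0 exprn_ge0// ltW.
  rewrite (@le_trans _ _ (s ^+ 6)^-1)//; last by rewrite lerDr ltW.
  by rewrite invf_ge1 ?exprn_gt0// exprn_ile1// ltW.
rewrite -natr1 mulrDr (mulrDl Q) sE -/s; lra.
Qed.

(** Bernoulli's inequality gives j / 5 <= (6/5)^j, and (6/5)^7 <= 4. *)
Lemma seventh_power_le (j : nat) : j%:R ^+ 7 <= 5 ^+ 7 * 4 ^+ j :> R.
Proof.
have h1 : 1 + j%:R / 5 <= (6 / 5) ^+ j :> R.
  elim: j => [|j ih]; first by rewrite mul0r addr0 expr0.
  rewrite exprS -natr1; have := ler0n R j; have := exprn_ge0 j (_ : 0 <= 6 / 5 :> R).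
  by move: ih; move: ((6 / 5) ^+ j) => q; lra.
have h2 : j%:R / 5 <= (6 / 5) ^+ j :> R by lra.
have h3 : (j%:R / 5) ^+ 7 <= ((6 / 5) ^+ j) ^+ 7 :> R.
  by rewrite ler_pXn2r// nnegrE ?exprn_ge0 ?divr_ge0.
have h4 : ((6 / 5) ^+ j) ^+ 7 <= 4 ^+ j :> R.
  rewrite -exprM mulnC exprM lerXn2r// ?nnegrE ?exprn_ge0//; first by lra.
by lra.
Qed.

End growth.

Section outer_loop.
Variables (R : realType) (d : nat) (f : 'rV[R]_d -> R) (gamma sigma : R).
Variables (xstar x0 : 'rV[R]_d) (sub : 'rV[R]_d -> 'rV[R]_d -> cost -> Prop).
Hypotheses (gamma_gt0 : 0 < gamma).
Local Notation tau := (1 - sigma ^+ 2).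
Hypothesis tau_gt0 : 0 < tau.
Hypothesis cf : forall x y, f x + dot (grad f x) (y - x) <= f y.
Hypothesis fmin : forall x, f xstar <= f x.
Hypothesis sub_inexact : forall x y c, sub x y c ->
  l2norm (grad f y + gamma *: cube_grad (y - x)) <= sigma * gamma * l2norm (y - x) ^+ 2.

Local Notation R0 := (l2norm (x0 - xstar)).

(* [n] counts the steps that halve lambda', [P] and [Q] accumulate the two
   quantities whose weighted sum dominates 1 at each of them, and the potential
   5 A^(1/3) - lambda'^(1/2) A^(-1/6) controls [P]. *)
Definition growth_invariant (t : nat) (s : calen_state R d) : Prop :=
  exists (u n : nat) (lam P Q B ell : R),
  [/\ (u + n = t)%N, 0 < lam, st_lambda' s * 2 ^+ n = lam * 2 ^+ u,
      tau <= (lam * gamma * R0) ^+ 2 & st_lambda' s <= 2 * st_A s] /\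
  [/\ 0 < B, B ^+ 6 = st_A s, 0 < ell & ell ^+ 2 = st_lambda' s] /\
  [/\ 0 <= P, 0 <= Q, P / 4 + ell / B <= 5 * B ^+ 2,
      energy f xstar s + tau / 2 * (Q / gamma ^+ 2) <= 2^-1 * R0 ^+ 2 &
      forall w, 0 < w -> n%:R <= w * P + Q / w ^+ 6].

Lemma step_lambdaE (x y : 'rV[R]_d) : y <> x ->
  0 < step_lambda gamma x y /\ step_lambda gamma x y * (gamma * l2norm (y - x)) = 1.
Proof.
move=> yx; have r0 : 0 < gamma * l2norm (y - x).
  rewrite mulr_gt0// lt_def l2norm_ge0 andbT; apply/eqP => /l2norm_eq0/eqP.
  by rewrite subr_eq0 => /eqP.
by rewrite /step_lambda divr_gt0// divfK// gt_eqF.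
Qed.

(** Initially lambda' = lambda, so the first step is a doubling. Its energy gain bounds tau |y -
    x0|^2 by R0^2, which is the lower bound on [lam], because lam gamma |y - x0| = 1. *)
Lemma growth_first y c : sub x0 y c -> y <> x0 ->
  growth_invariant 1
    (calen_step f (CalenState x0 x0 0 (step_lambda gamma x0 y)) y (step_lambda gamma x0 y)).
Proof.
move=> suby yx; have [l0 lE] := step_lambdaE yx; set lam := step_lambda _ _ _ in l0 lE *.
set s := CalenState _ _ _ _.
have aE : step_a' s = lam.
  by rewrite /step_a' /= mulr0 addr0 sqrtr_sqr gtr0_norm//; lra.
have AE : step_A' s = lam by rewrite /step_A' aE /= add0r.
have xbarE : step_A' s *: x0 = st_A s *: st_x s + step_a' s *: st_v s.
  by rewrite AE aE /= scale0r add0r.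
have := @calen_step_up _ _ _ gamma sigma xstar gamma_gt0 cf s (lexx 0) l0 x0 y lam xbarE
    lE l0
  (sub_inexact suby) (lexx lam).
rewrite /calen_step /= lexx /energy /= AE aE mul0r add0r => E.
have [B B0 BE] := sixth_root l0.
have r0 := l2norm_ge0 (y - x0); set r := l2norm (y - x0) in lE E r0.
have e1 : lam * (gamma * r ^+ 3) = r ^+ 2.
  by transitivity (lam * (gamma * r) * r ^+ 2); [ring | rewrite lE mul1r].
rewrite e1 in E.
have fy : 0 <= lam * (f y - f xstar) by rewrite mulr_ge0 ?(ltW l0)// subr_ge0.
have ts : 0 <= tau * r ^+ 2 by rewrite mulr_ge0 ?(ltW tau_gt0) ?sqr_ge0.
have v0 := sqr_ge0 (l2norm (x0 - lam *: grad f y - xstar)).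
have q0 : 0 < Num.sqrt 2 :> R by rewrite sqrtr_gt0.
have q2 : Num.sqrt 2 ^+ 2 = 2 :> R by rewrite sqr_sqrtr.
exists 1%N, 0%N, lam, 0, 0, B, (Num.sqrt 2 * B ^+ 3); split; [|split]; split => //=.
- by rewrite expr0 expr1 mulr1 mulrC.
- have : (lam * gamma) ^+ 2 * (tau * r ^+ 2) <= (lam * gamma) ^+ 2 * R0 ^+ 2.
    by rewrite ler_wpM2l ?sqr_ge0//; lra.
  rewrite -exprMn; apply: le_trans.
  have -> : (lam * gamma) ^+ 2 * (tau * r ^+ 2) = tau * (lam * (gamma * r)) ^+ 2 by ring.
  by rewrite lE expr1n mulr1.
- by rewrite mulr_gt0// exprn_gt0.
- by rewrite exprMn q2 -exprM BE.
- rewrite mul0r add0r.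
  have -> : Num.sqrt 2 * B ^+ 3 / B = Num.sqrt 2 * B ^+ 2 by field; rewrite gt_eqF.
  rewrite ler_wpM2r ?sqr_ge0// -(@ler_pXn2r _ 2)// ?nnegrE ?(ltW q0)// q2; lra.
- rewrite /energy /= mul0r mulr0 addr0; lra.
- by move=> w w0; rewrite mulr0 mul0r addr0.
Qed.

Lemma growth_next t s y c : growth_invariant t s ->
  sub (step_xbar s) y c -> y <> step_xbar s ->
  growth_invariant t.+1 (calen_step f s y (step_lambda gamma (step_xbar s) y)).
Proof.
move=> [u [n [lam [P [Q [B [ell
    [[unt lam0 lamE tle lA] [[B0 BE l0 lE] [P0 Q0 HP HE Hn]]]]]]]]]].
move=> suby yx; have [la0 laE] := step_lambdaE yx.
set la := step_lambda _ _ _ in la0 laE *.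
have g0 := gamma_gt0; have t0 := tau_gt0.
have A0 : 0 < st_A s by rewrite -BE exprn_gt0.
have l'0 : 0 < st_lambda' s by rewrite -lE exprn_gt0.
have A0' := ltW A0; have a'0 := step_a'_gt0 l'0.
have a'E := step_a'_sqr A0' l'0; have A'0 := step_A'_gt0 A0' l'0.
have xbarE := step_xbarE A0' l'0.
(* Preserves lambda' <= 2 A when lambda' is doubled. *)
have a'l : st_lambda' s <= step_a' s.
  have : st_lambda' s * step_a' s <= step_a' s * step_a' s.
    by rewrite -expr2 a'E ler_pM2l// lerDr.
  by rewrite ler_pM2r.
have [up|down] := leP (st_lambda' s) la.
- have := @calen_step_up _ _ _ gamma sigma xstar gamma_gt0 cf s A0' l'0 _ y la xbarE laE la0
    (sub_inexact suby) up.
  rewrite /calen_step up => E.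
  have [B' B'0 B'E] := sixth_root A'0.
  have q0 : 0 < Num.sqrt 2 :> R by rewrite sqrtr_gt0.
  have q2 : Num.sqrt 2 ^+ 2 = 2 :> R by rewrite sqr_sqrtr.
  have l2 : (Num.sqrt 2 * ell) ^+ 2 = 2 * ell ^+ 2 by rewrite exprMn q2.
  have l20 : 0 < Num.sqrt 2 * ell by rewrite mulr_gt0.
  exists u.+1, n, lam, P, Q, B', (Num.sqrt 2 * ell); split; [|split]; split => //=.
  + by rewrite addSn unt.
  + by rewrite exprS mulrCA -lamE mulrA.
  + by rewrite /step_A'; lra.
  + by rewrite l2 lE.
  + apply: (growth_up B0 B'0 a'0 l0 l20 BE) => //.
    by rewrite a'E lE.
  + apply: le_trans HE; rewrite lerD2r (le_trans _ E)// lerDl.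
    rewrite mulr_ge0 ?divr_ge0 ?(ltW t0)// mulr_ge0 ?(ltW A'0)// mulr_ge0 ?(ltW g0)//.
    by rewrite exprn_ge0// l2norm_ge0.
- have := @calen_step_down _ _ _ gamma sigma xstar gamma_gt0 cf (ltW t0) s A0' l'0 _ y
    la xbarE laE la0
    (sub_inexact suby) down.
  rewrite /calen_step (leNgt (st_lambda' s)) down /=; set beta := la / st_lambda' s.
  set A1 := st_A s + beta * step_a' s => E.
  have be0 : 0 < beta by rewrite divr_gt0.
  have AA1 : st_A s <= A1 by rewrite lerDl mulr_ge0 ?(ltW be0) ?(ltW a'0).
  have A10 : 0 < A1 := lt_le_trans A0 AA1.
  have [B' B'0 B'E] := sixth_root A10; have [Bm Bm0 BmE] := sixth_root A'0.
  have q0 : 0 < Num.sqrt 2^-1 :> R by rewrite sqrtr_gt0.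
  have q2 : Num.sqrt 2^-1 ^+ 2 = 2^-1 :> R by rewrite sqr_sqrtr.
  have l2 : (Num.sqrt 2^-1 * ell) ^+ 2 = ell ^+ 2 / 2 by rewrite exprMn q2 mulrC.
  have l20 : 0 < Num.sqrt 2^-1 * ell by rewrite mulr_gt0.
  have QE : step_A' s / (gamma ^+ 2 * st_lambda' s ^+ 3) = Bm ^+ 6 / (ell ^+ 2) ^+ 3 /
      gamma ^+ 2.
    by rewrite BmE lE invfM mulrA mulrAC.
  exists u, n.+1, lam, (P + ell / Bm), (Q + Bm ^+ 6 / (ell ^+ 2) ^+ 3), B',
      (Num.sqrt 2^-1 * ell).
  split; [|split]; split => //=.
  + by rewrite addnS unt.
  + by rewrite exprS mulrA divfK.
  + by lra.
  + by rewrite l2 lE.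
  + by rewrite addr_ge0// divr_ge0// ltW.
  + by rewrite addr_ge0// divr_ge0// exprn_ge0// ?exprn_ge0// ltW.
  + apply: (growth_down (B := B)) => //.
      by rewrite -(@ler_pXn2r _ 6)// ?nnegrE ?(ltW B0) ?(ltW Bm0)// BE BmE lerDl ltW.
    by rewrite -(@ler_pXn2r _ 6)// ?nnegrE ?(ltW B0) ?(ltW B'0)// BE B'E.
  + by rewrite QE in E; apply: le_trans HE; rewrite (mulrDl Q) (mulrDr (tau / 2)); lra.
  + by move=> w w0; apply: count_down_step => //; exact: Hn.
Qed.

Lemma calen_reaches_growth t s c : calen_reaches gamma f sub x0 t s c ->
    growth_invariant t s.
Proof.
elim=> [y c' suby yx|t' s' c1 y c2 _ ih suby yx]; first exact: growth_first suby yx.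
exact: growth_next ih suby yx.
Qed.

End outer_loop.

(** * Existence and cost of runs of CALEN *)

Section calen_run.
Variables (R : realType) (d : nat) (f : 'rV[R]_d -> R) (gamma : R) (x0 : 'rV[R]_d).
Variable sub : 'rV[R]_d -> 'rV[R]_d -> cost -> Prop.

Lemma calen_returns_exists T : (forall x, exists y c, sub x y c) ->
  exists out c, calen_returns gamma f sub x0 T out c.
Proof.
move=> ex; have [y0 [c0 sub0]] := ex x0.
case: T => [|T]; first by exists x0, c0; exact: (calen_no_iteration _ _ erefl sub0).
have [y0x|y0x] := pselect (y0 = x0).
  by exists y0, c0; exact: calen_stop_first.
suff [[s [c rs]]|[t [s [c [y [c' [tT rs suby yx]]]]]]] :
    (exists s c, calen_reaches gamma f sub x0 T.+1 s c) \/
    (exists t s c y c', [/\ (t < T.+1)%N, calen_reaches gamma f sub x0 t s c,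
       sub (step_xbar s) y c' & y = step_xbar s]).
- by exists (st_x s), c; exact: calen_finish.
- by exists y, (add_cost c c'); exact: calen_stop rs suby yx.
elim: T => [|T [[s [c rs]]|[t [s [c [y [c' [tT rs suby yx]]]]]]]].
- by left; do 2!eexists; exact: calen_first sub0 y0x.
- have [y [c' suby]] := ex (step_xbar s).
  have [yx|yx] := pselect (y = step_xbar s); last first.
    by left; do 2!eexists; exact: calen_next rs suby yx.
  by right; exists T.+1, s, c, y, c'; split.
- by right; exists t, s, c, y, c'; split => //; exact: ltnW.
Qed.

(** A run stopped after t < T iterations has made one further call to the sub-solver, still covered
    by T; T = 0 is excluded since its single call is charged. *)
Lemma calen_returns_cost (phi : cost -> R) B T out c : (0 < T)%N ->
  {morph phi : c c' / add_cost c c' >-> c + c'} -> 0 <= B -> 0 <= phi (Cost 0 0 1) ->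
  (forall x y c, sub x y c -> phi c <= B) ->
  calen_returns gamma f sub x0 T out c -> phi c <= T%:R * (B + phi (Cost 0 0 1)).
Proof.
move=> T0 phiD B0 b0 phiB; set b := phi _ in b0 *.
have reach t s c' : calen_reaches gamma f sub x0 t s c' -> phi c' <= t%:R * (B + b).
  elim=> [y c1 suby _|t' s' c1 y c2 _ ih suby _].
    by rewrite phiD mul1r lerD2r (phiB _ _ _ suby).
  by rewrite !phiD -natr1 -/b; have := phiB _ _ _ suby; lra.
case=> [y c' TE|s c' /reach//|y c' _ suby _|t s c1 y c2 tT /reach rs suby _].
- by rewrite TE in T0.
- have T1 : 1 <= T%:R :> R by rewrite ler1n.
  have := phiB _ _ _ suby; have := ler_wpM2r (addr_ge0 B0 b0) T1; lra.
- have T1 : t%:R + 1 <= T%:R :> R by rewrite natr1 ler_nat.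
  have := phiB _ _ _ suby; have := ler_wpM2r (addr_ge0 B0 b0) T1.
  by rewrite phiD; lra.
Qed.

End calen_run.

(** * Convergence rate of the outer loop *)

Section calen_rate.
Variables (R : realType) (d : nat) (f : 'rV[R]_d -> R) (gamma sigma : R).
Variables (xstar x0 : 'rV[R]_d) (sub : 'rV[R]_d -> 'rV[R]_d -> cost -> Prop).
Hypotheses (gamma_gt0 : 0 < gamma).
Local Notation tau := (1 - sigma ^+ 2).
Hypothesis tau_gt0 : 0 < tau.
Hypothesis cf : forall x y, f x + dot (grad f x) (y - x) <= f y.
Hypothesis fmin : forall x, f xstar <= f x.
Hypothesis sub_inexact : forall x y c, sub x y c ->
  l2norm (grad f y + gamma *: cube_grad (y - x)) <= sigma * gamma * l2norm (y - x) ^+ 2.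

Local Notation R0 := (l2norm (x0 - xstar)).

(** For n halvings and an excess j of doublings, (2 n + j)^7 <= (4 n)^7 + (2 j)^7; the two summands
    bound these terms, with 10 = 2 * 5. *)
Definition outer_constant : R := 4 ^+ 7 * (20 + tau^-1) ^+ 7 + 10 ^+ 7 * (4 / tau).

Lemma outer_constant_gt0 : 0 < outer_constant.
Proof.
rewrite /outer_constant addr_gt0// mulr_gt0// ?exprn_gt0// ?divr_gt0//.
by rewrite addr_gt0// invr_gt0.
Qed.

Lemma outer_growth t s c : calen_reaches gamma f sub x0 t s c ->
  [/\ 0 < st_A s, st_A s * (f (st_x s) - f xstar) <= 2^-1 * R0 ^+ 2 &
    t%:R ^+ 7 <= outer_constant * (gamma * R0 * st_A s) ^+ 2].
Proof.
move/(calen_reaches_growth gamma_gt0 tau_gt0 cf fmin sub_inexact).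
move=> [u [n [lam [P [Q [B [ell
    [[unt lam0 lamE tle lA] [[B0 BE l0 lE] [P0 Q0 HP HE Hn]]]]]]]]]].
have g0 := gamma_gt0; have t0 := tau_gt0.
have R00 := l2norm_ge0 (x0 - xstar).
have R0 : 0 < R0.
  rewrite lt_def R00 andbT; apply/eqP => R0E; move: tle.
  by rewrite R0E mulr0 expr0n /= leNgt t0.
move: R00 HE tle R0; set R0 := l2norm _ => R00 HE tle R0_gt0.
set A := st_A s in BE lA *.
have A0 : 0 < A by rewrite -BE exprn_gt0.
have gap0 : 0 <= A * (f (st_x s) - f xstar) by rewrite mulr_ge0 ?(ltW A0)// subr_ge0.
have v0 := sqr_ge0 (l2norm (st_v s - xstar)).
rewrite /energy -/A in HE.
have Qt0 : 0 <= tau / 2 * (Q / gamma ^+ 2).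
  by rewrite mulr_ge0 ?divr_ge0 ?(ltW t0)// exprn_ge0// ltW.
split => //; first by lra.
have gR0 : 0 < gamma * R0 by rewrite mulr_gt0.
have Qle : Q <= (gamma * R0) ^+ 2 / tau.
  have : tau * (Q / gamma ^+ 2) <= R0 ^+ 2 by lra.
  rewrite mulrA ler_pdivrMr ?exprn_gt0// => h.
  by rewrite ler_pdivlMr// exprMn; lra.
have Ple : P <= 20 * B ^+ 2.
  have := divr_ge0 (ltW l0) (ltW B0); lra.
(* This w balances w B^2, the order of w P, against (gamma R0)^2 / w^6, the order of Q / w^6. *)
set w := ((gamma * R0) ^+ 2 / B ^+ 2) `^ (1 / 7).
have wb0 : 0 < (gamma * R0) ^+ 2 / B ^+ 2 by rewrite divr_gt0 ?exprn_gt0.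
have w0 : 0 < w by rewrite powR_gt0.
have w7 : w ^+ 7 * B ^+ 2 = (gamma * R0) ^+ 2.
  have e7 : 1 / 7 * 7%:R = 1 :> R by lra.
  by rewrite (powR_natX (ltW wb0) e7) powRr1 ?(ltW wb0)// divfK// gt_eqF// exprn_gt0.
have nle : n%:R <= (20 + tau^-1) * (w * B ^+ 2).
  have h1 := Hn w w0; have h2 := ler_wpM2l (ltW w0) Ple.
  have h3 : Q / w ^+ 6 <= (gamma * R0) ^+ 2 / tau / w ^+ 6.
    by rewrite ler_wpM2r// invr_ge0 exprn_ge0// ltW.
  have h4 : (gamma * R0) ^+ 2 / tau / w ^+ 6 = tau^-1 * (w * B ^+ 2).
    by rewrite -w7; field; rewrite !gt_eqF.
  by rewrite h4 in h3; lra.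
have n7 : n%:R ^+ 7 <= (20 + tau^-1) ^+ 7 * (gamma * R0 * A) ^+ 2.
  have -> : (20 + tau^-1) ^+ 7 * (gamma * R0 * A) ^+ 2 = ((20 + tau^-1) * (w * B ^+ 2))
      ^+ 7.
    by rewrite [(gamma * R0 * A) ^+ 2]exprMn -w7 -BE; ring.
  by rewrite ler_pXn2r// ?nnegrE// (le_trans _ nle).
(* lambda' = lam 2^(u - n) <= 2 A together with the lower bound on lam gives 4^(u - n) <= (4 / tau)
   (gamma R0 A)^2. *)
have j7 : (u - n)%:R ^+ 7 <= 5 ^+ 7 * (4 / tau) * (gamma * R0 * A) ^+ 2.
  have [un|nu] := leqP u n.
    rewrite (eqP un) expr0n /=; apply: mulr_ge0 (sqr_ge0 _).
    by apply: mulr_ge0; [exact: exprn_ge0 | exact: divr_ge0 (ltW t0)].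
  apply: (le_trans (seventh_power_le R _)); rewrite -mulrA ler_wpM2l ?exprn_ge0//.
  have e1 : st_lambda' s = lam * 2 ^+ (u - n).
    have : st_lambda' s * 2 ^+ n = lam * 2 ^+ (u - n) * 2 ^+ n.
      by rewrite lamE -mulrA -exprD subnK// ltnW.
    by move/mulIf; apply; rewrite expf_neq0.
  have e2 : 4 ^+ (u - n) = (2 ^+ (u - n)) ^+ 2 :> R.
    by rewrite -exprM mulnC exprM; congr (_ ^+ _); lra.
  rewrite e2 mulrAC ler_pdivlMr//.
  have q0 : 0 <= 2 ^+ (u - n) :> R by rewrite exprn_ge0.
  have h1 : (lam * 2 ^+ (u - n)) ^+ 2 <= (2 * A) ^+ 2.
    by rewrite ler_pXn2r// ?nnegrE ?mulr_ge0 ?(ltW lam0) ?(ltW A0)// -e1.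
  have := ler_wpM2r (sqr_ge0 (2 ^+ (u - n))) tle.
  have := ler_wpM2r (sqr_ge0 (gamma * R0)) h1.
  lra.
(* The subtraction is truncated, and u <= n + (u - n) holds in either case. *)
have tle2 : t%:R <= 2 * n%:R + (u - n)%:R :> R.
  rewrite -natrM -natrD ler_nat -unt mul2n -addnn.
  by rewrite -addnA -maxnE addnC leq_add2l leq_maxr.
have X0 : 0 <= (gamma * R0 * A) ^+ 2 by exact: sqr_ge0.
have n0 : 0 <= n%:R :> R by []; have j0 : 0 <= (u - n)%:R :> R by [].
have t70 : t%:R ^+ 7 <= (2 * n%:R + (u - n)%:R) ^+ 7 :> R.
  by rewrite ler_pXn2r// ?nnegrE ?addr_ge0 ?mulr_ge0.
have nn70 := exprn_ge0 7 n0; have jj70 := exprn_ge0 7 j0.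
have e10 : (10 : R) ^+ 7 = 2 ^+ 7 * 5 ^+ 7 by rewrite -exprMn; congr (_ ^+ _); lra.
have e4 : (4 : R) ^+ 7 = 2 ^+ 7 * 2 ^+ 7 by rewrite -exprMn; congr (_ ^+ _); lra.
rewrite (le_trans t70)// /outer_constant e10 e4 mulrDl.
have n70 : 0 <= (20 + tau^-1) ^+ 7 * (gamma * R0 * A) ^+ 2 := le_trans nn70 n7.
have j70 : 0 <= 5 ^+ 7 * (4 / tau) * (gamma * R0 * A) ^+ 2 := le_trans jj70 j7.
move: n7 j7 n70 j70; move: ((20 + tau^-1) ^+ 7) (5 ^+ 7) => a b n7 j7 n70 j70.
have c2 : 0 <= 2 ^+ 7 :> R by rewrite exprn_ge0.
have c22 := mulr_ge0 c2 c2.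
have n7' := ler_wpM2l c22 n7; have j7' := ler_wpM2l c2 j7.
have n70' := mulr_ge0 c22 n70; have j70' := mulr_ge0 c2 j70.
have [nj|jn] := leP (2 * n%:R) ((u - n)%:R : R).
  have : (2 * n%:R + (u - n)%:R) ^+ 7 <= (2 * (u - n)%:R) ^+ 7 :> R.
    by rewrite ler_pXn2r// ?nnegrE ?addr_ge0 ?mulr_ge0//; lra.
  rewrite exprMn; lra.
have : (2 * n%:R + (u - n)%:R) ^+ 7 <= (4 * n%:R) ^+ 7 :> R.
  by rewrite ler_pXn2r// ?nnegrE ?addr_ge0 ?mulr_ge0//; lra.
rewrite exprMn e4; lra.
Qed.

(** A stop at y = xbar reduces the inexactness condition to a zero gradient. Otherwise a gap above
    eps would force A < R0^2 / (2 eps), against the growth of A. *)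
Lemma calen_returns_accuracy T out c (eps : R) : (0 < T)%N -> 0 < eps ->
  outer_constant * (gamma * R0 ^+ 3) ^+ 2 <= T%:R ^+ 7 * (2 * eps) ^+ 2 ->
  calen_returns gamma f sub x0 T out c -> f out - f xstar <= eps.
Proof.
move=> T0 e0 HT.
have stop x y c' : sub x y c' -> y = x -> f y - f xstar <= eps.
  move=> suby yx; have := sub_inexact suby.
  rewrite yx subrr l2norm0 expr0n /= mulr0 /cube_grad !scaler0 addr0 => h.
  have g0 : grad f x = 0 by apply: l2norm_eq0; apply/eqP; rewrite eq_le h l2norm_ge0.
  by have := stationary_minimizer cf xstar g0; lra.
case=> [y c' TE|s c' rs|y c' _ suby yx|t s c1 y c2 _ _ suby yx].
- by rewrite TE in T0.
- have [A0 Ef T7] := outer_growth rs; have g0 := gamma_gt0; have K0 := outer_constant_gt0.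
  have R00 := l2norm_ge0 (x0 - xstar).
  rewrite leNgt; apply/negP => lt.
  have h1 : st_A s * eps < 2^-1 * R0 ^+ 2.
    by rewrite (lt_le_trans _ Ef)// ltr_pM2l.
  have R0p : 0 < R0.
    rewrite lt_def R00 andbT; apply/eqP => R0E; move: h1.
    by rewrite R0E expr0n /= mulr0 ltNge mulr_ge0// ltW.
  have h2 : (gamma * R0 * st_A s * (2 * eps)) ^+ 2 < (gamma * R0 ^+ 3) ^+ 2.
    have a1 : 0 <= gamma * R0 * st_A s * (2 * eps).
      by apply: ltW; apply: mulr_gt0 (mulr_gt0 (mulr_gt0 g0 R0p) A0) (mulr_gt0 _ e0).
    have a2 : 0 <= gamma * R0 ^+ 3 by rewrite mulr_ge0 ?(ltW g0)// exprn_ge0.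
    rewrite ltr_pXn2r//.
    have h := h1; rewrite -(ltr_pM2l (mulr_gt0 g0 R0p)) in h.
    by move: h; move: (gamma) (l2norm _) (st_A s) => a b e h; lra.
  have h3 : outer_constant * (gamma * R0 * st_A s * (2 * eps)) ^+ 2 < outer_constant *
      (gamma * R0 ^+ 3) ^+ 2.
    by rewrite ltr_pM2l.
  by have := ler_wpM2r (sqr_ge0 (2 * eps)) T7; lra.
- exact: stop suby yx.
- exact: stop suby yx.
Qed.

End calen_rate.

(** * Choice of the parameters *)

Section parameters.
Variable R : realType.

(* c_N = 2 * 35^2 makes a run of NALEN shrink the gap of the regularized function by
   a factor 3; c_S = 39 / ln 3 turns 3^S into at least the 39th power of the argument
   of the logarithm defining S. *)
Definition calen_constants : constants R :=
  Constants 1 (39 / ln 3) (2 * 35 ^+ 2) 1 1 8^-1.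

Lemma ln_gt0_of_gt1 (x : R) : 1 < x -> 0 < ln x.
Proof. by move=> x1; rewrite -ln1 ltr_ln// posrE// (lt_trans ltr01). Qed.

Lemma calen_constants_positive : positive_constants calen_constants.
Proof.
by do 2!split => //=; rewrite ?divr_gt0 ?mulr_gt0 ?exprn_gt0 ?ln_gt0_of_gt1// ltr1n.
Qed.

(* W is the cube of the argument of the logarithm in S, so W^26 is at most 9^S. *)
Lemma power_budget (sg Y W : R) : 3 <= Y -> 0 < sg -> sg <= 1 -> W = Y ^+ 2 / sg ^+ 3 ->
  (128 * 192) ^+ 3 * Y ^+ 3 <= W ^+ 26 * sg ^+ 3.
Proof.
move=> y3 s0 s1 WE; have s3 : 0 < sg ^+ 3 by rewrite exprn_gt0.
have s31 : sg ^+ 3 <= 1 by rewrite exprn_ile1 ?(ltW s0).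
have y0 : 0 <= Y by rewrite (le_trans _ y3).
have Y9 : 3 ^+ 2 <= Y ^+ 2 by rewrite ler_pXn2r ?nnegrE.
have W9 : 9 <= W by rewrite WE ler_pdivlMr//; lra.
(* Two of the 26 factors W pay for Y^3 / sg^3, the other 24 for the numerical constant. *)
have W2 : Y ^+ 3 <= W ^+ 2 * sg ^+ 3.
  have -> : W ^+ 2 * sg ^+ 3 = Y ^+ 3 * (Y / sg ^+ 3).
    by rewrite WE; field; rewrite gt_eqF.
  by rewrite ler_peMr ?exprn_ge0 ?ler_pdivlMr//; lra.
have W24 : (128 * 192) ^+ 3 <= W ^+ 24.
  have h1 : 128 * 192 <= 9 ^+ 6 :> R.
    by rewrite (exprD 9 3 3) ler_pM// -natrX ler_nat.
  have h2 : (128 * 192) ^+ 3 <= (9 ^+ 6) ^+ 3 :> R.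
    by rewrite ler_pXn2r ?nnegrE ?exprn_ge0.
  rewrite (le_trans h2)// -exprM (@le_trans _ _ (9 ^+ 24))//.
    by rewrite ler_weXn2l// ler1n.
  by rewrite ler_pXn2r ?nnegrE// (le_trans _ W9).
by rewrite (exprD W 24 2) -mulrA ler_pM// ?exprn_ge0 ?mulr_ge0.
Qed.

Variables (sigma L : R) (m : nat).
Hypotheses (sigma_gt0 : 0 < sigma) (sigma_le1 : sigma <= 1).
Hypotheses (L_gt0 : 0 < L) (m_ge2 : (2 <= m)%N).

Local Notation q := (m%:R : R).
Local Notation mu := (q `^ (1 / 3)).
Local Notation gamma := (calen_gamma calen_constants L m).
Local Notation S := (calen_S calen_constants sigma L m).
Local Notation N := (calen_N calen_constants L m).
Local Notation M := (L + 2 * gamma).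
Local Notation Y := (mu ^+ 4 + 2).

Let m_gt0 : (0 < m)%N. Proof. exact: leq_trans m_ge2. Qed.
Let q2 : 2 <= q. Proof. by rewrite ler_nat. Qed.
Let mu1 : 1 <= mu. Proof. exact: mu_ge1. Qed.

Lemma calen_gammaE : gamma = L / mu ^+ 4.
Proof.
have e : 1 / 3 * 4%:R = 4 / 3 :> R by lra.
by rewrite /calen_gamma [c_gamma _]/= mul1r (powR_natX _ e).
Qed.

Lemma calen_gamma_gt0 : 0 < gamma.
Proof. by have m1 := mu1; rewrite calen_gammaE divr_gt0 ?exprn_gt0//; lra. Qed.

Lemma calen_ratioE : M / gamma = Y.
Proof.
have m1 := mu1; have mu0 : mu != 0 by rewrite gt_eqF//; lra.
have L0 := L_gt0; rewrite calen_gammaE; field; rewrite mu0 gt_eqF//.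
Qed.

Lemma calen_ratio_ge3 : 3 <= Y.
Proof. by have : 1 <= mu ^+ 4 by [rewrite exprn_ege1//; exact: mu1]; lra. Qed.

Let M_gt0 : 0 < M.
Proof. by have := calen_gamma_gt0; have := L_gt0; lra. Qed.

Let N_arg_ge : mu <= mu * Num.sqrt Y.
Proof.
rewrite ler_peMr//.
by rewrite -[leLHS]sqrtr1 ler_wsqrtr//; have := calen_ratio_ge3; lra.
Qed.

Lemma calen_N_ge : 2 * 35 ^+ 2 * (mu * Num.sqrt Y) <= N%:R.
Proof.
have a0 : 0 <= 2 * 35 ^+ 2 :> R by rewrite mulr_ge0// exprn_ge0.
by rewrite /calen_N calen_ratioE nat_ceil_ge// !mulr_ge0 ?sqrtr_ge0.
Qed.

Lemma calen_T'_le : (nalen_T' calen_constants m <= N)%N.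
Proof.
have /andP[_ T2] := @nalen_T'_bounds R calen_constants m erefl m_gt0.
have := calen_N_ge; have := N_arg_ge; have m1 := mu1 => h1 h2.
rewrite -(ler_nat R); lra.
Qed.

Lemma calen_N_sqr : 4 * 35 ^+ 4 * mu ^+ 2 * M <= gamma * N%:R ^+ 2.
Proof.
have g0 := calen_gamma_gt0; have y3 := calen_ratio_ge3; have m1 := mu1.
have Y0 : 0 <= Y by lra.
have ME : M = gamma * Y by rewrite -calen_ratioE [RHS]mulrC divfK// gt_eqF.
have a0 : 0 <= 2 * 35 ^+ 2 * (mu * Num.sqrt Y).
  have := N_arg_ge => h; apply: mulr_ge0; last by lra.
  by rewrite mulr_ge0// exprn_ge0.
have : (2 * 35 ^+ 2 * (mu * Num.sqrt Y)) ^+ 2 <= N%:R ^+ 2.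
  by rewrite ler_pXn2r// ?nnegrE//; exact: calen_N_ge.
move/(ler_wpM2l (ltW g0)); apply: le_trans.
rewrite ME [(2 * _ * _) ^+ 2]exprMn [(mu * _) ^+ 2]exprMn (sqr_sqrtr Y0).
lra.
Qed.

(** sqrt (mu^4 + 2) <= 2 mu^2 and mu^3 = q, so N is linear in m. *)
Lemma calen_N_le : N%:R <= (4 * 35 ^+ 2 + 1) * q.
Proof.
have m1 := mu1; have y3 := calen_ratio_ge3; have h := N_arg_ge.
have a0 : 0 <= 2 * 35 ^+ 2 * (mu * Num.sqrt Y).
  by apply: mulr_ge0; [rewrite mulr_ge0// exprn_ge0 | lra].
have := nat_ceil_le a0; rewrite /calen_N calen_ratioE.
have s2 : Num.sqrt Y <= 2 * mu ^+ 2.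
  have mu2 : 0 <= 2 * mu ^+ 2 by rewrite mulr_ge0 ?sqr_ge0.
  rewrite -(ger0_norm mu2) -sqrtr_sqr ler_wsqrtr//.
  by have : 1 <= mu ^+ 4 by [exact: exprn_ege1]; lra.
have mu0 : 0 <= mu by lra.
have := ler_wpM2l mu0 s2; have := cube_root (ler0n R m); have := q2.
set sY := Num.sqrt Y => e1 e2 e3 e4.
lra.
Qed.

Local Notation X := (1 / sigma * Y `^ (2 / 3)).

Let Y1 : 1 <= Y. Proof. by have := calen_ratio_ge3; lra. Qed.

Lemma calen_X_cube : X ^+ 3 = Y ^+ 2 / sigma ^+ 3.
Proof.
have y0 : 0 <= Y by have := Y1; lra.
have e : 2 / 3 * 3%:R = 2%:R :> R by lra.
by rewrite exprMn (powR_natX y0 e) powR_mulrn// div1r exprVn mulrC.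
Qed.

Lemma calen_X_ge1 : 1 <= X.
Proof.
have h1 : 1 <= Y `^ (2 / 3) by rewrite -[leLHS](powRr0 Y) ler_powR.
have h2 : 1 <= 1 / sigma by rewrite ler_pdivlMr// mul1r.
by rewrite (le_trans h1)// ler_peMl// (le_trans ler01).
Qed.

Lemma calen_S_ge : X ^+ 39 <= 3 ^+ S.
Proof.
have ln30 : 0 < ln 3 :> R by rewrite ln_gt0_of_gt1// ltr1n.
have X0 : 0 < X by have := calen_X_ge1; lra.
have lnX : 0 <= ln X by rewrite ln_ge0// calen_X_ge1.
rewrite -ler_ln ?posrE ?exprn_gt0//.
rewrite !lnXn// -[_ *+ 39]mulr_natr -[_ *+ S]mulr_natl.
have a0 : 0 <= 39 / ln 3 * ln X by rewrite mulr_ge0// divr_ge0// ltW.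
have := nat_ceil_ge a0; rewrite -/(calen_S _ _ _ _).
have -> : nat_ceil (39 / ln 3 * ln X) = S by rewrite /calen_S calen_ratioE.
move/(ler_wpM2r (ltW ln30)); rewrite mulrAC divfK ?gt_eqF//; lra.
Qed.

Lemma calen_S_pow : (128 * 192 * M) ^+ 3 <= 9 ^+ S * (sigma * gamma) ^+ 3.
Proof.
have g0 := calen_gamma_gt0; have X1 := calen_X_ge1.
have ME : M = gamma * Y by rewrite -calen_ratioE [RHS]mulrC divfK// gt_eqF.
have h9 : (X ^+ 3) ^+ 26 <= 9 ^+ S.
  have -> : (9 : R) ^+ S = (3 ^+ S) ^+ 2 by rewrite -exprM mulnC exprM; congr (_ ^+ _); lra.
  have -> : (X ^+ 3) ^+ 26 = (X ^+ 39) ^+ 2 by rewrite -!exprM.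
  by rewrite ler_pXn2r ?nnegrE ?exprn_ge0// ?(le_trans ler01)//; exact: calen_S_ge.
have g3 : 0 <= (sigma * gamma) ^+ 3 by rewrite exprn_ge0// mulr_ge0// ltW.
apply: le_trans (ler_wpM2r g3 h9).
have -> : (128 * 192 * M) ^+ 3 = (128 * 192) ^+ 3 * Y ^+ 3 * gamma ^+ 3.
  by rewrite ME exprMn (exprMn 3 gamma) mulrA mulrAC.
rewrite (exprMn 3 sigma) [leRHS]mulrA; apply: ler_wpM2r; first by rewrite exprn_ge0
    ?(ltW g0).
exact: power_budget calen_ratio_ge3 sigma_gt0 sigma_le1 calen_X_cube.
Qed.

(** As ln 2 <= ln m, dividing by ln 2 turns additive constants into multiples of ln m. The 4 comes
    from Y <= q^4, the 2 from rounding up and from the extra run. *)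
Definition log_factor : R := 39 / ln 3 * (ln (1 / sigma) / ln 2 + 4) + 2 / ln 2.

Lemma calen_S_le : S.+1%:R <= log_factor * ln q.
Proof.
have ln30 : 0 < ln 3 :> R by rewrite ln_gt0_of_gt1// ltr1n.
have ln20 : 0 < ln 2 :> R by rewrite ln_gt0_of_gt1// ltr1n.
have X1 := calen_X_ge1; have X0 : 0 < X by lra.
have lnX0 : 0 <= ln X by rewrite ln_ge0.
have a0 : 0 <= 39 / ln 3 * ln X by rewrite mulr_ge0// divr_ge0// ltW.
have lnq : ln 2 <= ln q by rewrite ler_ln ?posrE//; have := q2; lra.
have := nat_ceil_le a0.
have -> : nat_ceil (39 / ln 3 * ln X) = S by rewrite /calen_S calen_ratioE.
have is0 : 0 < 1 / sigma by rewrite divr_gt0.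
have is1 : 1 <= 1 / sigma by rewrite ler_pdivlMr// mul1r.
have lns : 0 <= ln (1 / sigma) by rewrite ln_ge0.
have y1 := Y1; have y0 : 0 < Y by lra.
have Yq : Y <= q ^+ 4.
  have m1 := mu1; have e3 := cube_root (ler0n R m); have q2' := q2.
  have h1 : mu ^+ 4 <= (mu ^+ 3) ^+ 2 by rewrite -exprM ler_weXn2l.
  rewrite e3 in h1.
  have h2 : 2 ^+ 2 <= q ^+ 2 by rewrite ler_pXn2r// ?nnegrE.
  have : 4 * q ^+ 2 <= q ^+ 2 * q ^+ 2 by rewrite ler_wpM2r ?sqr_ge0//; lra.
  lra.
have lnXle : ln X <= ln (1 / sigma) + 4 * ln q.
  rewrite lnM ?posrE ?powR_gt0// lerD2l ln_powR.
  have : ln Y <= ln (q ^+ 4) by rewrite ler_ln ?posrE// exprn_gt0//; have := q2; lra.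
  rewrite lnXn; last by have := q2; lra.
  rewrite -[ln q *+ 4]mulr_natl => h.
  have lY0 : 0 <= ln Y by rewrite ln_ge0.
  lra.
have h1 : ln (1 / sigma) <= ln (1 / sigma) / ln 2 * ln q.
  by rewrite mulrAC ler_pdivlMr// ler_wpM2l.
have h2 : 2 <= 2 / ln 2 * ln q.
  by rewrite mulrAC ler_pdivlMr// ler_wpM2l.
have c0 : 0 <= 39 / ln 3 :> R by rewrite divr_ge0// ltW.
have h3 := ler_wpM2l c0 lnXle; have h4 := ler_wpM2l c0 h1.
rewrite /log_factor -natr1; lra.
Qed.

Lemma log_factor_gt0 : 0 < log_factor.
Proof.
have ln30 : 0 < ln 3 :> R by rewrite ln_gt0_of_gt1// ltr1n.
have ln20 : 0 < ln 2 :> R by rewrite ln_gt0_of_gt1// ltr1n.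
have is1 : 1 <= 1 / sigma by rewrite ler_pdivlMr// mul1r.
rewrite /log_factor addr_gt0 ?divr_gt0// mulr_gt0 ?divr_gt0// ltr_wpDl//.
by apply: divr_ge0; [exact: ln_ge0 | exact: ltW].
Qed.

End parameters.

(** * Counting of Hessian evaluations and of outer iterations *)

Lemma count_period_start m N : (0 < m)%N ->
  (count (fun n => period_start m n == n) (iota 0 N) * m <= N + m)%N.
Proof.
move=> m0; suff le : (count (fun n => period_start m n == n) (iota 0 N) <= (N + m.-1) %/
    m)%N.
  rewrite (leq_trans (leq_mul le (leqnn m)))// (leq_trans (leq_trunc_div _ _))//.
  by rewrite leq_add2l leq_pred.
elim: N => [//|N ih]; rewrite -addn1 iotaD count_cat /= add0n addn0.
have [E|_] := eqVneq (period_start m N) N; last first.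
  by rewrite addn0 (leq_trans ih)// leq_div2r// -addnA leq_add2l add1n leqnSn.
have /dvdnP[j Nj] : (m %| N)%N.
  rewrite /dvdn -(eqn_add2l (N - N %% m)) subnK ?leq_mod// addn0.
  by rewrite -/(period_start m N) E.
move: ih; rewrite Nj -addnA add1n prednK// -mulSnr mulnK//.
by rewrite divnMDl// divn_small ?prednK// addn0 addn1 ltnS.
Qed.

Section outer_iterations.
Variables (R : realType) (K L R0 eps : R) (m : nat).
Hypotheses (K_gt0 : 0 < K) (L_gt0 : 0 < L) (R0_ge0 : 0 <= R0) (eps_gt0 : 0 < eps).
Hypothesis m_gt0 : (0 < m)%N.

Local Notation q := (m%:R : R).
Local Notation mu := (q `^ (1 / 3)).
Local Notation gamma := (calen_gamma (calen_constants R) L m).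
Local Notation U := (q `^ (13 / 21) * (L * R0 ^+ 3 / eps) `^ (2 / 7)).

(** The real number of iterations at which the accuracy condition is an equality. *)
Let Z : R := (K * (gamma * R0 ^+ 3 / (2 * eps)) ^+ 2) `^ (1 / 7).

Let Z7 : Z ^+ 7 = K * (gamma * R0 ^+ 3 / (2 * eps)) ^+ 2.
Proof.
have a0 : 0 <= K * (gamma * R0 ^+ 3 / (2 * eps)) ^+ 2 by rewrite mulr_ge0 ?sqr_ge0
    ?(ltW K_gt0).
have e : 1 / 7 * 7%:R = 1 :> R by lra.
by rewrite /Z (powR_natX a0 e) powRr1.
Qed.

(** The successor keeps T positive even when Z = 0; CALEN with T = 0 would just return x0. *)
Definition outer_iterations : nat := (nat_ceil Z).+1.

Lemma outer_iterations_ge :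
  K * (gamma * R0 ^+ 3) ^+ 2 <= outer_iterations%:R ^+ 7 * (2 * eps) ^+ 2.
Proof.
have Z0 : 0 <= Z := powR_ge0 _ _.
have ZT : Z <= outer_iterations%:R by rewrite -natr1; have := nat_ceil_ge Z0; lra.
have : Z ^+ 7 <= outer_iterations%:R ^+ 7 by rewrite ler_pXn2r ?nnegrE.
move/(ler_wpM2r (sqr_ge0 (2 * eps))); apply: le_trans; rewrite Z7.
by rewrite le_eqVlt; apply/orP; left; apply/eqP; field; rewrite gt_eqF.
Qed.

(** Z^7 contains gamma^2, hence mu^-8, and q^7 = mu^21: the remaining mu^13 is the source of the
    exponent 13/21. *)
Lemma outer_iterations_le : outer_iterations%:R * q <= (3 + K) * (q + U).
Proof.
have Z0 : 0 <= Z := powR_ge0 _ _; have K0 := K_gt0; have L0 := L_gt0; have e0 := eps_gt0.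
have q0 : 0 <= q by []; have mu1 := mu_ge1 R m_gt0.
set rho := L * R0 ^+ 3 / eps.
have rho0 : 0 <= rho by rewrite divr_ge0 ?(ltW e0)// mulr_ge0 ?(ltW L0)// exprn_ge0.
have gE : gamma * R0 ^+ 3 / (2 * eps) = rho / (2 * mu ^+ 4).
  have mu0 : mu != 0 by rewrite gt_eqF//; lra.
  by rewrite calen_gammaE /rho; field; rewrite mu0 gt_eqF.
have e1 : 13 / 21 * 7%:R = 13 / 3 :> R by lra.
have e2 : 1 / 3 * 13%:R = 13 / 3 :> R by lra.
have e3 : 2 / 7 * 7%:R = 2%:R :> R by lra.
have U7 : U ^+ 7 = mu ^+ 13 * rho ^+ 2.
  by rewrite exprMn (powR_natX q0 e1) (powR_natX rho0 e3) powR_mulrn// (powR_natX q0 e2).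
have qZ : (q * Z) ^+ 7 = K / 4 * U ^+ 7.
  have mu0 : mu != 0 by rewrite gt_eqF//; lra.
  rewrite U7 exprMn Z7 gE -{1}(cube_root q0); field.
  by rewrite mu0.
have U0 : 0 <= U by rewrite mulr_ge0// powR_ge0.
move: qZ U0 {U7}; move: (U) => V qZ V0.
have qZU : q * Z <= (K + 1) * V.
  have K1 : 1 <= K + 1 by lra.
  have qZ0 : 0 <= q * Z by rewrite mulr_ge0.
  have KU0 : 0 <= (K + 1) * V by rewrite mulr_ge0//; lra.
  rewrite -(@ler_pXn2r _ 7)// qZ (exprMn 7 (K + 1)); apply: ler_wpM2r; first exact:
      exprn_ge0.
  have : K + 1 <= (K + 1) ^+ 7 by rewrite ler_eXnr.
  lra.
have := nat_ceil_le Z0; rewrite /outer_iterations -natr1 => Zle.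
have := ler_wpM2r q0 Zle; have := mulr_ge0 (ltW K0) q0; lra.
Qed.

End outer_iterations.

(** * Assembly of the bounds *)

Lemma calen_spec (R : realType) (sigma : R) (d : nat) (f : 'rV[R]_d -> R) (L eps : R)
    (xstar x0 : 'rV[R]_d) (m : nat) (k := calen_constants R) (R0 := l2norm (x0 - xstar))
    (S := calen_S k sigma L m) (N := calen_N k L m) :
  0 < sigma -> sigma <= 99 / 100 ->
  convex_function setT f -> twice_differentiable f -> 0 < L -> lipschitz_hessian L f ->
  (forall x, f xstar <= f x) -> 0 < eps -> (2 <= m)%N ->
  exists T : nat, [/\ (0 < T)%N,
    T%:R * m%:R <= (3 + outer_constant sigma) *
      (m%:R + m%:R `^ (13 / 21) * (L * R0 ^+ 3 / eps) `^ (2 / 7)),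
    (exists out c, calen k sigma L m f x0 T out c),
    (forall out c, calen k sigma L m f x0 T out c -> f out - f xstar <= eps) &
    forall (phi : cost -> R) B, phi no_cost = 0 ->
      {morph phi : c c' / add_cost c c' >-> c + c'} -> 0 <= B ->
      0 <= phi (Cost 0 1 1) -> 0 <= phi (Cost 0 0 1) -> phi (nalen_cost k m N) <= B ->
      forall out c, calen k sigma L m f x0 T out c ->
        phi c <= T%:R * (phi (Cost 0 1 1) + S.+1%:R * B + phi (Cost 0 0 1))].
Proof.
move=> s0 s99 cf d2f L0 fL fmin e0 m2.
have s1 : sigma <= 1 by lra.
have t0 : 0 < 1 - sigma ^+ 2.
  have : sigma ^+ 2 <= (99 / 100) ^+ 2 by rewrite ler_pXn2r// nnegrE ?(ltW s0)//; lra.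
  lra.
have m0 : (0 < m)%N := leq_trans (isT : 0 < 2)%N m2.
have g0 := calen_gamma_gt0 L0 m2.
have H2 := lipschitz_hessian_second_order d2f fL (ltW L0).
have tan := convex_above_tangent d2f.1 (ltW L0) H2 cf.
have TN := calen_T'_le L0 m2.
have inexact x y c : subsolver k m L (calen_gamma k L m) S N f x y c ->
    l2norm (grad f y + calen_gamma k L m *: cube_grad (y - x)) <=
    sigma * calen_gamma k L m * l2norm (y - x) ^+ 2.
  apply: (@subsolver_inexact R d k m S N L _ sigma f xstar x) => //.
  - exact: calen_N_sqr.
  - exact: calen_S_pow.
have ex x : exists y c, subsolver k m L (calen_gamma k L m) S N f x y c.
  exact: (@subsolver_exists R d k m S N L (calen_gamma k L m) f xstar x).
have K0 := outer_constant_gt0 t0.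
exists (outer_iterations (outer_constant sigma) L R0 eps m); split => //.
- by apply: outer_iterations_le => //; exact: l2norm_ge0.
- exact: calen_returns_exists.
- move=> out c; apply: (calen_returns_accuracy g0 t0 tan fmin inexact) => //.
  exact: outer_iterations_ge.
- move=> phi B phi0 phiD B0 p1 p2 pB out c.
  apply: calen_returns_cost => //.
    by rewrite addr_ge0// mulr_ge0.
  by move=> x y c'; exact: subsolver_cost.
Qed.

Lemma calen_rate_budget (R : realType) (L R0 eps q T S1 X lf c K : R) :
  1 <= q -> 0 <= T -> 0 <= S1 -> 0 <= X -> 0 <= c -> 0 <= lf ->
  T * q <= K * (q + q `^ (13 / 21) * (L * R0 ^+ 3 / eps) `^ (2 / 7)) ->
  S1 <= lf * ln q -> X <= c * q ->
  T * (S1 * X) <= c * lf * K * calen_rate L R0 eps q.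
Proof.
move=> q1 T0 S0 X0 c0 lf0 HT HS HX; rewrite /calen_rate.
have lq0 : 0 <= ln q by rewrite ln_ge0.
have h1 : T * (S1 * X) <= T * (lf * ln q * (c * q)) by rewrite ler_wpM2l// ler_pM.
have h2 : 0 <= c * lf * ln q by rewrite !mulr_ge0.
have := ler_wpM2l h2 HT; move: h1; move: (_ `^ (13 / 21)) (_ `^ (2 / 7)) (ln q) => a b
    l; lra.
Qed.

(** Replaces m by dbar after rounding up: 2 p <= p^2 gives ln q <= 2 ln p, and the other factor at
    most doubles too. *)
Lemma calen_rate_double (R : realType) (L R0 eps p q : R) :
  2 <= p -> 1 <= q -> q <= 2 * p ->
  calen_rate L R0 eps q <= 4 * calen_rate L R0 eps p.
Proof.
move=> p2 q1 qp; rewrite /calen_rate; set r := _ `^ (2 / 7).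
have r0 : 0 <= r := powR_ge0 _ _.
have lnq : ln q <= 2 * ln p.
  have : ln q <= ln (p * p).
    by rewrite ler_ln ?posrE ?mulr_gt0 ?(lt_le_trans ltr01 q1) ?(lt_le_trans _ p2)//;
      have := ler_wpM2r (_ : 0 <= p) p2; move=> /(_ (le_trans (ler0n R 2) p2)); lra.
  by rewrite lnM ?posrE ?(lt_le_trans _ p2)//; lra.
have pq : q `^ (13 / 21) <= 2 * p `^ (13 / 21).
  have p0 : 0 <= p by lra.
  have h1 : q `^ (13 / 21) <= (2 * p) `^ (13 / 21).
    by apply: ge0_ler_powR; rewrite ?nnegrE ?mulr_ge0//; lra.
  have h2 : 2 `^ (13 / 21) <= 2 `^ 1 :> R by apply: ler_powR; lra.
  rewrite powRM// powRr1// in h1 h2.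
  by have := ler_wpM2r (powR_ge0 p (13 / 21)) h2; lra.
have h1 : q + q `^ (13 / 21) * r <= 2 * (p + p `^ (13 / 21) * r).
  by have := ler_wpM2r r0 pq; lra.
have h0 : 0 <= q + q `^ (13 / 21) * r.
  by rewrite addr_ge0 ?mulr_ge0 ?powR_ge0//; lra.
have := ler_pM h0 (ln_ge0 q1) h1 lnq; lra.
Qed.

Theorem theorem5p1 (R : realType) (sigma : R)
    (sigma_gt0 : 0 < sigma) (sigma_le : sigma <= 99 / 100) :
  exists (k : constants R) (C c_m C' : R),
    [/\ positive_constants k, 0 < C, 0 < c_m & 0 < C'] /\
    forall (d : nat) (f : 'rV[R]_d -> R) (L eps : R) (xstar x0 : 'rV[R]_d),
      convex_function setT f -> twice_differentiable f ->
      0 < L -> lipschitz_hessian L f ->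
      (forall x, f xstar <= f x) -> 0 < eps ->
      let R0 := l2norm (x0 - xstar) in
      (forall m : nat, (2 <= m)%N ->
         exists T : nat,
           [/\ exists out c, calen k sigma L m f x0 T out c,
               (T * calen_S k sigma L m * calen_N k L m)%:R
                 <= C * calen_rate L R0 eps m%:R &
               forall out c, calen k sigma L m f x0 T out c ->
                 f out - f xstar <= eps /\
                 (n_iter c)%:R <= C * calen_rate L R0 eps m%:R])
      /\
      (forall c_H c_g : R, 0 < c_H -> 0 < c_g ->
         let dbar := c_H / c_g in
         2 <= dbar -> dbar <= d%:R ->
         let m := nat_ceil (c_m * dbar) in
         (2 <= m)%N /\
         exists T : nat,
           (exists out c, calen k sigma L m f x0 T out c) /\
           forall out c, calen k sigma L m f x0 T out c ->
             f out - f xstar <= eps /\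
             equivalent_gradients dbar c <= C' * calen_rate L R0 eps dbar).
Proof.
have s1 : sigma <= 1 by lra.
have t0 : 0 < 1 - sigma ^+ 2.
  have : sigma ^+ 2 <= (99 / 100) ^+ 2 by rewrite ler_pXn2r// nnegrE ?(ltW sigma_gt0)//;
      lra.
  lra.
have lf0 := log_factor_gt0 sigma_gt0 s1; have K0 := outer_constant_gt0 t0.
set lf := log_factor sigma in lf0; set K := outer_constant sigma in K0.
have K3 : 0 < 3 + K by lra.
(* [cB] covers one NALEN run in equivalent gradients: at most N + m for the Hessians and 1 + 3 N for
   the gradients. *)
pose cN : R := 4 * 35 ^+ 2 + 1; pose cB : R := 4 * cN + 2.
have cN0 : 0 < cN by rewrite addr_gt0// mulr_gt0// exprn_gt0.
have cB0 : 0 < cB by rewrite addr_gt0// mulr_gt0.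
have cB3 : 0 < cB + 3 by rewrite addr_gt0.
exists (calen_constants R), (cN * lf * (3 + K)), 1, (4 * ((cB + 3) * lf * (3 + K))).
have C0 := mulr_gt0 (mulr_gt0 cN0 lf0) K3; have C'0 := mulr_gt0 (mulr_gt0 cB3 lf0) K3.
split; first by split; [exact: calen_constants_positive | | | exact: mulr_gt0].
move=> d f L eps xstar x0 cf d2f L0 fL fmin e0 R0; split=>
    [m m2|cH cg cH0 cg0 dbar dbar2 _ m].
  have [T [T0 HT ex acc HC]] := calen_spec x0 sigma_gt0 sigma_le cf d2f L0 fL fmin e0 m2.
  exists T; have HS := calen_S_le sigma_gt0 s1 L0 m2; have HN := @calen_N_le R L m L0 m2.
  have m1 : 1 <= m%:R :> R by rewrite ler1n (leq_trans _ m2).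
  have budget : T%:R * ((calen_S (calen_constants R) sigma L m).+1%:R *
      (calen_N (calen_constants R) L m)%:R)
      <= cN * lf * (3 + K) * calen_rate L R0 eps m%:R.
    by apply: (calen_rate_budget m1) => //; exact: ltW.
  split => //.
    apply: le_trans budget; rewrite -!natrM ler_nat -mulnA leq_mul// leq_mul//.
  move=> out c run; split; first exact: acc run.
  have := HC (fun c => (n_iter c)%:R) (calen_N (calen_constants R) L m)%:R erefl _
      (ler0n _ _) (ler0n _ _) (ler0n _ _) (lexx _) out c run.
  rewrite /= add0r addr0 => h; apply: le_trans budget; apply: h.
  by move=> c1 c2; rewrite /= natrD.
have dm : dbar <= m%:R by rewrite /m mul1r nat_ceil_ge//; lra.
have md : m%:R <= dbar + 1 by rewrite /m mul1r nat_ceil_le//; lra.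
have m2 : (2 <= m)%N by rewrite -(ler_nat R); lra.
split => //; have m0 : (0 < m)%N := leq_trans (isT : 0 < 2)%N m2.
have [T [T0 HT ex acc HC]] := calen_spec x0 sigma_gt0 sigma_le cf d2f L0 fL fmin e0 m2.
exists T; split => // out c run; split; first exact: acc run.
have HS := calen_S_le sigma_gt0 s1 L0 m2; have HN := @calen_N_le R L m L0 m2.
move: HT HS HN HC run; set k := calen_constants R.
set S := calen_S k sigma L m; set N := calen_N k L m; set q : R := m%:R => HT HS HN HC run.
have q1 : 1 <= q by rewrite ler1n.
have nalenB : equivalent_gradients dbar (nalen_cost k m N) <= cB * q.
  rewrite /equivalent_gradients /=; set cnt := count _ _.
  have cntN : q * cnt%:R <= N%:R + q.
    by rewrite -natrM -natrD ler_nat mulnC count_period_start.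
  have KN : (nalen_K k m N)%:R <= N%:R :> R by rewrite ler_nat leq_div.
  have := ler_wpM2r (ler0n R cnt) dm; rewrite -/q !natrD.
  by rewrite -/cN in HN; rewrite /cB; lra.
have morph : {morph equivalent_gradients dbar : c c' / add_cost c c' >-> c + c'}.
  by move=> c1 c2; rewrite /equivalent_gradients /= !natrD; ring.
have eq0 : equivalent_gradients dbar no_cost = 0 by rewrite /equivalent_gradients /=
    mulr0 addr0.
have e11 : equivalent_gradients dbar (Cost 0 1 1) = dbar + 1 by rewrite
    /equivalent_gradients /= mulr1.
have e01 : equivalent_gradients dbar (Cost 0 0 1) = 1 by rewrite /equivalent_gradients
    /= mulr0 add0r.
have cBq : 0 <= cB * q by rewrite mulr_ge0 ?(ltW cB0)//; lra.
have := HC _ (cB * q) eq0 morph cBq _ _ nalenB out c run.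
rewrite e11 e01 => /(_ _ ler01) h; have {}h := h
    (addr_ge0 (le_trans (ler0n R 2) dbar2) ler01).
apply: (le_trans h).
have S1 : 1 <= S.+1%:R :> R by rewrite ler1n.
have X0 : 0 <= (cB + 3) * q by rewrite mulr_ge0 ?(ltW cB3)//; lra.
(* The 3 absorbs the oracle calls outside NALEN, dbar + 2 <= 3 m per outer iteration. *)
have step : T%:R * (dbar + 1 + S.+1%:R * (cB * q) + 1) <= T%:R * (S.+1%:R * ((cB + 3) * q)).
  rewrite ler_wpM2l//; have q0 : 0 <= q by lra.
  by have := ler_wpM2r q0 S1; lra.
apply: (le_trans step).
have budget := calen_rate_budget q1 (ler0n R T) (ler0n R S.+1) X0 (ltW cB3) (ltW lf0) HT
    HS (lexx _).
apply: (le_trans budget).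
have := calen_rate_double L R0 eps dbar2 q1 (_ : q <= 2 * dbar).
have qd : q <= 2 * dbar by lra.
move=> /(_ qd) dbl.
have c0 : 0 <= (cB + 3) * lf * (3 + K) by rewrite !mulr_ge0// ltW.
by rewrite -[leRHS]mulrA [leRHS]mulrCA; exact: ler_wpM2l.
Qed.
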